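(* Let $d,N\ge 1$ be integers, $0<\tau_1<\cdots<\tau_N<T$ real numbers, and let $D_1,\dots,D_N:\mathbb{R}\to\mathbb{C}^{d\times d}$ be $T$-periodic and differentiable with Hölder continuous derivative. Put $\omega=2\pi/T$ and, for $p\in\mathbb{C}$, let $R(p)$ be the bounded operator on $\ell^2(\mathbb{Z},\mathbb{C}^d)$ whose doubly infinite block matrix is $$R(p)=I_\infty-\Bigl(\sum_{j=1}^N e^{-(p-i\ell\omega)\tau_j}\,\check D_j(\ell-k)\Bigr)_{(k,\ell)\in\mathbb{Z}^2},\qquad \check D_j(k)=\frac1T\int_0^T D_j(t)e^{-ik\omega t}\,dt .$$ Then the system $$y(t)=\sum_{j=1}^N D_j(t)\,y(t-\tau_j),\qquad t>s,\qquad y(s+\theta)=\phi(\theta)\ \text{ for } -\tau_N\le\theta\le 0,$$ is exponentially stable if and only if there exists a real number $\beta<0$ such that: (i) $R(p):\ell^2(\mathbb{Z},\mathbb{C}^d)\to\ell^2(\mathbb{Z},\mathbb{C}^d)$ is invertible for each $p$ in $\{z\in\mathbb{C}:\Re(z)\ge\beta\}$; and (ii) there is a positive number $M$ such that $\|R(p)^{-1}\|\le M$ (operator norm on $\ell^2(\mathbb{Z},\mathbb{C}^d)$) for all $p$ in $\{z\in\mathbb{C}:\Re(z)\ge\beta\}$.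
   Context: $I_\infty$ is the identity of $\ell^2(\mathbb{Z},\mathbb{C}^d)$, the Hilbert space of square summable sequences $(z_j)_{j\in\mathbb{Z}}$ with $z_j\in\mathbb{C}^d$. In block matrices, $k$ is the block-row index and $\ell$ the block-column index. Solution operators. For $s\in\mathbb{R}$ let $C_s=\{\phi\in C^0([-\tau_N,0],\mathbb{C}^d):\ \phi(0)=\sum_{j=1}^N D_j(s)\phi(-\tau_j)\}$, with the sup norm. For $\phi\in C_s$ the system has a unique continuous solution $y$ on $[s-\tau_N,+\infty)$, and for $t\ge s$ one sets $(U(t,s)\phi)(\theta)=y(t+\theta)$, $\theta\in[-\tau_N,0]$; this defines $U(t,s):C_s\to C_t$. For $1\le q\le\infty$ and $\phi\in L^q([-\tau_N,0],\mathbb{C}^d)$ the system (required to hold for a.e. $t\geq s$) has a unique solution in $L^q_{\rm loc}([s-\tau_N,+\infty),\mathbb{C}^d)$, and $U_q(t,s)\phi\in L^q([-\tau_N,0],\mathbb{C}^d)$ is defined by $(U_q(t,s)\phi)(\theta)=y(t+\theta)$ for a.e. $\theta\in[-\tau_N,0]$. Exponential stability. The system is $C^0$-exponentially stable if there are $\gamma,K>0$ with $\|U(t,s)\phi\|_{C^0}\le Ke^{-\gamma(t-s)}\|\phi\|_{C^0}$ for all $s\in\mathbb{R}$, $t\ge s$, $\phi\in C_s$. It is $L^q$-exponentially stable if there are $\gamma,K>0$ with $\|U_q(t,s)\phi\|_{L^q}\le Ke^{-\gamma(t-s)}\|\phi\|_{L^q}$ for all $s\in\mathbb{R}$, $t\ge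 s$, $\phi\in L^q([-\tau_N,0],\mathbb{C}^d)$. These properties (for $C^0$ and for every $q\in[1,\infty]$) are known to be equivalent, and ''exponentially stable'' means that any one of them holds. *)

(* Defs.v *)
From HB Require Import structures.
From mathcomp Require Import all_boot all_order all_algebra.
From mathcomp Require Export complex.
From mathcomp Require Import all_classical all_reals all_analysis.

Set Implicit Arguments.
Unset Strict Implicit.
Unset Printing Implicit Defensive.

Import Order.TTheory GRing.Theory Num.Theory.
Import numFieldNormedType.Exports.

Local Open Scope classical_set_scope.
Local Open Scope ring_scope.

(** * Complex-valued functions

    [R[i]] carries no normed-module structure over [R], so calculus for
    functions [R -> 'M[R[i]]_(m, n)] is done on the real and imaginary parts of
    the entries. *)

Section ComplexAnalysis.
Variable R : realType.
Implicit Types (m n : nat).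

(** Euclidean norm on C^d (column vectors), Frobenius norm on matrices. *)
Definition enorm m n (A : 'M[R[i]]_(m, n)) : R :=
  Num.sqrt (\sum_i \sum_j (complex.Re (A i j) ^+ 2 + complex.Im (A i j) ^+ 2)).

Definition for_parts m n (P : (R -> R) -> Prop) (f : R -> 'M[R[i]]_(m, n)) :=
  forall i j, P (fun t => complex.Re (f t i j)) /\
              P (fun t => complex.Im (f t i j)).

Definition map_parts m n (F : (R -> R) -> R) (f : R -> 'M[R[i]]_(m, n)) :
    'M[R[i]]_(m, n) :=
  \matrix_(i, j) Complex (F (fun t => complex.Re (f t i j)))
                         (F (fun t => complex.Im (f t i j))).

Definition mx_continuous_on m n (A : set R) (f : R -> 'M[R[i]]_(m, n)) :=
  for_parts (fun g => {within A, continuous g}) f.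

Definition mx_measurable_on m n (A : set R) (f : R -> 'M[R[i]]_(m, n)) :=
  for_parts (fun g => measurable_fun A g) f.

Definition mx_derivable m n (f : R -> 'M[R[i]]_(m, n)) :=
  for_parts (fun g => forall t : R, derivable g t 1) f.

Definition mx_derive m n (f : R -> 'M[R[i]]_(m, n)) (t : R) : 'M[R[i]]_(m, n) :=
  map_parts (fun g => derive1 (g : R -> R^o) t) f.

Definition mx_integral m n (a b : R) (f : R -> 'M[R[i]]_(m, n)) :
    'M[R[i]]_(m, n) :=
  map_parts (fun g => Rintegral lebesgue_measure `[a, b] g) f.

Definition hoelder_continuous m n (f : R -> 'M[R[i]]_(m, n)) :=
  exists alpha C : R, [/\ 0 < alpha, alpha <= 1, 0 <= C &
    forall s t : R, enorm (f t - f s) <= C * `|t - s| `^ alpha].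

Definition cexp (z : R[i]) : R[i] :=
  Complex (expR (complex.Re z) * cos (complex.Im z))
          (expR (complex.Re z) * sin (complex.Im z)).

(** [fourier_coef T f k] is (1/T) int_0^T f(t) e^{-i k (2 pi / T) t} dt. *)
Definition fourier_coef m n (T : R) (f : R -> 'M[R[i]]_(m, n)) (k : int) :
    'M[R[i]]_(m, n) :=
  Complex T^-1 0 *:
  mx_integral 0 T
    (fun t => cexp (Complex 0 (- (k%:~R * (2 * pi / T) * t))) *: f t).

End ComplexAnalysis.

(** * Operators on l^2(Z, C^d)

    Elements of l^2 are functions [int -> 'cV_d] satisfying [l2], and operators
    are functions on [int -> 'cV_d] of which only the values on [l2] matter. *)

Section L2.
Variables (R : realType) (d : nat).

Definition zseq := int -> 'cV[R[i]]_d.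

Definition l2sq (x : zseq) : \bar R :=
  \esum_(k in [set: int]) (enorm (x k) ^+ 2)%:E.

Definition l2 : set zseq := [set x | (l2sq x < +oo)%E].

Definition l2norm (x : zseq) : R := Num.sqrt (fine (l2sq x)).

Definition bounded_operator (A : zseq -> zseq) : Prop :=
  [/\ forall x, l2 x -> l2 (A x),
      forall (a : R[i]) (x y : zseq), l2 x -> l2 y ->
        A (fun k => a *: x k + y k) = (fun k => a *: A x k + A y k)
    & exists M : R, forall x, l2 x -> l2norm (A x) <= M * l2norm x].

Definition is_inverse (A B : zseq -> zseq) : Prop :=
  [/\ bounded_operator A, bounded_operator B,
      forall x, l2 x -> B (A x) = x & forall x, l2 x -> A (B x) = x].

Definition invertible (A : zseq -> zseq) : Prop := exists B, is_inverse A B.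

Definition opnorm (A : zseq -> zseq) : \bar R :=
  ereal_sup [set (l2norm (A x))%:E | x in [set x | l2 x /\ l2norm x <= 1]].

(** Sum over Z as the limit of the partial sums over [-n, n]; below it is only
    relevant for absolutely convergent series, where the order of summation is
    immaterial. *)
Definition zsum (x : zseq) : 'cV[R[i]]_d :=
  let S (n : nat) := \sum_(m < (2 * n).+1) x (m%:Z - n%:Z) in
  \col_i Complex (limn (fun n => complex.Re (S n i ord0) : R))
                 (limn (fun n => complex.Im (S n i ord0) : R)).

(** Action of a doubly infinite block matrix, [B k l] being the block in row
    [k] and column [l]. *)
Definition block_apply (B : int -> int -> 'M[R[i]]_d) : zseq -> zseq :=
  fun x k => zsum (fun l => B k l *m x l).

End L2.

(** * Difference-delay systems

    The delays tau_1 < ... < tau_N, N >= 1, are indexed by ['I_n.+1] with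
    N = n + 1; thus tau_N is [tau ord_max]. *)

Section System.
Variables (R : realType) (d n : nat).
Variables (tau : 'I_n.+1 -> R) (T : R) (D : 'I_n.+1 -> R -> 'M[R[i]]_d).

Definition tauN : R := tau ord_max.

Definition delayed_sum (y : R -> 'cV[R[i]]_d) (t : R) : 'cV[R[i]]_d :=
  \sum_j D j t *m y (t - tau j).

(** For a solution [y] with initial time [s] and initial value [phi],
    [shift y t] restricted to [[-tauN, 0]] is U(t,s) phi. Such a solution exists
    and is unique (almost everywhere unique in L^q), so the stability estimates
    below, which quantify over all solutions [y], are the estimates on the
    operators U(t,s) and U_q(t,s). *)
Definition shift (y : R -> 'cV[R[i]]_d) (t : R) : R -> 'cV[R[i]]_d :=
  fun theta => y (t + theta).

Definition C0_norm (phi : R -> 'cV[R[i]]_d) : \bar R :=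
  ereal_sup [set (enorm (phi theta))%:E | theta in `[- tauN, 0]].

(** The space C_s. *)
Definition C0_state (s : R) (phi : R -> 'cV[R[i]]_d) : Prop :=
  mx_continuous_on `[- tauN, 0] phi /\
  phi 0 = \sum_j D j s *m phi (- tau j).

Definition C0_solution (s : R) (phi y : R -> 'cV[R[i]]_d) : Prop :=
  [/\ mx_continuous_on `[s - tauN, +oo[ y,
      forall theta, - tauN <= theta <= 0 -> y (s + theta) = phi theta
    & forall t, s < t -> y t = delayed_sum y t].

Definition C0_exponentially_stable : Prop :=
  exists gamma K : R, [/\ 0 < gamma, 0 < K &
    forall s phi y, C0_state s phi -> C0_solution s phi y ->
    forall t, s <= t ->
      (C0_norm (shift y t) <=
       (K * expR (- gamma * (t - s)))%:E * C0_norm phi)%E].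

Definition Lq_norm (q : \bar R) (a b : R) (f : R -> 'cV[R[i]]_d) : \bar R :=
  'N[lebesgue_measure]_q [(fun t => (enorm (f t))%:E) \_ `[a, b]].

Definition in_Lq (q : \bar R) (a b : R) (f : R -> 'cV[R[i]]_d) : Prop :=
  mx_measurable_on `[a, b] f /\ (Lq_norm q a b f < +oo)%E.

Definition Lq_solution (q : \bar R) (s : R) (phi y : R -> 'cV[R[i]]_d) : Prop :=
  [/\ forall b, in_Lq q (s - tauN) b y,
      {ae lebesgue_measure, forall theta : R,
         - tauN <= theta <= 0 -> y (s + theta) = phi theta}
    & {ae lebesgue_measure, forall t : R, s < t -> y t = delayed_sum y t}].

Definition Lq_exponentially_stable (q : \bar R) : Prop :=
  exists gamma K : R, [/\ 0 < gamma, 0 < K &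
    forall s phi y, in_Lq q (- tauN) 0 phi -> Lq_solution q s phi y ->
    forall t, s <= t ->
      (Lq_norm q (- tauN) 0 (shift y t) <=
       (K * expR (- gamma * (t - s)))%:E * Lq_norm q (- tauN) 0 phi)%E].

(** The C^0 and L^q properties, 1 <= q <= oo, are all equivalent; a system is
    exponentially stable when any one of them holds. *)
Definition exponentially_stable : Prop :=
  C0_exponentially_stable \/
  exists2 q : \bar R, (1 <= q)%E & Lq_exponentially_stable q.

(** sum_j e^{-(p - i l omega) tau_j} Dcheck_j(l - k), with omega = 2 pi / T. *)
Definition harmonic_block (p : R[i]) (k l : int) : 'M[R[i]]_d :=
  \sum_j cexp (- (p - Complex 0 (l%:~R * (2 * pi / T))) * Complex (tau j) 0) *:
         fourier_coef T (D j) (l - k).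

(** The operator R(p). *)
Definition harmonic_operator (p : R[i]) : zseq R d -> zseq R d :=
  fun x k => x k - block_apply (harmonic_block p) x k.

End System.

(* Main.v *)
Require Import Defs.
From HB Require Import structures.
From mathcomp Require Import all_boot all_order all_algebra.
From mathcomp Require Import all_classical all_reals all_analysis.
From mathcomp Require Import measurable_realfun ess_sup_inf.
From mathcomp Require Import ring lra zify.

Set Implicit Arguments.
Unset Strict Implicit.
Unset Printing Implicit Defensive.

Import Order.TTheory GRing.Theory Num.Theory.
Import numFieldNormedType.Exports.
Local Open Scope classical_set_scope.
Local Open Scope ring_scope.

(** Both sides of the equivalence amount to a third property, [fund_decay]: the
    fundamental solution [fund x t] = X(t, t - x), the response of the system to a
    Kronecker delta, decays exponentially in x, uniformly in t. Iterating the
    equation expands the solutions over words of delays, and [fund x] adds up the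
    coefficient functions [wcoef] of the words with total delay x. The number of
    words with total delay at most L grows exponentially with L, but the delay of a
    word depends only on how often each letter occurs in it, so that there are only
    polynomially many delays up to L ([size_delaysle]). Hence a bound on each
    [fund x] is as good as a bound on sums over x, up to an arbitrarily small loss
    in the exponent, and nothing is lost in passing between norms of supremum and of
    square sum type.

    Stability and decay. A continuous solution, continued by zero into the past, is
    the response to a source supported in the initial interval, so decay implies
    C^0 stability ([C0_stable_of_decay]). Conversely, if the initial value is a
    sufficiently narrow tent at t0, then near the time t0 + x only the words with
    total delay x see the tent, and the solution there is a copy of it multiplied by
    [fund x]. Both in the supremum norm and in the L^q norms this bounds [fund x]
    by the operator norm of the solution operator ([decay_of_stable]).

    Decay gives uniformly bounded inverses. Read on Fourier coefficients, R(p) is the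
    identity minus the operators [delop], each of which delays a function and then
    multiplies it by D_j. A sum of words with the same delay r is a single delay
    followed by multiplication by [fund r], and its norm is at most
    e^(- Re p r) sup |fund r| ([group_bound]). As there are few delays, the Neumann
    series of R(p), summed in the order of increasing total delay, converges for
    Re p >= - g / 2, where g is the rate of decay, to an inverse with a bound that
    does not depend on p ([harm_inverse]).

    Uniformly bounded inverses give decay. A bound M for the inverse is a lower bound
    for R(p). It is tested on the sequences that are, for l in [0, N), the sum over
    finitely many real numbers r of e^(- (p - i l omega) r) u(r); on these the
    multiplication by a function with absolutely convergent Fourier series takes
    the values of the function at the points r, up to an error that is small
    compared to the square root of N ([harm_test]). The characters of distinct r
    being orthogonal in the mean ([bohr_mean]), averaging over the imaginary part of
    p yields the lower bound for the delay equation on functions of finite support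
    on the discrete real line with weights e^(- b r), for each b >= beta
    ([lower_bound_discrete]). For the fundamental solution cut off after time L, the
    source consists of the delta at the start and of terms near the cut, so that
    its weighted square sum E(L) satisfies
    E(L) <= M^2 (1 + kappa (E(L) - E(L - tau_N))). Either E is bounded by M^2 or it
    grows exponentially at a definite rate ([dichotomy]). For large b it does not
    grow, and boundedness for b + delta excludes that rate for b; this descends to
    b = beta < 0 in finitely many steps ([energy_bound]) and gives the decay
    ([decay_of_lower_bound]).

    The D_j enter through two facts about periodic functions with a continuous
    derivative: their Fourier coefficients are absolutely summable, by integration by
    parts and Bessel's inequality ([fourier_coef_summable]), and their Fourier series
    converges to them, by positivity of the Fejer kernel ([fourier_inversion]). *)

(** * Euclidean norms *)

Section FiniteSums.
Variable R : realType.

Lemma cauchy_schwarz_seq (I : Type) (s : seq I) (f g : I -> R) :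
  (\sum_(i <- s) f i * g i) ^+ 2 <=
  (\sum_(i <- s) f i ^+ 2) * (\sum_(i <- s) g i ^+ 2).
Proof.
elim: s => [|i s IH]; first by rewrite !big_nil expr0n mulr0.
rewrite !big_cons; move: IH.
have := @sumr_ge0 R _ s xpredT (fun i => f i ^+ 2) (fun i _ => sqr_ge0 _).
have := @sumr_ge0 R _ s xpredT (fun i => g i ^+ 2) (fun i _ => sqr_ge0 _).
set A := \sum_(j <- s) f j ^+ 2; set B := \sum_(j <- s) g j ^+ 2.
set S := \sum_(j <- s) _; move: (f i) (g i) => a b B0 A0 SAB.
have SE : `|S| <= Num.sqrt A * Num.sqrt B.
  by rewrite -sqrtrM // -sqrtr_sqr ler_wsqrtr.
have hS : S * (a * b) <= Num.sqrt A * Num.sqrt B * `|a * b|.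
  by rewrite (le_trans (ler_norm _)) // normrM ler_wpM2r.
have hAB : 2 * (Num.sqrt A * Num.sqrt B * `|a * b|) <= A * b ^+ 2 + B * a ^+ 2.
  rewrite normrM -[in leRHS](sqr_sqrtr A0) -[in leRHS](sqr_sqrtr B0).
  rewrite -(real_normK (num_real a)) -(real_normK (num_real b)).
  have := sqr_ge0 (Num.sqrt A * `|b| - Num.sqrt B * `|a|); nra.
by nra.
Qed.

Lemma ler_sum_uniq (I : eqType) (s s' : seq I) (a : I -> R) :
  uniq s -> uniq s' -> (forall i, 0 <= a i) ->
  (forall i, i \in s -> i \notin s' -> a i = 0) ->
  \sum_(i <- s) a i <= \sum_(i <- s') a i.
Proof.
move=> us us' a0 h; rewrite (bigID (mem s')) /= [X in _ + X]big1_seq ?addr0; last first.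
  by move=> i /andP[] /[swap]; exact: h.
rewrite [leRHS](bigID (mem s)) /= -[leLHS]addr0 lerD ?sumr_ge0 //.
rewrite -[leLHS]big_filter -[leRHS]big_filter.
rewrite (perm_big [seq i <- s' | i \in s]) // uniq_perm ?filter_uniq // => i.
by rewrite !mem_filter andbC.
Qed.

Definition l2sum (I : Type) (s : seq I) (f : I -> R) : R :=
  Num.sqrt (\sum_(i <- s) f i ^+ 2).

Lemma l2sum_ge0 I (s : seq I) f : 0 <= l2sum s f.
Proof. exact: sqrtr_ge0. Qed.

Lemma l2sumK I (s : seq I) f : l2sum s f ^+ 2 = \sum_(i <- s) f i ^+ 2.
Proof. by rewrite sqr_sqrtr // sumr_ge0 // => i _; exact: sqr_ge0. Qed.

Lemma l2sum_minkowski I (s : seq I) (f g : I -> R) :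
  l2sum s (fun i => f i + g i) <= l2sum s f + l2sum s g.
Proof.
rewrite -[leRHS]ger0_norm ?addr_ge0 ?l2sum_ge0 // -sqrtr_sqr ler_wsqrtr //.
rewrite sqrrD !l2sumK.
under eq_bigr do rewrite sqrrD.
rewrite !big_split /= lerD2r lerD2l.
suff h : \sum_(i <- s) f i * g i <= l2sum s f * l2sum s g by rewrite mulr2n lerD.
rewrite (le_trans (ler_norm _)) // -sqrtr_sqr /l2sum -sqrtrM.
  by rewrite ler_wsqrtr // cauchy_schwarz_seq.
by rewrite sumr_ge0 // => i _; exact: sqr_ge0.
Qed.

Lemma ler_l2sum I (s : seq I) (f g : I -> R) :
  (forall i, 0 <= f i <= g i) -> l2sum s f <= l2sum s g.
Proof.
move=> h; rewrite ler_wsqrtr // ler_sum // => i _.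
by have /andP[f0 fg] := h i; rewrite lerXn2r // nnegrE (le_trans f0).
Qed.

Lemma l2sumZ I (s : seq I) (a : R) f :
  0 <= a -> l2sum s (fun i => a * f i) = a * l2sum s f.
Proof.
move=> a0; rewrite /l2sum; under eq_bigr do rewrite exprMn.
by rewrite -mulr_sumr sqrtrM ?sqr_ge0 // sqrtr_sqr ger0_norm.
Qed.

Lemma l2sum_le_sum I (s : seq I) (f : I -> R) :
  l2sum s f <= \sum_(i <- s) `|f i|.
Proof.
elim: s => [|i s IH]; first by rewrite /l2sum !big_nil sqrtr0.
rewrite big_cons -[leRHS]ger0_norm ?addr_ge0 ?sumr_ge0 // -sqrtr_sqr ler_wsqrtr //.
rewrite big_cons sqrrD real_normK ?num_real // -l2sumK -addrA lerD2l.
apply: (@le_trans _ _ ((\sum_(j <- s) `|f j|) ^+ 2)).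
  by rewrite lerXn2r ?nnegrE ?l2sum_ge0 ?sumr_ge0.
by rewrite lerDr mulrn_wge0 // mulr_ge0 // sumr_ge0.
Qed.

End FiniteSums.

Section Enorm.
Variable R : realType.
Implicit Types (m n p : nat).

Definition cabs2 (z : R[i]) : R := complex.Re z ^+ 2 + complex.Im z ^+ 2.

Lemma cabs2_ge0 z : 0 <= cabs2 z.
Proof. by rewrite addr_ge0 ?sqr_ge0. Qed.

Lemma cabs2M z w : cabs2 (z * w) = cabs2 z * cabs2 w.
Proof. by case: z w => a b [c d]; rewrite /cabs2 /=; ring. Qed.

(** The real and imaginary parts of the entries, as one family: [enorm] is the
    Euclidean norm of this real vector. *)
Definition part m n (A : 'M[R[i]]_(m, n)) (q : 'I_m * 'I_n * bool) : R :=
  if q.2 then complex.Re (A q.1.1 q.1.2) else complex.Im (A q.1.1 q.1.2).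

Lemma sum_cabs2E m n (A : 'M[R[i]]_(m, n)) :
  \sum_i \sum_j cabs2 (A i j) = \sum_q part A q ^+ 2.
Proof.
rewrite pair_bigA /= [RHS](eq_bigr (fun q => part A (q.1, q.2) ^+ 2)); last by case.
rewrite -(pair_bigA _ (fun q b => part A (q, b) ^+ 2)) /=.
by apply: eq_bigr => q _; rewrite big_bool.
Qed.

Lemma enormE m n (A : 'M[R[i]]_(m, n)) : enorm A = l2sum (index_enum _) (part A).
Proof. by rewrite /l2sum -sum_cabs2E. Qed.

Lemma enorm_ge0 m n (A : 'M[R[i]]_(m, n)) : 0 <= enorm A.
Proof. exact: sqrtr_ge0. Qed.

Lemma enorm_sqr m n (A : 'M[R[i]]_(m, n)) :
  enorm A ^+ 2 = \sum_i \sum_j cabs2 (A i j).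
Proof. by rewrite enormE l2sumK sum_cabs2E. Qed.

Lemma part0 m n : part (0 : 'M[R[i]]_(m, n)) =1 fun=> 0.
Proof. by case=> -[i j] [] /=; rewrite /part /= mxE. Qed.

Lemma partD m n (A B : 'M[R[i]]_(m, n)) q : part (A + B) q = part A q + part B q.
Proof. by case: q => -[i j] []; rewrite /part /= mxE raddfD. Qed.

Lemma partN m n (A : 'M[R[i]]_(m, n)) q : part (- A) q = - part A q.
Proof. by case: q => -[i j] []; rewrite /part /= mxE raddfN. Qed.

Lemma part_inj m n (A B : 'M[R[i]]_(m, n)) : part A =1 part B -> A = B.
Proof.
move=> h; apply/matrixP => i j.
have := h (i, j, true); have := h (i, j, false); rewrite /part /=.
by case: (A i j) (B i j) => a b [c d] /= -> ->.
Qed.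

Lemma enorm0 m n : enorm (0 : 'M[R[i]]_(m, n)) = 0.
Proof.
rewrite enormE /l2sum big1 ?sqrtr0 // => q _.
by rewrite part0 expr0n.
Qed.

Lemma enormN m n (A : 'M[R[i]]_(m, n)) : enorm (- A) = enorm A.
Proof.
rewrite !enormE /l2sum; congr Num.sqrt; apply: eq_bigr => q _.
by rewrite partN sqrrN.
Qed.

Lemma enormD m n (A B : 'M[R[i]]_(m, n)) : enorm (A + B) <= enorm A + enorm B.
Proof.
rewrite !enormE (le_trans _ (l2sum_minkowski _ _ _)) //.
by rewrite /l2sum; under eq_bigr do rewrite partD.
Qed.

Lemma enormB m n (A B : 'M[R[i]]_(m, n)) : enorm (A - B) <= enorm A + enorm B.
Proof. by rewrite -(enormN B) enormD. Qed.

Lemma enormBC m n (A B : 'M[R[i]]_(m, n)) : enorm (A - B) = enorm (B - A).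
Proof. by rewrite -enormN opprB. Qed.

Lemma enorm_sum m n (I : Type) (s : seq I) P (F : I -> 'M[R[i]]_(m, n)) :
  enorm (\sum_(i <- s | P i) F i) <= \sum_(i <- s | P i) enorm (F i).
Proof.
elim/big_rec2: _ => [|i x A _ h]; first by rewrite enorm0.
by rewrite (le_trans (enormD _ _)) // lerD2l.
Qed.

Lemma part_le_enorm m n (A : 'M[R[i]]_(m, n)) q : `|part A q| <= enorm A.
Proof.
rewrite enormE -sqrtr_sqr ler_wsqrtr // (bigD1 q) //= lerDl sumr_ge0 // => *.
exact: sqr_ge0.
Qed.

Lemma enorm_le_parts m n (A : 'M[R[i]]_(m, n)) : enorm A <= \sum_q `|part A q|.
Proof. by rewrite enormE l2sum_le_sum. Qed.

Lemma enorm_eq0 m n (A : 'M[R[i]]_(m, n)) : enorm A <= 0 -> A = 0.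
Proof.
move=> h; apply: part_inj => q; rewrite part0; apply/eqP.
by rewrite -normr_le0 (le_trans (part_le_enorm _ _)).
Qed.

Lemma enormZ m n (z : R[i]) (A : 'M[R[i]]_(m, n)) :
  enorm (z *: A) = Num.sqrt (cabs2 z) * enorm A.
Proof.
rewrite /enorm -sqrtrM ?cabs2_ge0 //; congr Num.sqrt; rewrite mulr_sumr.
apply: eq_bigr => i _; rewrite mulr_sumr; apply: eq_bigr => j _.
by rewrite mxE -[LHS]/(cabs2 (z * A i j)) cabs2M.
Qed.

Lemma cabs2_sum_le (I : Type) (s : seq I) (a b : I -> R[i]) :
  cabs2 (\sum_(i <- s) a i * b i) <=
  (\sum_(i <- s) cabs2 (a i)) * (\sum_(i <- s) cabs2 (b i)).
Proof.
pose v (i : I) : 'M[R[i]]_1 := (a i * b i)%:M.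
have vE z : enorm (z%:M : 'M[R[i]]_1) = Num.sqrt (cabs2 z).
  by rewrite /enorm !big_ord1 mxE eqxx mulr1n.
have h : enorm (\sum_(i <- s) v i) <=
    \sum_(i <- s) Num.sqrt (cabs2 (a i)) * Num.sqrt (cabs2 (b i)).
  rewrite (le_trans (enorm_sum _ _ _)) // ler_sum // => i _.
  by rewrite vE cabs2M sqrtrM ?cabs2_ge0.
have {}h : Num.sqrt (cabs2 (\sum_(i <- s) a i * b i)) <=
    \sum_(i <- s) Num.sqrt (cabs2 (a i)) * Num.sqrt (cabs2 (b i)).
  by rewrite -vE; move: h; rewrite /v -raddf_sum.
rewrite -(sqr_sqrtr (cabs2_ge0 (\sum_(i <- s) _))).
apply: (@le_trans _ _ ((\sum_(i <- s) Num.sqrt (cabs2 (a i)) * Num.sqrt (cabs2 (b i))) ^+ 2)).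
  by rewrite lerXn2r // nnegrE ?sqrtr_ge0 // (le_trans _ h) ?sqrtr_ge0.
rewrite (le_trans (cauchy_schwarz_seq _ _ _)) //.
by under eq_bigr do rewrite sqr_sqrtr ?cabs2_ge0 //;
   under [X in _ * X]eq_bigr do rewrite sqr_sqrtr ?cabs2_ge0 //.
Qed.

Lemma enormM m n p (A : 'M[R[i]]_(m, n)) (B : 'M[R[i]]_(n, p)) :
  enorm (A *m B) <= enorm A * enorm B.
Proof.
rewrite -[leLHS]ger0_norm ?enorm_ge0 // -sqrtr_sqr.
rewrite -[leRHS]ger0_norm ?mulr_ge0 ?enorm_ge0 // -[leRHS]sqrtr_sqr ler_wsqrtr //.
rewrite exprMn !enorm_sqr [X in _ * X]exchange_big /= mulr_suml.
apply: ler_sum => i _; rewrite mulr_sumr; apply: ler_sum => j _.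
by rewrite mxE cabs2_sum_le.
Qed.

End Enorm.

(** * The exponential *)

Section Cexp.
Variable R : realType.
Implicit Types z w : R[i].

Lemma cexpD z w : cexp (z + w) = cexp z * cexp w.
Proof.
case: z w => a b [c d]; rewrite /cexp /= expRD cosD sinD.
by congr Complex; rewrite /=; ring.
Qed.

Lemma cabs2_cexp z : cabs2 (cexp z) = expR (complex.Re z) ^+ 2.
Proof.
by rewrite /cabs2 /cexp /= !exprMn -mulrDr cos2Dsin2 mulr1.
Qed.

Lemma enorm_cexpZ m n z (A : 'M[R[i]]_(m, n)) :
  enorm (cexp z *: A) = expR (complex.Re z) * enorm A.
Proof. by rewrite enormZ cabs2_cexp sqrtr_sqr ger0_norm ?expR_ge0. Qed.

Definition cis (x : R) : R[i] := Complex (cos x) (sin x).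

Lemma cexp_cis a b : cexp (Complex a b) = Complex (expR a) 0 * cis b.
Proof. by rewrite /cexp /cis /=; congr Complex; rewrite /=; ring. Qed.

Lemma cexp_im x : cexp (Complex 0 x) = cis x.
Proof. by rewrite /cexp /= expR0 !mul1r. Qed.

Lemma cisD x y : cis (x + y) = cis x * cis y.
Proof. by rewrite /cis cosD sinD; congr Complex; rewrite /=; ring. Qed.

Lemma cis0 : cis 0 = 1.
Proof. by rewrite /cis cos0 sin0. Qed.

Lemma enorm_cisZ m n x (A : 'M[R[i]]_(m, n)) : enorm (cis x *: A) = enorm A.
Proof. by rewrite -cexp_im enorm_cexpZ /= expR0 mul1r. Qed.

End Cexp.

(** * Square summable sequences *)

Section Limits.
Variable R : realType.

Lemma big_supp (V : nmodType) (I : eqType) (s s' : seq I) (f : I -> V) :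
  uniq s -> uniq s' -> {subset s <= s'} ->
  (forall i, i \in s' -> i \notin s -> f i = 0) ->
  \sum_(i <- s') f i = \sum_(i <- s) f i.
Proof.
move=> us us' ss f0; rewrite (bigID (mem s)) /= [X in _ + X]big1_seq ?addr0.
  rewrite -big_filter; apply/perm_big/uniq_perm => //; first exact: filter_uniq.
  by move=> i; rewrite mem_filter; apply/andP/idP => [[]//|/[dup] /ss].
by move=> i /andP[]; move=> nis is'; exact: f0.
Qed.

Definition mxlim m n (z : nat -> 'M[R[i]]_(m, n)) : 'M[R[i]]_(m, n) :=
  \matrix_(i, j) Complex (limn (fun n => complex.Re (z n i j) : R))
                         (limn (fun n => complex.Im (z n i j) : R)).

Definition mxcvg m n (z : nat -> 'M[R[i]]_(m, n)) (l : 'M[R[i]]_(m, n)) :=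
  forall e : R, 0 < e -> exists N, forall k, (N <= k)%N -> enorm (z k - l) <= e.

Lemma mxcvg_unique m n (z : nat -> 'M[R[i]]_(m, n)) l l' :
  mxcvg z l -> mxcvg z l' -> l = l'.
Proof.
move=> h h'; apply/eqP; rewrite -subr_eq0; apply/eqP/enorm_eq0/ler_addgt0Pl => e e0.
have e20 : 0 < e / 2 by rewrite divr_gt0.
have [N hN] := h _ e20; have [N' hN'] := h' _ e20.
have := hN _ (leq_maxl N N'); have := hN' _ (leq_maxr N N').
set k := maxn N N' => k1 k2; rewrite addr0.
have -> : l - l' = (z k - l') - (z k - l) by rewrite opprB [RHS]addrC subrKA.
by rewrite (le_trans (enormB _ _)) // (splitr e) lerD.
Qed.

Lemma mxcvgD m n (z z' : nat -> 'M[R[i]]_(m, n)) l l' :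
  mxcvg z l -> mxcvg z' l' -> mxcvg (fun k => z k + z' k) (l + l').
Proof.
move=> h h' e e0; have e20 : 0 < e / 2 by rewrite divr_gt0.
have [N hN] := h _ e20; have [N' hN'] := h' _ e20.
exists (maxn N N') => k; rewrite geq_max => /andP[k1 k2].
rewrite opprD addrACA (le_trans (enormD _ _)) // (splitr e).
by rewrite lerD ?hN ?hN'.
Qed.

Lemma mxcvg_mulmx m n p (A : 'M[R[i]]_(p, m)) (z : nat -> 'M[R[i]]_(m, n)) l :
  mxcvg z l -> mxcvg (fun k => A *m z k) (A *m l).
Proof.
move=> h e e0; have c0 : 0 < enorm A + 1 by rewrite ltr_wpDl ?enorm_ge0.
have [N hN] := h _ (divr_gt0 e0 c0).
exists N => k Nk; rewrite -mulmxBr (le_trans (enormM _ _)) //.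
apply: (@le_trans _ _ ((enorm A + 1) * (e / (enorm A + 1)))).
  by rewrite ler_pM ?enorm_ge0 ?hN // lerDl.
by rewrite mulrCA divff ?mulr1 // gt_eqF.
Qed.

Lemma mxcvg_lim m n (z : nat -> 'M[R[i]]_(m, n)) :
  (forall q, cvgn (fun k => part (z k) q : R)) -> mxcvg z (mxlim z).
Proof.
move=> h e e0.
have h1 q : (fun k => part (z k) q - part (mxlim z) q : R) @ \oo --> (0 : R).
  have -> : part (mxlim z) q = limn (fun k => part (z k) q : R).
    by case: q {h} => -[i j] []; rewrite /part /= mxE.
  by rewrite -(subrr (limn (fun k => part (z k) q : R))); apply: cvgB (h q) (cvg_cst _).
have h2 : (fun k => \sum_q `|part (z k) q - part (mxlim z) q| : R) @ \oo --> (0 : R).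
  elim: (index_enum _) => [|q s IH].
    by under eq_fun do rewrite big_nil; exact: cvg_cst.
  under eq_fun do rewrite big_cons.
  have hq : (fun k => `|part (z k) q - part (mxlim z) q| : R) @ \oo --> (0 : R).
    by rewrite -(normr0 R); apply: cvg_norm.
  have hs := cvgD hq IH; rewrite addr0 in hs.
  exact: hs.
have /cvgrPdist_le /(_ e e0) [N _ hN] := h2; exists N => k /hN.
rewrite sub0r normrN ger0_norm ?sumr_ge0 // => hk.
rewrite (le_trans (enorm_le_parts _)) //.
by under eq_bigr do rewrite partD partN.
Qed.

Lemma mxcvg_unif m n (I : eqType) (s : seq I) (z : I -> nat -> 'M[R[i]]_(m, n)) l e :
  (forall i, mxcvg (z i) (l i)) -> 0 < e ->
  exists N, forall i k, i \in s -> (N <= k)%N -> enorm (z i k - l i) <= e.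
Proof.
move=> h e0; elim: s => [|i s [N hN]]; first by exists 0%N.
have [N' hN'] := h i e e0; exists (maxn N N') => j k.
by rewrite inE geq_max => /orP[/eqP ->|js] /andP[k1 k2]; [exact: hN'|exact: hN].
Qed.

Lemma series_parts_cvg m n (u : nat -> 'M[R[i]]_(m, n)) (C : R) q :
  (forall N, \sum_(k < N) enorm (u k) <= C) ->
  cvgn (fun N => part (\sum_(k < N) u k) q : R).
Proof.
move=> h.
have pS N : part (\sum_(k < N) u k) q = \sum_(0 <= k < N) part (u k) q.
  rewrite big_mkord; elim: N => [|N IH]; first by rewrite !big_ord0 part0.
  by rewrite !big_ord_recr /= partD IH.
have -> : (fun N => part (\sum_(k < N) u k) q : R) = series (fun k => part (u k) q).
  by apply/funext => N; rewrite pS.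
apply: normed_cvg; apply: nondecreasing_is_cvgn.
  by apply: nondecreasing_series => k _ _; exact: normr_ge0.
exists C => _ [N _ <-]; have := h N.
rewrite -(big_mkord xpredT (fun k => enorm (u k))); apply: le_trans.
by apply: ler_sum => k _; exact: part_le_enorm.
Qed.

End Limits.

(** The symmetric window [-n, n], over which [zsum] takes its partial sums. *)
HB.lock Definition win (n : nat) : seq int :=
  [seq m%:Z - n%:Z | m <- iota 0 (2 * n).+1].

Lemma mem_win n k : (k \in win n) = (`|k| <= n)%N.
Proof.
rewrite win.unlock; apply/mapP/idP => [[m]|kn]; first by rewrite mem_iota => h ->; lia.
by exists (absz (k + n%:Z)%R); [rewrite mem_iota|]; lia.
Qed.

Lemma win_uniq n : uniq (win n).
Proof. by rewrite win.unlock map_inj_uniq ?iota_uniq // => a b h; lia. Qed.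

Lemma big_win (V : nmodType) n (f : int -> V) :
  \sum_(m < (2 * n).+1) f (m%:Z - n%:Z) = \sum_(k <- win n) f k.
Proof. by rewrite win.unlock big_map -(big_mkord xpredT (fun m : nat => f (m%:Z - n%:Z))). Qed.

Lemma win_perm n : perm_eq (win n.+1) (n.+1%:Z :: - n.+1%:Z :: win n).
Proof.
apply: uniq_perm; first exact: win_uniq.
  by rewrite 2!cons_uniq win_uniq in_cons !mem_win andbT; lia.
by move=> k; rewrite mem_win 2!in_cons mem_win; lia.
Qed.

Lemma win_sub_seq (s : seq int) : exists n, {subset s <= win n}.
Proof.
elim: s => [|k s [n h]]; first by exists 0%N.
exists (maxn (absz k) n) => l; rewrite inE mem_win => /orP[/eqP->|/h]; rewrite ?mem_win; lia.
Qed.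

Section Zseq.
Variable R : realType.

Definition summable_by m n (F : int -> 'M[R[i]]_(m, n)) (c : R) :=
  forall s, uniq s -> \sum_(k <- s) enorm (F k) <= c.

(** Over absolutely summable families the symmetric partial sums converge: they
    are the partial sums of the series grouping [k] with [- k]. *)
Lemma win_cvg m n (F : int -> 'M[R[i]]_(m, n)) c : summable_by F c ->
  forall q, cvgn (fun N => part (\sum_(k <- win N) F k) q : R).
Proof.
move=> h q; pose u k := if k is k'.+1 then F k%:Z + F (- k%:Z) else F 0.
have uE N : \sum_(k <- win N) F k = \sum_(j < N.+1) u j.
  elim: N => [|N IH]; first by rewrite big_ord1 /= win.unlock big_seq1.
  by rewrite big_ord_recr /= -IH (perm_big _ (win_perm N)) !big_cons /= [RHS]addrC addrA.
have uc N : \sum_(j < N) enorm (u j) <= c.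
  apply: (@le_trans _ _ (\sum_(j < N.+1) enorm (u j))).
    by rewrite big_ord_recr lerDl enorm_ge0.
  apply: le_trans (h _ (win_uniq N)).
  elim: N => [|N IH]; first by rewrite big_ord1 /= win.unlock big_seq1.
  rewrite big_ord_recr /= (perm_big _ (win_perm N)) !big_cons [leRHS]addrA [leLHS]addrC.
  by apply: lerD => //; exact: enormD.
have := @series_parts_cvg _ _ _ u c q uc.
move=> /cvg_ex[l hl]; apply/cvg_ex; exists l.
rewrite (_ : (fun N => _) = (fun N => part (\sum_(k < N.+1) u k) q : R)); last first.
  by apply/funext => N; rewrite uE.
by rewrite (cvg_shiftS (fun N => part (\sum_(k < N) u k) q : R)).
Qed.

Section Zsum.
Variable d : nat.
Implicit Types (x y : zseq R d).

Lemma zsum_cvg x c : summable_by x c ->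
  mxcvg (fun n => \sum_(k <- win n) x k) (zsum x).
Proof.
move=> h; have -> : zsum x = mxlim (fun n => \sum_(k <- win n) x k).
  apply/matrixP => i j; rewrite !mxE !ord1; congr Complex; congr (limn _);
  by apply/funext => n; rewrite big_win.
exact: mxcvg_lim (win_cvg h).
Qed.

Lemma zsum_supp (s : seq int) x :
  uniq s -> (forall k, k \notin s -> x k = 0) -> zsum x = \sum_(k <- s) x k.
Proof.
move=> us x0; have hs : summable_by x (\sum_(k <- s) enorm (x k)).
  move=> s' us'; apply: ler_sum_uniq => // [k|k _ ks]; first exact: enorm_ge0.
  by rewrite x0 // enorm0.
apply: mxcvg_unique (zsum_cvg hs) _ => e e0.
have [N hN] := win_sub_seq s; exists N => k Nk.
rewrite (@big_supp _ _ s) ?win_uniq ?subrr ?enorm0 ?(ltW e0) //.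
- by move=> l /hN; rewrite !mem_win => /leq_trans; apply.
- by move=> l _; exact: x0.
Qed.

Lemma zsumD x y c c' : summable_by x c -> summable_by y c' ->
  zsum (fun k => x k + y k) = zsum x + zsum y.
Proof.
move=> hx hy; have hxy : summable_by (fun k => x k + y k) (c + c').
  move=> s us; apply: le_trans (lerD (hx s us) (hy s us)).
  by rewrite -big_split; apply: ler_sum => k _; exact: enormD.
apply: mxcvg_unique (zsum_cvg hxy) _.
under eq_fun do rewrite big_split.
by apply: mxcvgD; apply: zsum_cvg; eassumption.
Qed.

Lemma zsum_mulmx (A : 'M[R[i]]_d) x c : summable_by x c ->
  zsum (fun k => A *m x k) = A *m zsum x.
Proof.
move=> hx; have hAx : summable_by (fun k => A *m x k) (enorm A * c).
  move=> s us; apply: le_trans (ler_wpM2l (enorm_ge0 _) (hx s us)).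
  by rewrite mulr_sumr; apply: ler_sum => k _; exact: enormM.
apply: mxcvg_unique (zsum_cvg hAx) _.
under eq_fun do rewrite -mulmx_sumr.
by apply: mxcvg_mulmx; exact: zsum_cvg hx.
Qed.

End Zsum.

Section L2by.
Variable d : nat.
Implicit Types (x y : zseq R d).

(** Being square summable together with a bound on the norm; working with the
    bound rather than with [l2norm] spares every finiteness side condition. *)
Definition L2by x (C : R) :=
  forall s, uniq s -> l2sum s (fun k => enorm (x k)) <= C.

Lemma L2by_ge0 x C : L2by x C -> 0 <= C.
Proof. by move=> /(_ [::] isT); apply: le_trans; exact: l2sum_ge0. Qed.

Lemma L2by_le x C C' : L2by x C -> C <= C' -> L2by x C'.
Proof. by move=> h CC' s us; rewrite (le_trans (h s us)). Qed.

Lemma L2by_pt x C k : L2by x C -> enorm (x k) <= C.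
Proof.
move=> /(_ [:: k] isT); rewrite /l2sum big_seq1 sqrtr_sqr ger0_norm //.
exact: enorm_ge0.
Qed.

Lemma L2by_dom m (x : zseq R d) (y : zseq R m) C :
  L2by x C -> (forall k, enorm (y k) <= enorm (x k)) ->
  forall s, uniq s -> l2sum s (fun k => enorm (y k)) <= C.
Proof.
move=> h xy s us; rewrite (le_trans _ (h s us)) // ler_l2sum // => k.
by rewrite enorm_ge0 xy.
Qed.

Lemma L2byD x y C C' : L2by x C -> L2by y C' -> L2by (fun k => x k + y k) (C + C').
Proof.
move=> hx hy s us; apply: le_trans (lerD (hx s us) (hy s us)).
apply: le_trans (l2sum_minkowski _ _ _); apply: ler_l2sum => k.
by rewrite enorm_ge0 enormD.
Qed.

Lemma L2byN x C : L2by x C -> L2by (fun k => - x k) C.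
Proof. by move=> h; apply: (L2by_dom h) => k; rewrite enormN. Qed.

Lemma L2byB x y C C' : L2by x C -> L2by y C' -> L2by (fun k => x k - y k) (C + C').
Proof. by move=> hx /L2byN; exact: L2byD. Qed.

Lemma L2by0 : L2by (fun=> 0) 0.
Proof.
by move=> s _; rewrite /l2sum big1 ?sqrtr0 // => k _; rewrite enorm0 expr0n.
Qed.

Lemma L2by_scale m (x : zseq R d) (y : zseq R m) C a : 0 <= a ->
  L2by x C -> (forall k, enorm (y k) <= a * enorm (x k)) ->
  forall s, uniq s -> l2sum s (fun k => enorm (y k)) <= a * C.
Proof.
move=> a0 h xy s us; apply: le_trans (ler_wpM2l a0 (h s us)).
by rewrite -l2sumZ //; apply: ler_l2sum => k; rewrite enorm_ge0 xy.
Qed.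

Lemma L2byM (A : 'M[R[i]]_d) x C :
  L2by x C -> L2by (fun k => A *m x k) (enorm A * C).
Proof. by move=> h; apply: (L2by_scale (enorm_ge0 A) h) => k; exact: enormM. Qed.

Lemma L2by_shift x C m : L2by x C -> L2by (fun k => x (k + m)) C.
Proof.
move=> h s us; have := h [seq k + m | k <- s]; rewrite /l2sum big_map; apply.
by rewrite map_inj_uniq // => a b /addIr.
Qed.

Lemma L2by_mask x C (P : pred int) :
  L2by x C -> L2by (fun k => if P k then x k else 0) C.
Proof. by move=> h; apply: (L2by_dom h) => k; case: ifP; rewrite ?enorm0 ?enorm_ge0. Qed.

Lemma L2by_sum (I : Type) (s : seq I) (f : I -> zseq R d) (C : I -> R) :
  (forall i, L2by (f i) (C i)) ->
  L2by (fun k => \sum_(i <- s) f i k) (\sum_(i <- s) C i).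
Proof.
move=> h; elim: s => [|i s IH].
  by under eq_fun do rewrite big_nil; rewrite big_nil; exact: L2by0.
under eq_fun do rewrite big_cons; rewrite big_cons; exact: L2byD.
Qed.

(** Fatou: the norm is a supremum of continuous functions of finitely many
    entries. *)
Lemma L2by_fatou x C :
  (forall s e, uniq s -> 0 < e -> exists2 y, L2by y (C + e) &
     forall k, k \in s -> enorm (x k - y k) <= e) ->
  L2by x C.
Proof.
move=> h s us; apply/ler_addgt0Pl => e e0.
have c0 : 0 < 1 + (size s)%:R :> R by rewrite ltr_pwDl.
have [y hy xy] := h s _ us (divr_gt0 e0 c0); set e' := e / _ in hy xy.
apply: (@le_trans _ _ (l2sum s (fun k => enorm (y k)) +
                       l2sum s (fun k => enorm (x k - y k)))).
  apply: le_trans (l2sum_minkowski _ _ _); apply: ler_l2sum => k.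
  by rewrite enorm_ge0 -{1}(subrK (y k) (x k)) addrC enormD.
apply: (@le_trans _ _ (C + e' + e' * (size s)%:R)).
  apply: lerD; first exact: hy.
  rewrite (le_trans (l2sum_le_sum _ _)) //.
  rewrite -sum1_size natr_sum mulr_sumr big_seq [leRHS]big_seq.
  by apply: ler_sum => k ks; rewrite mulr1 ger0_norm ?enorm_ge0 ?xy.
rewrite -addrA -{1}(mulr1 e') -mulrDr divfK ?gt_eqF //.
by rewrite addrC.
Qed.

Lemma L2by_supp x (s : seq int) C : uniq s -> (forall k, k \notin s -> x k = 0) ->
  l2sum s (fun k => enorm (x k)) <= C -> L2by x C.
Proof.
move=> us x0 hC s' us'; apply: le_trans hC; rewrite /l2sum ler_wsqrtr //.
apply: ler_sum_uniq => // [k|k _ ks]; first exact: sqr_ge0.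
by rewrite x0 // enorm0 expr0n.
Qed.

(** A finite set on which the square sum is nearly its supremum leaves little
    outside. *)
Lemma L2by_tail x C e : L2by x C -> 0 < e ->
  exists2 s, uniq s & L2by (fun k => if k \in s then 0 else x k) e.
Proof.
move=> h e0; pose S := [set a | exists2 s : seq int, uniq s &
  a = \sum_(k <- s) enorm (x k) ^+ 2].
have hS : has_sup S.
  split; first by exists (\sum_(k <- [::]) enorm (x k) ^+ 2); exists [::].
  exists (C ^+ 2) => _ [s us ->]; rewrite -l2sumK.
  by rewrite lerXn2r ?nnegrE ?l2sum_ge0 ?(L2by_ge0 h) ?h.
have [_ [s us ->] hs] := sup_adherent (exprn_gt0 2 e0) hS.
exists s => // s' us'; rewrite -[leRHS]ger0_norm ?(ltW e0) // -sqrtr_sqr ler_wsqrtr //.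
rewrite (bigID (mem s)) /= big1_seq ?add0r; last first.
  by move=> k /andP[-> _]; rewrite enorm0 expr0n.
under eq_bigr => k /negbTE -> do [].
rewrite -big_filter; set s1 := [seq _ <- _ | _].
have : sup S >= \sum_(k <- s ++ s1) enorm (x k) ^+ 2.
  apply: ub_le_sup; first by case: hS.
  exists (s ++ s1) => //; rewrite cat_uniq us filter_uniq // andbT.
  by apply/hasPn => k; rewrite mem_filter => /andP[].
by rewrite big_cat /=; move: hs; lra.
Qed.

End L2by.

Section Convolution.
Variable d : nat.
Implicit Types (x y : zseq R d) (F : int -> 'M[R[i]]_d).

(** The block Toeplitz operator that multiplies functions with Fourier
    coefficients [x l] (for the characters e^(-i l omega t)) by the function with
    Fourier coefficients [F m] (for e^(i m omega t)). *)
Definition conv F x : zseq R d := fun k => zsum (fun l => F (l - k) *m x l).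

Lemma conv_summable F x c C k : summable_by F c -> L2by x C ->
  summable_by (fun l => F (l - k) *m x l) (c * C).
Proof.
move=> hF hx s us; apply: (@le_trans _ _ ((\sum_(m <- [seq l - k | l <- s]) enorm (F m)) * C)).
  rewrite big_map mulr_suml; apply: ler_sum => l _.
  by rewrite (le_trans (enormM _ _)) // ler_wpM2l ?enorm_ge0 ?(L2by_pt l hx).
rewrite ler_wpM2r ?(L2by_ge0 hx) ?hF // map_inj_uniq // => a b /addIr.
exact.
Qed.

(** Young's inequality: [conv F x] superposes shifts of [x] with total weight
    [c]; by [L2by_fatou] finitely many of them are enough. *)
Lemma conv_L2by F x c C : summable_by F c -> L2by x C -> L2by (conv F x) (c * C).
Proof.
move=> hF hx; apply: L2by_fatou => s e us e0.
have [N /(_ _ N)] := mxcvg_unif s (fun k => zsum_cvg (conv_summable k hF hx)) e0.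
move=> hN; pose x' l := if l \in win N then x l else 0.
have hx' : L2by x' C := L2by_mask (mem (win N)) hx.
pose ms := undup [seq l - k | l <- win N, k <- s].
exists (fun k => \sum_(m <- ms) F m *m x' (k + m)).
  apply: (@L2by_le _ _ (\sum_(m <- ms) enorm (F m) * C)).
    by apply: L2by_sum => m; apply: L2byM; exact: L2by_shift.
  rewrite -mulr_suml; apply: (@le_trans _ _ (c * C)); last by rewrite lerDl ltW.
  by rewrite ler_wpM2r ?(L2by_ge0 hx) ?hF ?undup_uniq.
move=> k ks; have := hN k ks (leqnn N); rewrite enormBC.
suff -> : \sum_(m <- ms) F m *m x' (k + m) = \sum_(l <- win N) F (l - k) *m x l by [].
rewrite [RHS](eq_big_seq (fun l => F (l - k) *m x' l)); last by move=> l; rewrite /x' => ->.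
rewrite -(@big_supp _ _ (win N) [seq k + m | m <- ms] (fun l => F (l - k) *m x' l)).
- by rewrite big_map; apply: eq_bigr => m _; rewrite [k + m]addrC addrK addrC.
- exact: win_uniq.
- by rewrite map_inj_uniq ?undup_uniq // => a b /addrI.
- move=> l lN; apply/mapP; exists (l - k); last by rewrite addrC subrK.
  by rewrite mem_undup; apply/allpairsP; exists (l, k).
- by move=> l _ /negbTE; rewrite /x' => ->; rewrite mulmx0.
Qed.

(** Replacing [F] by finitely many of its coefficients changes the operator as
    little as the discarded coefficients are small. *)
Lemma conv_approx F x c C (s : seq int) e : uniq s -> summable_by F c ->
  summable_by (fun m => if m \in s then 0 else F m) e -> L2by x C ->
  L2by (fun k => conv F x k - \sum_(m <- s) F m *m x (k + m)) (e * C).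
Proof.
move=> us hF he hx.
have -> : (fun k => conv F x k - \sum_(m <- s) F m *m x (k + m)) =
    conv (fun m => if m \in s then 0 else F m) x; last exact: conv_L2by.
apply/funext => k; apply/eqP; rewrite subr_eq; apply/eqP.
have hG : summable_by (fun m => if m \in s then F m else 0) c.
  move=> s' us'; apply: le_trans (hF _ us'); apply: ler_sum => m _.
  by case: ifP; rewrite // enorm0 enorm_ge0.
rewrite (_ : \sum_(m <- s) _ = conv (fun m => if m \in s then F m else 0) x k).
  rewrite /conv -(zsumD (conv_summable k he hx) (conv_summable k hG hx)).
  congr zsum; apply/funext => l.
  by case: ifP; rewrite mul0mx ?add0r ?addr0.
rewrite /conv (@zsum_supp _ [seq k + m | m <- s]).
- rewrite big_map; apply: eq_big_seq => m ms.
  by rewrite [k + m]addrC addrK ms.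
- by rewrite map_inj_uniq // => a b /addrI.
- move=> l lk; case: ifP => [ls|]; last by rewrite mul0mx.
  by case/negP: lk; apply/mapP; exists (l - k); rewrite // addrC subrK.
Qed.

(** Taken for scalar matrices [A] this is linearity; with matrices in place of
    scalars the lemmas on [zsum] and matrix products apply. *)
Lemma conv_linear F x y c C C' (A : 'M[R[i]]_d) :
  summable_by F c -> (forall m, A *m F m = F m *m A) -> L2by x C -> L2by y C' ->
  conv F (fun l => A *m x l + y l) = (fun k => A *m conv F x k + conv F y k).
Proof.
move=> hF hA hx hy; apply/funext => k; rewrite /conv.
rewrite -(zsum_mulmx A (conv_summable k hF hx)).
have hAx : summable_by (fun l => A *m (F (l - k) *m x l)) (c * (enorm A * C)).
  have -> : (fun l => A *m (F (l - k) *m x l)) = (fun l => F (l - k) *m (A *m x l)).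
    by apply/funext => l; rewrite !mulmxA hA.
  have hAx : L2by (fun l => A *m x l) (enorm A * C) by apply: L2byM.
  exact: (conv_summable k hF hAx).
rewrite -(zsumD hAx (conv_summable k hF hy)); congr zsum.
by apply/funext => l; rewrite mulmxDr !mulmxA hA.
Qed.

End Convolution.

Section Completeness.
Variable d : nat.
Implicit Types (x y : zseq R d).

(** The limit is taken entrywise; [L2by_fatou] turns the bounds on the distances
    between terms into bounds on the distance to the limit. *)
Lemma L2by_complete (x_ : nat -> zseq R d) (b : nat -> R) (B : R) :
  (forall n, L2by (fun k => x_ n.+1 k - x_ n k) (b n)) ->
  (forall N, \sum_(n < N) b n <= B) ->
  forall n e, (forall N, \sum_(n <= j < N) b j <= e) ->
  L2by (fun k => mxlim (fun n => x_ n k) - x_ n k) e.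
Proof.
move=> hb hB n e he.
have cv k : mxcvg (fun n => x_ n k) (mxlim (fun n => x_ n k)).
  apply: mxcvg_lim => q; pose u j := x_ j.+1 k - x_ j k.
  have uB N : \sum_(j < N) enorm (u j) <= B.
    apply: le_trans (hB N); apply: ler_sum => j _.
    exact: (L2by_pt k (hb j)).
  have := @series_parts_cvg _ _ _ u B q uB => /cvg_ex[l hl].
  apply/cvg_ex; exists (part (x_ 0%N k) q + l).
  rewrite (_ : (fun N => _) = (fun N => part (x_ 0%N k) q + part (\sum_(j < N) u j) q)).
    by apply: cvgD hl; exact: cvg_cst.
  apply/funext => N; rewrite -partD; congr part.
  by rewrite -(big_mkord xpredT u) /u telescope_sumr // addrC subrK.
have hd N : (n <= N)%N -> L2by (fun k => x_ N k - x_ n k) e.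
  move=> nN; apply: (@L2by_le _ _ (\sum_(n <= j < N) b j)); last exact: he.
  have := L2by_sum (index_iota n N) hb; congr L2by; apply/funext => k.
  exact: telescope_sumr.
apply: L2by_fatou => s e' us e'0.
have [N hN] := mxcvg_unif s cv e'0.
exists (fun k => x_ (maxn n N) k - x_ n k).
  by apply: (L2by_le (hd _ (leq_maxl _ _))); rewrite lerDl ltW.
by move=> k ks; rewrite opprB addrA subrK enormBC; apply: hN; rewrite // leq_maxr.
Qed.

End Completeness.

Section Interface.
Variable d : nat.
Implicit Types (x y : zseq R d).

Lemma L2by_l2 x C : L2by x C -> l2 x /\ l2norm x <= C.
Proof.
move=> h; have hs : (l2sq x <= (C ^+ 2)%:E)%E.
  apply: ge_ereal_sup => _ [A [finA _] <-].
  rewrite fsbig_finite //= sumEFin lee_fin -l2sumK.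
  rewrite lerXn2r ?nnegrE ?l2sum_ge0 ?(L2by_ge0 h) //.
  exact/h/finmap.fset_uniq.
have x0 : (0 <= l2sq x)%E by apply: esum_ge0 => k _; rewrite lee_fin sqr_ge0.
split; first by rewrite /l2 /= (le_lt_trans hs) ?ltry.
rewrite /l2norm -[leRHS]ger0_norm ?(L2by_ge0 h) // -sqrtr_sqr ler_wsqrtr //.
by rewrite -lee_fin fineK // ge0_fin_numE // (le_lt_trans hs) ?ltry.
Qed.

Lemma l2_L2by x C : l2 x -> l2norm x <= C -> L2by x C.
Proof.
move=> hx hC s us; apply: le_trans hC; rewrite /l2sum /l2norm ler_wsqrtr //.
have x0 : (0 <= l2sq x)%E by apply: esum_ge0 => k _; rewrite lee_fin sqr_ge0.
rewrite -lee_fin fineK; last by rewrite ge0_fin_numE.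
apply: esum_ge; exists [set` s]; first by split => //; exact: finite_seq.
by rewrite -fsbig_seq //= sumEFin.
Qed.

End Interface.
End Zseq.

(** * Mean values of trigonometric polynomials *)

Section BohrMean.
Variable R : realType.

Definition bdd_seq (f : nat -> R) := exists C, forall n, `|f n| <= C.

Lemma bdd_seqD f g : bdd_seq f -> bdd_seq g -> bdd_seq (fun n => f n + g n).
Proof.
by move=> [C hC] [C' hC']; exists (C + C') => n; rewrite (le_trans (ler_normD _ _)) ?lerD.
Qed.

Lemma bdd_seqZ (a : R) f : bdd_seq f -> bdd_seq (fun n => a * f n).
Proof. by move=> [C hC]; exists (`|a| * C) => n; rewrite normrM ler_wpM2l. Qed.

Lemma bdd_seq0 : bdd_seq (fun=> 0).
Proof. by exists 0 => n; rewrite normr0. Qed.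

Lemma bdd_seq_sum (I : eqType) (s : seq I) (f : I -> nat -> R) :
  (forall i, i \in s -> bdd_seq (f i)) -> bdd_seq (fun n => \sum_(i <- s) f i n).
Proof.
elim: s => [|i s IH] h; first by under eq_fun do rewrite big_nil; exact: bdd_seq0.
under eq_fun do rewrite big_cons; apply: bdd_seqD; first by apply: h; rewrite mem_head.
by apply: IH => j js; apply: h; rewrite inE js orbT.
Qed.

(** Multiplied by [2 * (1 - cos x)] the sum telescopes. *)
Lemma sum_cos_bdd (x y : R) : cos x != 1 ->
  bdd_seq (fun n => \sum_(k < n) cos (k%:R * x + y)).
Proof.
move=> x1; have c0 : 0 < 1 - cos x by rewrite subr_gt0 lt_neqAle x1 cos_le1.
exists (2 / (1 - cos x)) => n; rewrite ler_pdivlMr //.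
pose h k := cos (k%:R * x - x + y) - cos (k%:R * x + y).
have -> : `|\sum_(k < n) cos (k%:R * x + y)| * (1 - cos x) = `|h n - h 0%N| / 2.
  rewrite -[1 - cos x]ger0_norm ?ltW // -normrM -[2%:R]ger0_norm // -normf_div.
  congr `|_|; apply: (@mulIf _ 2) => //; rewrite divfK //.
  elim: n => [|n IH]; first by rewrite big_ord0 !mul0r subrr.
  rewrite big_ord_recr /= !mulrDl IH /h -[in n.+1%:R]natr1 [(n%:R + 1) * x]mulrDl mul1r.
  rewrite [n%:R * x + x - x]addrK.
  have -> : n%:R * x - x + y = (n%:R * x + y) - x by ring.
  have -> : n%:R * x + x + y = (n%:R * x + y) + x by ring.
  set u := n%:R * x + y; rewrite (cosB u) (cosD u); ring.
rewrite ler_pdivrMr // (le_trans (ler_normB _ _)) //.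
have hh k : `|h k| <= 2.
  rewrite /h (le_trans (ler_normB _ _)) //.
  have := cos_max (k%:R * x - x + y); have := cos_max (k%:R * x + y); lra.
have := hh n; have := hh 0%N; lra.
Qed.

Lemma sum_sin_bdd (x : R) : cos x != 1 ->
  bdd_seq (fun n => \sum_(k < n) sin (k%:R * x)).
Proof.
move=> x1; have [C hC] := sum_cos_bdd (- (pi / 2)) x1; exists C => n.
have := hC n; congr (`|_| <= _); apply: eq_bigr => k _.
by rewrite -cosBpihalf.
Qed.

Lemma cabs2_sum (I : Type) (s : seq I) (z : I -> R[i]) :
  cabs2 (\sum_(i <- s) z i) = \sum_(i <- s) \sum_(j <- s)
    (complex.Re (z i) * complex.Re (z j) + complex.Im (z i) * complex.Im (z j)).
Proof.
rewrite /cabs2 !raddf_sum /= !expr2 !big_distrlr /= -big_split /=.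
by apply: eq_bigr => i _; rewrite -big_split.
Qed.

Lemma bohr_mean_scalar (I : eqType) (s : seq I) (th : I -> R) (a : I -> R[i]) :
  uniq s -> {in s &, forall i j, i != j -> cos (th i - th j) != 1} ->
  bdd_seq (fun n => \sum_(k < n) cabs2 (\sum_(i <- s) cis (k%:R * th i) * a i)
                    - n%:R * \sum_(i <- s) cabs2 (a i)).
Proof.
move=> us hs.
pose P i j := complex.Re (a i) * complex.Re (a j) + complex.Im (a i) * complex.Im (a j).
pose Q i j := complex.Re (a i) * complex.Im (a j) - complex.Im (a i) * complex.Re (a j).
pose K i j n := P i j * \sum_(k < n) cos (k%:R * (th i - th j) + 0) +
                Q i j * \sum_(k < n) sin (k%:R * (th i - th j)).
pose K' i j n := if i == j then 0 else K i j n.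
have -> : (fun n => \sum_(k < n) cabs2 (\sum_(i <- s) cis (k%:R * th i) * a i)
             - n%:R * \sum_(i <- s) cabs2 (a i)) =
    (fun n => \sum_(i <- s) \sum_(j <- s) K' i j n).
  apply/funext => n; apply/eqP; rewrite subr_eq; apply/eqP.
  under eq_bigr do rewrite cabs2_sum.
  rewrite exchange_big /= mulr_sumr -big_split /=.
  rewrite big_seq [RHS]big_seq; apply: eq_bigr => i si; rewrite exchange_big /=.
  rewrite (bigD1_seq i) //= [X in _ = X + _](bigD1_seq i) //=.
  rewrite [K' i i n]/K' eqxx add0r [RHS]addrC; congr (_ + _).
    rewrite -[n in n%:R]card_ord -sum1_card natr_sum mulr_suml.
    apply: eq_bigr => k _; rewrite -!expr2 -[LHS]/(cabs2 _) cabs2M; congr (_ * _).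
    by rewrite /cabs2 /cis /= cos2Dsin2.
  apply: eq_bigr => j ji; rewrite /K' eq_sym (negbTE ji) /K !mulr_sumr -big_split /=.
  apply: eq_bigr => k _; rewrite addr0 mulrBr cosB sinB /P /Q /cis.
  by case: (a i) (a j) => p q [p' q'] /=; ring.
apply: bdd_seq_sum => i si; apply: bdd_seq_sum => j sj; rewrite /K'.
have [_|ij] := eqVneq i j; first exact: bdd_seq0.
apply: bdd_seqD; apply: bdd_seqZ; first exact: sum_cos_bdd (hs _ _ si sj ij).
exact: sum_sin_bdd (hs _ _ si sj ij).
Qed.

(** Distinct characters are orthogonal for the mean over the integers, with a
    bounded error in the partial sums. *)
Lemma bohr_mean d (I : eqType) (s : seq I) (th : I -> R) (a : I -> 'cV[R[i]]_d) :
  uniq s -> {in s &, forall i j, i != j -> cos (th i - th j) != 1} ->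
  bdd_seq (fun n => \sum_(k < n) enorm (\sum_(i <- s) cis (k%:R * th i) *: a i) ^+ 2
                    - n%:R * \sum_(i <- s) enorm (a i) ^+ 2).
Proof.
move=> us hs.
have -> : (fun n => \sum_(k < n) enorm (\sum_(i <- s) cis (k%:R * th i) *: a i) ^+ 2
                    - n%:R * \sum_(i <- s) enorm (a i) ^+ 2) =
  (fun n => \sum_(r < d) (\sum_(k < n) cabs2 (\sum_(i <- s) cis (k%:R * th i) * a i r ord0)
                    - n%:R * \sum_(i <- s) cabs2 (a i r ord0))).
  apply/funext => n; rewrite sumrB -mulr_sumr; congr (_ - _ * _).
    rewrite [RHS]exchange_big /=; apply: eq_bigr => k _; rewrite enorm_sqr.
    apply: eq_bigr => r _; rewrite big_ord1 summxE; congr cabs2.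
    by apply: eq_bigr => i _; rewrite mxE.
  rewrite [RHS]exchange_big /=; apply: eq_bigr => i _; rewrite enorm_sqr.
  by apply: eq_bigr => r _; rewrite big_ord1.
by apply: bdd_seq_sum => r _; exact: bohr_mean_scalar.
Qed.

Lemma cos_neq1 (x : R) : 0 < `|x| -> `|x| < 2 * pi -> cos x != 1.
Proof.
move=> x0 xpi; have -> : cos x = cos `|x|.
  by have [_|_] := ger0P x; rewrite ?cosN.
have -> : `|x| = `|x| / 2 + `|x| / 2 by rewrite -splitr.
have s0 : 0 < sin (`|x| / 2) by apply: sin_gt0_pi; apply/andP; split; lra.
rewrite cosD; have := cos2Dsin2 (`|x| / 2); rewrite !expr2 => h.
by apply/eqP => h1; nra.
Qed.

End BohrMean.

(** * Words of delays *)

Lemma sum_group (V : nmodType) (I J : eqType) (s : seq I) (g : I -> J) (F : I -> V) :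
  \sum_(i <- s) F i = \sum_(x <- undup (map g s)) \sum_(i <- s | g i == x) F i.
Proof.
under [RHS]eq_bigr do rewrite big_mkcond.
rewrite exchange_big /= big_seq [RHS]big_seq; apply: eq_bigr => i si.
rewrite (bigD1_seq (g i)) ?undup_uniq ?mem_undup ?map_f //= eqxx big1 ?addr0 // => x.
by rewrite eq_sym => /negbTE ->.
Qed.

Section Words.
Variables (R : realType) (n : nat).
Notation letter := 'I_n.+1.
Variable tau : letter -> R.
Hypothesis tau0_gt0 : 0 < tau ord0.
Hypothesis tau_min : forall j, tau ord0 <= tau j.

Lemma tau_gt0 j : 0 < tau j.
Proof. exact: lt_le_trans (tau_min j). Qed.

Definition delay (w : seq letter) : R := \sum_(j <- w) tau j.

Lemma delay_cons j w : delay (j :: w) = tau j + delay w.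
Proof. by rewrite /delay big_cons. Qed.

Lemma delay_ge w : (size w)%:R * tau ord0 <= delay w.
Proof.
elim: w => [|j w IH]; first by rewrite /delay big_nil mul0r.
by rewrite delay_cons /= -natr1 mulrDl mul1r addrC lerD.
Qed.

Lemma delay_ge0 w : 0 <= delay w.
Proof. by apply: le_trans (delay_ge w); rewrite mulr_ge0 // ltW. Qed.

Fixpoint words (k : nat) : seq (seq letter) :=
  if k is k'.+1 then [seq j :: w | j <- enum letter, w <- words k'] else [:: [::]].

Lemma mem_words k w : (w \in words k) = (size w == k).
Proof.
elim: k w => [|k IH] w; first by rewrite inE; case: w.
apply/allpairsP/idP => [[[j w'] /= [_]]|]; first by rewrite IH => /eqP <- ->.
case: w => // j w /=; rewrite eqSS => hw; exists (j, w).
by split; rewrite ?mem_enum //= IH.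
Qed.

Lemma words_uniq k : uniq (words k).
Proof.
elim: k => // k IH; apply: allpairs_uniq => //; first exact: enum_uniq.
by case=> j w [j' w'] _ _ /= [-> ->].
Qed.

(** A bound for the lengths of the words with total delay at most [L]. *)
Definition len (L : R) : nat := (Num.truncn (L / tau ord0)).+1.

Lemma size_len w L : delay w <= L -> (size w < len L)%N.
Proof.
move=> h; rewrite /len ltnS truncn_ge_nat.
  by rewrite ler_pdivlMr // (le_trans (delay_ge w)).
by rewrite divr_ge0 ?(ltW tau0_gt0) // (le_trans (delay_ge0 w)).
Qed.

Definition wordsle (L : R) : seq (seq letter) :=
  [seq w <- flatten [seq words k | k <- iota 0 (len L)] | delay w <= L].

Lemma mem_wordsle L w : (w \in wordsle L) = (delay w <= L).
Proof.
rewrite mem_filter; case: leP => [h|//]; rewrite andTb; apply/flattenP.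
exists (words (size w)); last by rewrite mem_words.
by apply: map_f; rewrite mem_iota /= size_len.
Qed.

Lemma wordsle_uniq L : uniq (wordsle L).
Proof.
apply: filter_uniq; elim: (len L) 0%N => [//|k IH] a.
suff : uniq (words a ++ flatten [seq words l | l <- iota a.+1 k]) by [].
rewrite cat_uniq words_uniq IH andbT; apply/hasPn => w hw.
have /flattenP[ws /mapP[b]] : w \in flatten [seq words l | l <- iota a.+1 k] := hw.
rewrite mem_iota => /andP[ab _] ->; rewrite !mem_words => /eqP ->.
by rewrite gtn_eqF.
Qed.

Lemma wordsle_lt0 L : L < 0 -> wordsle L = [::].
Proof.
move=> L0; apply/eqP; rewrite -size_eq0 -leqn0 leqNgt -has_predT.
apply/hasPn => w; rewrite mem_wordsle => h.
by have := le_lt_trans (le_trans (delay_ge0 w) h) L0; rewrite ltxx.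
Qed.

Lemma sum_wordsle_cons (V : nmodType) L (F : seq letter -> V) : 0 <= L ->
  \sum_(w <- wordsle L) F w =
  F [::] + \sum_j \sum_(w <- wordsle (L - tau j)) F (j :: w).
Proof.
move=> L0; pose s := [seq j :: w | j <- enum letter, w <- wordsle (L - tau j)].
have us : uniq ([::] :: s).
  rewrite /= allpairs_uniq_dep ?enum_uniq // => [|j _|]; last 2 first.
  - exact: wordsle_uniq.
  - by move=> [j w] [j' w'] _ _ /= [-> ->].
  by rewrite andbT; apply/allpairsPdep => -[j [w [_ _]]].
rewrite (perm_big ([::] :: s)) /=; last first.
  apply: uniq_perm us _; first exact: wordsle_uniq.
  move=> w; rewrite mem_wordsle inE; case: w => [|j w].
    by rewrite eqxx /delay big_nil.
  apply/idP/allpairsPdep => [h|[j' [w' [_ h [-> ->]]]]].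
    exists j, w; rewrite mem_enum mem_wordsle; split => //.
    by rewrite lerBrDl -delay_cons.
  by move: h; rewrite mem_wordsle delay_cons lerBrDl.
rewrite big_cons big_allpairs_dep /= big_enum.
by [].
Qed.

Lemma sum_wordsle_rcons (V : nmodType) L (F : seq letter -> V) : 0 <= L ->
  \sum_(w <- wordsle L) F w =
  F [::] + \sum_j \sum_(w <- wordsle (L - tau j)) F (rcons w j).
Proof.
have wordsle_rev M G : \sum_(w <- wordsle M) G w = \sum_(w <- wordsle M) G (rev w) :> V.
  rewrite -(big_map (@rev letter) xpredT G); apply/perm_big/uniq_perm.
  - exact: wordsle_uniq.
  - by rewrite map_inj_uniq ?wordsle_uniq //; exact: inv_inj (@revK _).
  move=> w; rewrite -{2}(revK w) mem_map; last exact: inv_inj (@revK _).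
  by rewrite !mem_wordsle /delay (perm_big _ (permEl (perm_rev w))).
move=> L0; rewrite wordsle_rev sum_wordsle_cons //; congr (_ + _).
apply: eq_bigr => j _; rewrite [RHS]wordsle_rev.
by apply: eq_bigr => w _; rewrite rev_cons.
Qed.

Lemma sum_wordsle_le (V : nmodType) L L' (P : pred (seq letter)) (F : seq letter -> V) :
  L <= L' -> (forall w, P w -> delay w <= L) ->
  \sum_(w <- wordsle L' | P w) F w = \sum_(w <- wordsle L | P w) F w.
Proof.
move=> LL' hP; rewrite -[LHS]big_filter -[RHS]big_filter; apply/perm_big/uniq_perm.
- by rewrite filter_uniq ?wordsle_uniq.
- by rewrite filter_uniq ?wordsle_uniq.
move=> w; rewrite !(mem_filter P) !mem_wordsle; case: (boolP (P w)) => //= /hP h.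
by rewrite h (le_trans h).
Qed.

Lemma sum_wordsle_split (V : nmodType) L L' (F : seq letter -> V) : L' <= L ->
  \sum_(w <- wordsle L) F w =
  \sum_(w <- wordsle L') F w + \sum_(w <- wordsle L | L' < delay w) F w.
Proof.
move=> LL; rewrite (bigID (fun w => delay w <= L')) /=; congr (_ + _).
  rewrite (sum_wordsle_le (L := L')) // big_seq_cond [RHS]big_seq.
  by apply: eq_bigl => w; rewrite mem_wordsle andbb.
by apply: eq_bigl => w; rewrite ltNge.
Qed.

Definition delaysle L : seq R := undup (map delay (wordsle L)).

Lemma mem_delaysle L x : x \in delaysle L -> 0 <= x <= L.
Proof.
rewrite mem_undup => /mapP[w]; rewrite mem_wordsle => h ->.
by rewrite delay_ge0 h.
Qed.

(** The number of words grows exponentially with [L], but that of their delays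
    only polynomially: the delay of a word depends only on the numbers of
    occurrences of its letters. *)
Lemma size_delaysle L : (size (delaysle L) <= len L ^ n.+1)%N.
Proof.
pose g (f : {ffun letter -> 'I_(len L)}) : R := \sum_j tau j *+ f j.
have -> : (len L ^ n.+1)%N = size (map g (enum {ffun letter -> 'I_(len L)})).
  by rewrite size_map -cardE card_ffun !card_ord.
apply: uniq_leq_size; first exact: undup_uniq.
move=> x; rewrite mem_undup => /mapP[w]; rewrite mem_wordsle => h ->.
have hc j : (count_mem j w < len L)%N.
  exact: leq_ltn_trans (count_size _ _) (size_len h).
apply/mapP; exists [ffun j => Ordinal (hc j)]; first by rewrite mem_enum.
rewrite /g; under eq_bigr do rewrite ffunE /=.
elim: w {h hc} => [|k w IH]; first by rewrite /delay big_nil big1.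
rewrite delay_cons IH; under [RHS]eq_bigr do rewrite /= mulrnDr.
rewrite big_split /=; congr (_ + _); rewrite (bigD1 k) //= eqxx big1 ?addr0 // => j.
by rewrite eq_sym => /negbTE ->.
Qed.

Lemma len_exp_le (e : R) : 0 < e -> exists2 C, 0 < C &
  forall L, 0 <= L -> (len L ^ n.+1)%N%:R <= C * expR (e * L).
Proof.
move=> e0; pose h := e / n.+1%:R; have h0 : 0 < h by rewrite divr_gt0.
have ht : 0 < h * tau ord0 by rewrite mulr_gt0.
exists ((expR (h * tau ord0) / (h * tau ord0)) ^+ n.+1).
  by rewrite exprn_gt0 // divr_gt0 ?expR_gt0.
move=> L L0; have -> : expR (e * L) = expR (h * L) ^+ n.+1.
  rewrite -expRM_natl; congr expR.
  by rewrite mulrA [n.+1%:R * h]mulrC divfK // pnatr_eq0.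
rewrite natrX -exprMn lerXn2r ?nnegrE ?mulr_ge0 ?invr_ge0 ?expR_ge0 ?(ltW ht) //.
rewrite mulrAC ler_pdivlMr // -expRD /len.
have tL : (Num.truncn (L / tau ord0))%:R <= L / tau ord0.
  by rewrite truncn_le // divr_ge0 // ltW.
have h1 : (Num.truncn (L / tau ord0)).+1%:R * (h * tau ord0) <= h * tau ord0 + h * L.
  rewrite -natr1 mulrDl mul1r addrC lerD2l.
  have -> : h * L = L / tau ord0 * (h * tau ord0).
    by rewrite mulrCA divfK // gt_eqF.
  by rewrite ler_wpM2r // ltW.
apply: le_trans h1 _; apply: le_trans (expR_ge1Dx _); by rewrite lerDr.
Qed.

Section Coefficients.
Variables (d : nat) (D : letter -> R -> 'M[R[i]]_d).

(** Iterating the equation along [w] makes [y t] depend on [y (t - delay w)] with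
    this coefficient. *)
Fixpoint wcoef (w : seq letter) (t : R) : 'M[R[i]]_d :=
  if w is j :: w' then D j t *m wcoef w' (t - tau j) else 1%:M.

(** [fund x t] is X(t, t - x), where X is the fundamental solution: the solution
    of the equation with a Kronecker delta as source. *)
Definition fund (x t : R) : 'M[R[i]]_d :=
  \sum_(w <- wordsle x | delay w == x) wcoef w t.

Lemma fundE L x t : x <= L ->
  fund x t = \sum_(w <- wordsle L | delay w == x) wcoef w t.
Proof.
by move=> xL; symmetry; apply: sum_wordsle_le => // w /eqP ->.
Qed.

Lemma fund_lt0 x t : x < 0 -> fund x t = 0.
Proof. by move=> x0; rewrite /fund wordsle_lt0 // big_nil. Qed.

Lemma fund0 t : fund 0 t = 1%:M.
Proof.
rewrite /fund big_mkcond sum_wordsle_cons // /delay big_nil eqxx big1 ?addr0 // => j _.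
by rewrite wordsle_lt0 ?big_nil // sub0r oppr_lt0 tau_gt0.
Qed.

Lemma fund_gt0 x t : 0 < x ->
  fund x t = \sum_j D j t *m fund (x - tau j) (t - tau j).
Proof.
move=> x0; rewrite /fund big_mkcond sum_wordsle_cons ?ltW //.
rewrite /delay big_nil eq_sym gt_eqF // add0r; apply: eq_bigr => j _.
rewrite mulmx_sumr [RHS]big_mkcond; apply: eq_bigr => w _ /=.
by rewrite big_cons [in RHS]eq_sym subr_eq [in RHS]addrC [in LHS]eq_sym.
Qed.

Lemma fund_notin L x t : x <= L -> x \notin delaysle L -> fund x t = 0.
Proof.
move=> xL h; rewrite (fundE t xL) big1_seq // => w /andP[/eqP wx ws].
by case/negP: h; rewrite mem_undup -wx map_f.
Qed.

Lemma sum_wordsle_fund m L t (g : R -> 'M[R[i]]_(d, m)) :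
  \sum_(w <- wordsle L) wcoef w t *m g (delay w) =
  \sum_(x <- delaysle L) fund x t *m g x.
Proof.
rewrite (sum_group _ delay) big_seq [RHS]big_seq; apply: eq_bigr => x /mem_delaysle.
move=> /andP[_ xL]; rewrite (fundE t xL) mulmx_suml.
by apply: eq_bigr => w /eqP ->.
Qed.

(** The series over words solves the equation with source [f]: only finitely
    many words count, as [f] vanishes before [a]. *)
Definition causal m (a : R) (f : R -> 'M[R[i]]_(d, m)) (t : R) : 'M[R[i]]_(d, m) :=
  \sum_(w <- wordsle (t - a)) wcoef w t *m f (t - delay w).

Lemma causal_lt m a (f : R -> 'M[R[i]]_(d, m)) t : t < a -> causal a f t = 0.
Proof. by move=> ta; rewrite /causal wordsle_lt0 ?big_nil // subr_lt0. Qed.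

Lemma causal_eq m a (f : R -> 'M[R[i]]_(d, m)) t : a <= t ->
  causal a f t = f t + \sum_j D j t *m causal a f (t - tau j).
Proof.
move=> at_; rewrite /causal sum_wordsle_cons ?subr_ge0 //=.
rewrite mul1mx /delay big_nil subr0; congr (_ + _); apply: eq_bigr => j _.
rewrite mulmx_sumr addrAC; apply: eq_bigr => w _.
by rewrite big_cons opprD addrA mulmxA.
Qed.

(** Each step of length [tau ord0] after [a] only looks back at earlier steps. *)
Lemma causal_unique m a (z f : R -> 'M[R[i]]_(d, m)) :
  (forall t, t < a -> z t = 0) ->
  (forall t, a <= t -> z t = f t + \sum_j D j t *m z (t - tau j)) ->
  forall t, z t = causal a f t.
Proof.
move=> z0 hz; suff h k t : t - a < k%:R * tau ord0 -> z t = causal a f t.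
  move=> t; apply: (h (len (t - a))); rewrite -ltr_pdivrMr //.
  exact: truncnS_gt.
elim: k t => [|k IH] t htk.
  by rewrite z0 ?causal_lt //; move: htk; rewrite mul0r subr_lt0.
have [ta|at_] := ltP t a; first by rewrite z0 // causal_lt.
rewrite hz // causal_eq //; congr (_ + _); apply: eq_bigr => j _.
rewrite IH //; move: htk; rewrite -natr1 mulrDl mul1r.
have := tau_min j; lra.
Qed.

End Coefficients.
End Words.

(** * The harmonic operator as a sum of block Toeplitz operators *)

Section Operators.
Variables (R : realType) (d n : nat).
Variables (tau : 'I_n.+1 -> R) (T : R) (D : 'I_n.+1 -> R -> 'M[R[i]]_d).
Implicit Types (p : R[i]) (x y : zseq R d).

Notation om := (2 * pi / T).

(** The factor by which a delay [r] multiplies e^((p - i l omega) t). *)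
Definition chi p (l : int) (r : R) : R[i] :=
  cexp (- (p - Complex 0 (l%:~R * om)) * Complex r 0).

Lemma chiE p l r :
  chi p l r = Complex (expR (- (complex.Re p * r))) 0 *
              cis ((l%:~R * om - complex.Im p) * r).
Proof.
rewrite /chi; case: p => a b.
rewrite (_ : - _ * _ = Complex (- (a * r)) ((l%:~R * om - b) * r)) ?cexp_cis //.
by congr Complex; rewrite /=; ring.
Qed.

Lemma chiD p l r r' : chi p l (r + r') = chi p l r * chi p l r'.
Proof.
rewrite /chi -cexpD -mulrDr; congr (cexp (_ * _)).
by congr Complex; rewrite /= addr0.
Qed.

Lemma chi_addl p l m r : chi p (l + m) r = chi p l r * cis (m%:~R * om * r).
Proof. by rewrite !chiE -[RHS]mulrA -cisD; congr (_ * cis _); rewrite intrD; ring. Qed.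

Lemma enorm_chiZ m k p l r (A : 'M[R[i]]_(m, k)) :
  enorm (chi p l r *: A) = expR (- (complex.Re p * r)) * enorm A.
Proof.
rewrite enorm_cexpZ; congr (expR _ * _); case: p => a b /=; ring.
Qed.

Definition twist p (r : R) x : zseq R d := fun l => chi p l r *: x l.

Lemma twist_L2by p r x C :
  L2by x C -> L2by (twist p r x) (expR (- (complex.Re p * r)) * C).
Proof. by move=> h; apply: (L2by_scale (expR_ge0 _) h) => l; rewrite enorm_chiZ. Qed.

Variable F : 'I_n.+1 -> int -> 'M[R[i]]_d.
Variable c : R.
Hypothesis F_summable : forall j, summable_by (F j) c.
Hypothesis F_inversion : forall j t,
  mxcvg (fun N => \sum_(m <- win N) cis (m%:~R * om * t) *: F j m) (D j t).

(** Multiplication of e^(p t) u(t), u periodic, by [D j] after the delay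
    [tau j], read on the Fourier coefficients of u. *)
Definition delop p j x : zseq R d := conv (F j) (twist p (tau j) x).

Lemma delop_L2by p j x C : L2by x C ->
  L2by (delop p j x) (c * (expR (- (complex.Re p * tau j)) * C)).
Proof. by move=> h; apply: conv_L2by => //; exact: twist_L2by. Qed.

Definition delop_trunc k p j x : zseq R d :=
  fun l => \sum_(m <- win k) F j m *m twist p (tau j) x (l + m).

Definition D_trunc k j t : 'M[R[i]]_d :=
  \sum_(m <- win k) cis (m%:~R * om * t) *: F j m.

Lemma summable_tail (G : int -> 'M[R[i]]_d) b e : summable_by G b -> 0 < e ->
  exists N, forall k, (N <= k)%N ->
    summable_by (fun m => if m \in win k then 0 else G m) e.
Proof.
move=> h e0; pose S := [set a | exists2 s : seq int, uniq s &
  a = \sum_(k <- s) enorm (G k)].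
have hS : has_sup S.
  split; first by exists (\sum_(k <- [::]) enorm (G k)); exists [::].
  by exists b => _ [s us ->]; exact: h.
have [_ [s us ->] hs] := sup_adherent e0 hS.
have [N hN] := win_sub_seq s; exists N => k Nk s' us'.
have {}hN l : l \in s -> l \in win k.
  by move=> /hN; rewrite !mem_win => /leq_trans; apply.
rewrite (bigID (mem (win k))) /= big1_seq ?add0r; last first.
  by move=> l /andP[-> _]; rewrite enorm0.
under eq_bigr => l /negbTE -> do [].
rewrite -big_filter; set s1 := [seq _ <- _ | _].
have : sup S >= \sum_(k <- s ++ s1) enorm (G k).
  apply: ub_le_sup; first by case: hS.
  exists (s ++ s1) => //; rewrite cat_uniq us filter_uniq // andbT.
  apply/hasPn => l; rewrite mem_filter => /andP[lk _]; exact: contra (hN l) lk.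
by rewrite big_cat /=; move: hs; lra.
Qed.

Lemma F_tail e : 0 < e -> exists N, forall k j, (N <= k)%N ->
  summable_by (fun m => if m \in win k then 0 else F j m) e.
Proof.
move=> e0; suff [N hN] : exists N, forall j k, j \in enum 'I_n.+1 -> (N <= k)%N ->
    summable_by (fun m => if m \in win k then 0 else F j m) e.
  by exists N => k j Nk; apply: hN; rewrite ?mem_enum.
elim: (enum _) => [|i s [N hN]]; first by exists 0%N.
have [N' hN'] := summable_tail (F_summable i) e0; exists (maxn N N') => j k.
by rewrite inE geq_max => /orP[/eqP ->|js] /andP[k1 k2]; [exact: hN'|exact: hN].
Qed.

Lemma D_trunc_near k j t e :
  summable_by (fun m => if m \in win k then 0 else F j m) e ->
  enorm (D_trunc k j t - D j t) <= e.
Proof.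
move=> he; apply/ler_addgt0Pl => e' e'0; have [N hN] := F_inversion j t e'0.
have := hN (maxn N k) (leq_maxl _ _); rewrite -/(D_trunc (maxn N k) j t) => h.
rewrite -(subrKA (D_trunc (maxn N k) j t)) addrC.
apply: le_trans (enormD _ _) _; apply: lerD => //.
rewrite enormBC; apply: le_trans (he (win (maxn N k)) (win_uniq _)).
have -> : D_trunc (maxn N k) j t - D_trunc k j t = \sum_(m <- win (maxn N k))
    if m \in win k then 0 else cis (m%:~R * om * t) *: F j m.
  rewrite /D_trunc [in LHS](bigID (mem (win k))) /= -big_filter.
  rewrite (perm_big (win k)) /=.
    by rewrite addrAC subrr add0r big_mkcond; apply: eq_bigr => m _; rewrite if_neg.
  apply: uniq_perm; rewrite ?filter_uniq ?win_uniq // => m.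
  by rewrite mem_filter !mem_win leq_max andb_idr // => ->; rewrite orbT.
apply: le_trans (enorm_sum _ _ _) _; apply: ler_sum => m _.
by case: ifP => _; rewrite ?enorm_cisZ ?enorm0.
Qed.

Lemma D_bounded j t : enorm (D j t) <= c.
Proof.
apply/ler_addgt0Pl => e e0; have [N hN] := F_inversion j t e0.
rewrite -[D j t](subKr (D_trunc N j t)) (le_trans (enormB _ _)) //.
rewrite [leRHS]addrC; apply: lerD; last exact: hN.
apply: le_trans (enorm_sum _ _ _) _; apply: le_trans (F_summable j (win_uniq N)).
by apply: ler_sum => m _; rewrite enorm_cisZ.
Qed.

Lemma c_ge0 : 0 <= c.
Proof. exact: le_trans (enorm_ge0 _) (D_bounded ord0 0). Qed.

Lemma delop_approx k p j x C e :
  summable_by (fun m => if m \in win k then 0 else F j m) e -> L2by x C ->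
  L2by (fun l => delop p j x l - delop_trunc k p j x l)
       (e * (expR (- (complex.Re p * tau j)) * C)).
Proof.
by move=> he hx; apply: (conv_approx (win_uniq k) (F_summable j) he); exact: twist_L2by.
Qed.

Lemma twistD p r x y (A : 'M[R[i]]_d) :
  twist p r (fun l => A *m x l + y l) = (fun l => A *m twist p r x l + twist p r y l).
Proof. by apply/funext => l; rewrite /twist scalerDr scalemxAr. Qed.

Lemma delop_linear p j x y C C' (a : R[i]) : L2by x C -> L2by y C' ->
  delop p j (fun l => a *: x l + y l) = (fun l => a *: delop p j x l + delop p j y l).
Proof.
move=> hx hy.
have -> : (fun l => a *: x l + y l) = (fun l => a%:M *m x l + y l).
  by apply/funext => l; rewrite mul_scalar_mx.
rewrite /delop twistD (conv_linear (F_summable j) _ (twist_L2by p (tau j) hx)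
  (twist_L2by p (tau j) hy)).
  by apply/funext => l; rewrite mul_scalar_mx.
by move=> m; rewrite mul_scalar_mx mul_mx_scalar.
Qed.

End Operators.

Section Harmonic.
Variables (R : realType) (d n : nat).
Variables (tau : 'I_n.+1 -> R) (T : R) (D : 'I_n.+1 -> R -> 'M[R[i]]_d).

(** On square summable sequences the series over the blocks may be split into
    one series for each delay. *)
Lemma harmonic_operatorE c p (x : zseq R d) C :
  (forall j, summable_by (fourier_coef T (D j)) c) -> L2by x C ->
  harmonic_operator tau T D p x =
  fun k => x k - \sum_j delop tau T (fun j => fourier_coef T (D j)) p j x k.
Proof.
move=> hF hx; apply/funext => k; congr (_ - _).
rewrite /block_apply /harmonic_block.
have hj j := conv_summable k (hF j) (twist_L2by T p (tau j) hx).
pose f j l := fourier_coef T (D j) (l - k) *m twist T p (tau j) x l.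
have -> : (fun l => (\sum_j cexp (- (p - Complex 0 (l%:~R * (2 * pi / T))) *
     Complex (tau j) 0) *: fourier_coef T (D j) (l - k)) *m x l) =
   (fun l => \sum_j f j l).
  apply/funext => l; rewrite mulmx_suml; apply: eq_bigr => j _.
  by rewrite -scalemxAl scalemxAr.
rewrite /delop /conv -/(f _); elim: (index_enum _) => [|i s IH].
  rewrite big_nil (@zsum_supp _ _ [::]) ?big_nil // => l _.
  by rewrite big_nil.
have [B hB] : exists B, summable_by (fun l => \sum_(j <- s) f j l) B.
  elim: s {IH} => [|i' s [B hB]].
    by exists 0 => s _; rewrite big1 // => l _; rewrite big_nil enorm0.
  exists (c * (expR (- (complex.Re p * tau i')) * C) + B) => s' us'.
  apply: le_trans (lerD (hj i' s' us') (hB s' us')).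
  by rewrite -big_split; apply: ler_sum => l _; rewrite big_cons enormD.
rewrite big_cons -IH -(zsumD (hj i) hB); congr zsum.
by apply/funext => l; rewrite big_cons.
Qed.

End Harmonic.

(** * From lower bounds on the harmonic operator to the time domain *)

Section Transfer.
Variables (R : realType) (d n : nat).
Variables (tau : 'I_n.+1 -> R) (T : R) (D : 'I_n.+1 -> R -> 'M[R[i]]_d).
Variable F : 'I_n.+1 -> int -> 'M[R[i]]_d.
Variable c : R.
Hypothesis F_summable : forall j, summable_by (F j) c.
Hypothesis F_inversion : forall j t,
  mxcvg (fun N => \sum_(m <- win N) cis (m%:~R * (2 * pi / T) * t) *: F j m) (D j t).

Notation om := (2 * pi / T).
Notation chi := (chi T).
Notation delop := (delop tau T F).

(** The harmonic operator for coefficients [F]; see [harmonic_operatorE]. *)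
Definition harm p (x : zseq R d) : zseq R d := fun k => x k - \sum_j delop p j x k.

Lemma L2by_few (x : zseq R d) (s : seq int) H : uniq s -> 0 <= H ->
  (forall l, l \notin s -> x l = 0) -> (forall l, enorm (x l) <= H) ->
  L2by x (H * Num.sqrt (size s)%:R).
Proof.
move=> us H0 x0 xH s' us'; rewrite -[leRHS]ger0_norm ?mulr_ge0 ?sqrtr_ge0 //.
rewrite -sqrtr_sqr ler_wsqrtr // exprMn sqr_sqrtr //.
rewrite (bigID (mem s)) /= [X in _ + X]big1_seq ?addr0; last first.
  by move=> l /andP[/x0 -> _]; rewrite enorm0 expr0n.
rewrite -big_filter; set s1 := [seq _ <- _ | _].
apply: (@le_trans _ _ (\sum_(l <- s1) H ^+ 2)).
  by apply: ler_sum => l _; rewrite lerXn2r ?nnegrE ?enorm_ge0.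
rewrite big_const_seq count_predT iter_addr_0 -[_ *+ size s1]mulr_natr ler_wpM2l ?sqr_ge0 //.
rewrite ler_nat uniq_leq_size // ?filter_uniq // => l.
by rewrite mem_filter => /andP[].
Qed.

Lemma size_win N : size (win N) = (2 * N).+1.
Proof. by rewrite win.unlock size_map size_iota. Qed.

Section Test.
Variables (S : seq R) (u : R -> 'cV[R[i]]_d).
Hypothesis S_uniq : uniq S.
Hypothesis u_out : forall r, r \notin S -> u r = 0.
Hypothesis u_delay : forall r j, r \notin S -> u (r - tau j) = 0.

Let g r := u r - \sum_j D j r *m u (r - tau j).

Definition mask (N : nat) (l : int) := (0 <= l) && (l < N%:Z).

(** The discrete analogue of a function concentrated on the points of [S]: a
    multiplication operator sees on it only the values at these points. *)
Definition test (v : R -> 'cV[R[i]]_d) p N : zseq R d :=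
  fun l => if mask N l then \sum_(r <- S) chi p l r *: v r else 0.

Lemma sum_shift p l j :
  \sum_(r <- S) chi p l (r + tau j) *: u r = \sum_(r <- S) chi p l r *: u (r - tau j).
Proof.
pose S1 := [seq r + tau j | r <- S]; pose f r := chi p l r *: u (r - tau j).
have -> : \sum_(r <- S) chi p l (r + tau j) *: u r = \sum_(r <- S1) f r.
  by rewrite big_map; apply: eq_bigr => r _; rewrite /f addrK.
rewrite -(@big_supp _ _ S1 (undup (S1 ++ S)) f) ?undup_uniq //.
- apply: big_supp; rewrite ?undup_uniq //.
    by move=> r rS; rewrite mem_undup mem_cat rS orbT.
  by move=> r _ rS; rewrite /f u_delay // scaler0.
- by rewrite map_inj_uniq // => a b /addIr.
- by move=> r rS; rewrite mem_undup mem_cat rS.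
move=> r _ rS; rewrite /f u_out ?scaler0 //; apply: contra rS => rS.
by apply/mapP; exists (r - tau j); rewrite // subrK.
Qed.

Lemma enorm_sum_chi p l (v : R -> 'cV[R[i]]_d) :
  enorm (\sum_(r <- S) chi p l r *: v r) <=
  \sum_(r <- S) expR (- (complex.Re p * r)) * enorm (v r).
Proof.
rewrite (le_trans (enorm_sum _ _ _)) //; apply: ler_sum => r _.
by rewrite enorm_chiZ.
Qed.

Let mass b (v : R -> 'cV[R[i]]_d) := \sum_(r <- S) expR (- (b * r)) * enorm (v r).

Lemma mass_ge0 b v : 0 <= mass b v.
Proof. by apply: sumr_ge0 => r _; rewrite mulr_ge0 ?expR_ge0 ?enorm_ge0. Qed.

Lemma test_L2by v p N :
  L2by (test v p N) (mass (complex.Re p) v * Num.sqrt N%:R).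
Proof.
rewrite -[N in N%:R](size_iota 0) -(size_map Posz (iota 0 N)).
apply: L2by_few; rewrite ?mass_ge0 //.
- by rewrite map_inj_uniq ?iota_uniq // => a b [].
- move=> l lN; rewrite /test /mask; case: ifP => // /andP[l0 lN'].
  case/negP: lN; apply/mapP; exists (absz l); last lia.
  by rewrite mem_iota; lia.
- move=> l; rewrite /test; case: ifP => _; first exact: enorm_sum_chi.
  by rewrite enorm0 mass_ge0.
Qed.

Lemma D_truncE k p l j :
  \sum_(r <- S) chi p l r *: (D_trunc T F k j r *m u (r - tau j)) =
  \sum_(m <- win k) F j m *m \sum_(r <- S) chi p (l + m) r *: u (r - tau j).
Proof.
under [RHS]eq_bigr do rewrite mulmx_sumr.
rewrite [RHS]exchange_big /=; apply: eq_bigr => r _.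
rewrite /D_trunc mulmx_suml scaler_sumr; apply: eq_bigr => m _.
by rewrite chi_addl -scalemxAl -scalemxAr scalerA.
Qed.

(** Cutting at [0] and [N] only affects boundedly many entries near the ends. *)
Lemma delop_trunc_test k p j N :
  L2by (fun l => delop_trunc tau T F k p j (test u p N) l -
     (if mask N l then
      \sum_(r <- S) chi p l r *: (D_trunc T F k j r *m u (r - tau j)) else 0))
   (\sum_(m <- win k) enorm (F j m) * (mass (complex.Re p) (fun r => u (r - tau j)) *
       Num.sqrt (2 * (2 * absz m).+1)%:R)).
Proof.
pose h l := \sum_(r <- S) chi p l r *: u (r - tau j).
pose dl m l := (if mask N (l + m) then h (l + m) else 0) -
               (if mask N l then h (l + m) else 0).
have -> : (fun l => delop_trunc tau T F k p j (test u p N) l -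
     (if mask N l then
      \sum_(r <- S) chi p l r *: (D_trunc T F k j r *m u (r - tau j)) else 0)) =
   (fun l => \sum_(m <- win k) F j m *m dl m l).
  apply/funext => l; rewrite D_truncE.
  rewrite (_ : (if mask N l then _ else _) =
    \sum_(m <- win k) F j m *m (if mask N l then h (l + m) else 0)); last first.
    by case: ifP => // _; rewrite big1 // => m _; rewrite mulmx0.
  rewrite -sumrB; apply: eq_bigr => m _; rewrite -mulmxBr; congr (_ *m (_ - _)).
  rewrite /twist /test; case: ifP => _; last by rewrite scaler0.
  rewrite /h -sum_shift scaler_sumr; apply: eq_bigr => r _.
  by rewrite scalerA -chiD [tau j + r]addrC.
apply: L2by_sum => m; apply: L2byM.
pose s := undup (win (absz m) ++ [seq l + N%:Z | l <- win (absz m)]).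
set H := mass _ _.
apply: (@L2by_le _ _ _ (H * Num.sqrt (size s)%:R)); last first.
  rewrite ler_wpM2l ?mass_ge0 // ler_wsqrtr // ler_nat (leq_trans (size_undup _)) //.
  by rewrite size_cat size_map size_win; lia.
apply: L2by_few; rewrite ?undup_uniq ?mass_ge0 //.
- move=> l; rewrite mem_undup mem_cat negb_or => /andP[]; rewrite mem_win => h1 h2.
  rewrite /dl; suff -> : mask N (l + m) = mask N l by rewrite subrr.
  have {}h2 : ~~ (absz (l - N%:Z) <= absz m)%N.
    apply: contra h2 => h2; apply/mapP; exists (l - N%:Z); last by rewrite subrK.
    by rewrite mem_win.
  by rewrite /mask; apply/idP/idP; lia.
- move=> l; have hh : enorm (h (l + m)) <= H by exact: enorm_sum_chi.
  have H0 : 0 <= H by exact: mass_ge0.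
  by rewrite /dl; do 2![case: ifP => _]; rewrite ?subrr ?subr0 ?sub0r ?enormN ?enorm0.
Qed.

(** The error has a part of bounded norm, from the ends of [test], and a part
    comparable to the norm of [test], which grows like the square root of [N];
    the latter is as small as the truncation of the Fourier series allows. *)
Lemma harm_test b e : 0 < e -> exists2 K, 0 <= K & forall p N, complex.Re p = b ->
  L2by (fun l => harm p (test u p N) l - test g p N l)
    (K + e * ((\sum_j (expR (- (b * tau j)) * mass b u + mass b (fun r => u (r - tau j))))
              * Num.sqrt N%:R)).
Proof.
move=> e0; have [k /(_ k _ (leqnn k)) hk] := F_tail F_summable e0.
pose K j := \sum_(m <- win k) enorm (F j m) * (mass b (fun r => u (r - tau j)) *
       Num.sqrt (2 * (2 * absz m).+1)%:R).
exists (\sum_j K j).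
  apply: sumr_ge0 => j _; apply: sumr_ge0 => m _.
  by rewrite mulr_ge0 ?enorm_ge0 // mulr_ge0 ?mass_ge0 ?sqrtr_ge0.
move=> p N pb.
pose q1 j l := delop p j (test u p N) l - delop_trunc tau T F k p j (test u p N) l.
pose q2 j l := delop_trunc tau T F k p j (test u p N) l -
     (if mask N l then
      \sum_(r <- S) chi p l r *: (D_trunc T F k j r *m u (r - tau j)) else 0).
pose q3 j := test (fun r => (D_trunc T F k j r - D j r) *m u (r - tau j)) p N.
have -> : (fun l => harm p (test u p N) l - test g p N l) =
    (fun l => - \sum_j (q1 j l + (q2 j l + q3 j l))).
  apply/funext => l; rewrite /harm.
  have -> : test g p N l = test u p N l -
      \sum_j (if mask N l then \sum_(r <- S) chi p l r *: (D j r *m u (r - tau j)) else 0).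
    rewrite /test; case: ifP => _; last by rewrite big1 ?subr0.
    rewrite exchange_big /= -sumrB; apply: eq_bigr => r _.
    by rewrite /g scalerBr scaler_sumr.
  rewrite opprB [_ + (_ - _)]addrC -addrA addrA subrKA -sumrB -sumrN.
  apply: eq_bigr => j _; rewrite -opprB; congr (- _).
  rewrite /q1 /q2 addrA subrKA -addrA; congr (_ + _).
  rewrite /q3 /test; case: ifP => _; last by rewrite oppr0 addr0.
  under [X in _ = _ + X]eq_bigr do rewrite mulmxBl scalerBr.
  by rewrite sumrB addrA addNr add0r.
apply: L2byN; rewrite mulr_suml mulr_sumr -big_split /=.
apply: L2by_sum => j.
have h1 : L2by (q1 j) (e * (expR (- (b * tau j)) * (mass b u * Num.sqrt N%:R))).
  by have := delop_approx tau T F_summable p (hk j) (test_L2by u p N); rewrite pb.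
have h2 : L2by (q2 j) (K j) by have := delop_trunc_test k p j N; rewrite pb.
have h3 : L2by (q3 j) (e * mass b (fun r => u (r - tau j)) * Num.sqrt N%:R).
  apply: L2by_le (test_L2by _ _ _) _; rewrite pb ler_wpM2r ?sqrtr_ge0 //.
  rewrite mulr_sumr; apply: ler_sum => r _; rewrite mulrCA ler_wpM2l ?expR_ge0 //.
  rewrite (le_trans (enormM _ _)) // ler_wpM2r ?enorm_ge0 //.
  exact: (D_trunc_near F_inversion).
apply: L2by_le (L2byD h1 (L2byD h2 h3)) _.
by rewrite le_eqVlt; apply/orP; left; apply/eqP; ring.
Qed.

End Test.
End Transfer.

Lemma ler_lim_nat (R : realType) (a b C : R) :
  (forall N : nat, N%:R * a <= N%:R * b + C) -> a <= b.
Proof.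
move=> h; rewrite leNgt; apply/negP => ba; have ab0 : 0 < a - b by rewrite subr_gt0.
have := h (Num.truncn (C / (a - b))).+1.
have : C / (a - b) < (Num.truncn (C / (a - b))).+1%:R by exact: truncnS_gt.
set N := _.+1%:R; rewrite ltr_pdivrMr // mulrBr; lra.
Qed.

Lemma sum_blocks (R : realType) (f : nat -> R) (N Q : nat) :
  \sum_(q < Q) \sum_(l < N) f (l * Q + q)%N = \sum_(k < N * Q) f k.
Proof.
elim: N => [|N IH]; first by rewrite mul0n big_ord0 big1 // => q _; rewrite big_ord0.
under eq_bigr do rewrite big_ord_recr /=.
rewrite big_split /= IH -!(big_mkord xpredT f) mulSn addnC.
rewrite [RHS](big_cat_nat (n := (N * Q)%N)) ?leq_addr //=; congr (_ + _).
rewrite -{2}[(N * Q)%N]add0n big_addn addKn big_mkord.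
by apply: eq_bigr => q _; rewrite addnC.
Qed.

Section Transfer.
Variables (R : realType) (d n : nat).
Variables (tau : 'I_n.+1 -> R) (T : R) (D : 'I_n.+1 -> R -> 'M[R[i]]_d).
Hypothesis T_gt0 : 0 < T.
Variable F : 'I_n.+1 -> int -> 'M[R[i]]_d.
Variable c : R.
Hypothesis F_summable : forall j, summable_by (F j) c.
Hypothesis F_inversion : forall j t,
  mxcvg (fun N => \sum_(m <- win N) cis (m%:~R * (2 * pi / T) * t) *: F j m) (D j t).
Variables beta M : R.
Hypothesis M_ge0 : 0 <= M.
Hypothesis lower_bound : forall p (x : zseq R d) C C', beta <= complex.Re p ->
  L2by x C' -> L2by (harm tau T F p x) C -> L2by x (M * C).

Section Test.
Variables (S : seq R) (u : R -> 'cV[R[i]]_d).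
Hypothesis S_uniq : uniq S.
Hypothesis u_out : forall r, r \notin S -> u r = 0.
Hypothesis u_delay : forall r j, r \notin S -> u (r - tau j) = 0.

Let g r := u r - \sum_j D j r *m u (r - tau j).
Notation om := (2 * pi / T).

(** The phases [om * r / Q] of the points of [S] lie in less than one turn, so
    that they are pairwise distinct characters. *)
Let spread : exists2 Q : nat, (0 < Q)%N & {in S &, forall r r', `|r - r'| < Q%:R * T}.
Proof.
pose B := \sum_(r <- S) `|r|; exists (Num.truncn ((B + B) / T)).+1 => // r r' rS r'S.
rewrite -ltr_pdivrMr //; apply: le_lt_trans (truncnS_gt _).
rewrite ler_wpM2r ?invr_ge0 ?(ltW T_gt0) // (le_trans (ler_normB _ _)) //.
have hB x : x \in S -> `|x| <= B.
  by move=> xS; rewrite /B (big_rem x) //= lerDl sumr_ge0.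
by rewrite lerD ?hB.
Qed.

Lemma test_l2sum (v : R -> 'cV[R[i]]_d) p N :
  l2sum [seq l%:Z | l <- iota 0 N] (fun l => enorm (test T S v p N l)) =
  Num.sqrt (\sum_(l < N) enorm (\sum_(r <- S) chi T p l%:Z r *: v r) ^+ 2).
Proof.
rewrite /l2sum big_map.
rewrite -(big_mkord xpredT (fun l => enorm (\sum_(r <- S) chi T p l%:Z r *: v r) ^+ 2)).
rewrite /index_iota subn0; congr Num.sqrt.
rewrite big_seq [RHS]big_seq; apply: eq_bigr => l; rewrite mem_iota add0n => /andP[_ lN].
by rewrite /test /mask lez_nat ltz_nat leq0n lN.
Qed.

Lemma test_L2by_eq (v : R -> 'cV[R[i]]_d) p N : L2by (test T S v p N)
  (Num.sqrt (\sum_(l < N) enorm (\sum_(r <- S) chi T p l%:Z r *: v r) ^+ 2)).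
Proof.
rewrite -test_l2sum; apply: L2by_supp (lexx _).
  by rewrite map_inj_uniq ?iota_uniq // => a b [].
move=> l lN; rewrite /test /mask; case: ifP => [/andP[l0 lN']|//].
case/negP: lN; apply/mapP; exists (absz l); last lia.
by rewrite mem_iota; lia.
Qed.

(** Applied to [test] at the frequencies p = b - i om q / Q, the lower bound of
    [harm] compares sums of squares over l and q, whose means are by [bohr_mean]
    the weighted square sums below. *)
Lemma lower_bound_discrete b : beta <= b ->
  \sum_(r <- S) expR (- (b * r)) ^+ 2 * enorm (u r) ^+ 2 <=
  M ^+ 2 * \sum_(r <- S) expR (- (b * r)) ^+ 2 * enorm (g r) ^+ 2.
Proof.
move=> bb; have [Q Q0 hQ] := spread; have Qr0 : 0 < Q%:R :> R by rewrite ltr0n.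
pose th r := om * r / Q%:R.
have hth : {in S &, forall r r', r != r' -> cos (th r - th r') != 1}.
  have om0 : 0 < om by rewrite divr_gt0 // mulr_gt0 // pi_gt0.
  move=> r r' rS r'S rr'; rewrite /th -mulrBl -mulrBr.
  have e1 : `|om * (r - r') / Q%:R| = om * `|r - r'| / Q%:R.
    by rewrite normrM (normrM om) (ger0_norm (ltW om0)) normfV (ger0_norm (ltW Qr0)).
  apply: cos_neq1; rewrite e1.
    by rewrite divr_gt0 // mulr_gt0 // normr_gt0 subr_eq0.
  rewrite ltr_pdivrMr // mulrAC ltr_pdivrMr // -mulrA ltr_pM2l ?mulr_gt0 ?pi_gt0 //.
  exact: hQ.
pose w v r := Complex (expR (- (b * r))) 0 *: v r : 'cV[R[i]]_d.
have ew v r : enorm (w v r) ^+ 2 = expR (- (b * r)) ^+ 2 * enorm (v r) ^+ 2.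
  by rewrite /w enormZ /cabs2 /= expr0n addr0 sqrtr_sqr ger0_norm ?expR_ge0 // exprMn.
(* The frequencies [l + q / Q] with [l < N], [q < Q] are the [k / Q] with
   [k < N * Q]: summing the test sequences for all [p q] gives one Bohr mean. *)
pose p (q : nat) := Complex b (- (om * q%:R / Q%:R)).
pose ev v k := enorm (\sum_(r <- S) cis (k%:R * th r) *: w v r) ^+ 2.
have evE v q l : enorm (\sum_(r <- S) chi T (p q) l%:Z r *: v r) ^+ 2 = ev v (l * Q + q)%N.
  congr (enorm _ ^+ 2); apply: eq_bigr => r _; rewrite chiE /w scalerA mulrC.
  congr (cis _ * _ *: _); rewrite /th /p /= opprK natrD natrM.
  by rewrite -[l%:~R]/(l%:R); field; rewrite !gt_eqF.
have [B1 hB1] := bohr_mean (w u) S_uniq hth.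
have [B2 hB2] := bohr_mean (w g) S_uniq hth.
under eq_bigr do rewrite -ew; under [X in _ <= _ * X]eq_bigr do rewrite -ew.
set FF := \sum_(r <- S) enorm (w u r) ^+ 2; set GG := \sum_(r <- S) enorm (w g r) ^+ 2.
set K' := \sum_j (expR (- (b * tau j)) * \sum_(r <- S) expR (- (b * r)) * enorm (u r) +
  \sum_(r <- S) expR (- (b * r)) * enorm (u (r - tau j))).
have {}hB1 k : `|\sum_(l < k) ev u l - k%:R * FF| <= B1 := hB1 k.
have {}hB2 k : `|\sum_(l < k) ev g l - k%:R * GG| <= B2 := hB2 k.
have ev_ge0 v k : 0 <= ev v k by exact: sqr_ge0.
have GG0 : 0 <= GG by apply: sumr_ge0 => r _; exact: sqr_ge0.
clearbody ev FF GG.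
(* [e] is both the accuracy in [harm_test] and the weight with which the square
   of a sum is split. *)
have main e : 0 < e -> FF <= M ^+ 2 * ((1 + e) * GG + (1 + e^-1) * (2 * e ^+ 2 * K' ^+ 2)).
  move=> e0; have e10 : 0 < e^-1 by rewrite invr_gt0.
  have [K K0 hK] := harm_test F_summable F_inversion S_uniq u_out u_delay b e0.
  have step N q : \sum_(l < N) ev u (l * Q + q)%N <= M ^+ 2 *
      ((1 + e) * (\sum_(l < N) ev g (l * Q + q)%N) +
       (1 + e^-1) * (2 * K ^+ 2 + N%:R * (2 * e ^+ 2 * K' ^+ 2))).
    have hu := test_L2by T S_uniq u (p q) N.
    have hg : L2by (test T S g (p q) N) (Num.sqrt (\sum_(l < N) ev g (l * Q + q)%N)).
      by under eq_bigr do rewrite -evE; exact: test_L2by_eq.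
    have := L2byD (hK (p q) N erefl) hg.
    rewrite (_ : (fun k => _ + _) = harm tau T F (p q) (test T S u (p q) N)); last first.
      by apply/funext => k; rewrite subrK.
    move=> /(@lower_bound (p q) _ _ _ bb hu) /(_ [seq l%:Z | l <- iota 0 N]).
    rewrite map_inj_uniq ?iota_uniq => [/(_ isT)|a b' []//].
    rewrite test_l2sum; under eq_bigr do rewrite evE.
    set X := \sum_(l < N) ev u _; set G := \sum_(l < N) ev g _ => hX.
    have X0 : 0 <= X by exact: sumr_ge0.
    have G0 : 0 <= G by exact: sumr_ge0.
    have {hX} : Num.sqrt X ^+ 2 <= (M * (K + e * (K' * Num.sqrt N%:R) + Num.sqrt G)) ^+ 2.
      by rewrite lerXn2r // nnegrE ?sqrtr_ge0 // (le_trans _ hX) ?sqrtr_ge0.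
    rewrite sqr_sqrtr // [(M * _) ^+ 2]exprMn => h; apply: le_trans h _.
    rewrite ler_wpM2l ?sqr_ge0 //.
    rewrite -[in leRHS](sqr_sqrtr G0) -[N%:R in leRHS](sqr_sqrtr (ler0n _ N)).
    move: (Num.sqrt G) (Num.sqrt N%:R) => y z.
    set a := e * (K' * z); have -> : z ^+ 2 * (2 * e ^+ 2 * K' ^+ 2) = 2 * a ^+ 2.
      by rewrite /a; ring.
    have h1 : 2 * (K + a) * y <= e * y ^+ 2 + e^-1 * (K + a) ^+ 2.
      have -> : 2 * (K + a) * y = e * y ^+ 2 + e^-1 * (K + a) ^+ 2 -
                                   e * (y - e^-1 * (K + a)) ^+ 2.
        by field; rewrite gt_eqF.
      by rewrite gerBl mulr_ge0 ?sqr_ge0 // ltW.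
    have h2 : (K + a) ^+ 2 <= 2 * K ^+ 2 + 2 * a ^+ 2.
      have := sqr_ge0 (K - a); rewrite sqrrB sqrrD; lra.
    have h3 : e^-1 * (K + a) ^+ 2 <= e^-1 * (2 * K ^+ 2 + 2 * a ^+ 2).
      by rewrite ler_wpM2l // ltW.
    rewrite [leLHS]sqrrD; move: h1 h2 h3; lra.
  apply: (@ler_lim_nat _ _ _ ((B1 + M ^+ 2 * ((1 + e) * B2 +
     (1 + e^-1) * (Q%:R * (2 * K ^+ 2)))) / Q%:R)) => N.
  have := @ler_sum R _ (index_enum 'I_Q) xpredT _ _ (fun q _ => step N q).
  rewrite sum_blocks -mulr_sumr big_split /= -!mulr_sumr sum_blocks sumr_const card_ord.
  have := hB1 (N * Q)%N; have := hB2 (N * Q)%N.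
  rewrite !ler_norml => /andP[_ b2] /andP[b1 _].
  set Z := _ *+ Q => hs.
  have hs2 : \sum_(k < N * Q) ev u k <=
      M ^+ 2 * ((1 + e) * ((N * Q)%:R * GG + B2) + (1 + e^-1) * Z).
    apply: le_trans hs _; rewrite ler_wpM2l ?sqr_ge0 // lerD2r ler_wpM2l //.
      by rewrite addr_ge0 // ltW.
    by move: b2; rewrite lerBlDr addrC.
  rewrite -(ler_pM2r Qr0) mulrDl divfK ?gt_eqF //.
  have {}hs2 : (N * Q)%:R * FF - B1 <=
      M ^+ 2 * ((1 + e) * ((N * Q)%:R * GG + B2) + (1 + e^-1) * Z).
    by apply: le_trans hs2; move: b1; rewrite lerBrDl.
  move: hs2; rewrite /Z -mulr_natr natrM; set M2 := M ^+ 2.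
  by rewrite lerBlDr => h; apply: le_trans (le_trans _ h) _;
    rewrite le_eqVlt; apply/orP; left; apply/eqP; ring.
pose Y := M ^+ 2 * (GG + 4 * K' ^+ 2).
have Y0 : 0 <= Y by rewrite mulr_ge0 ?sqr_ge0 // addr_ge0 // mulr_ge0 // sqr_ge0.
apply/ler_addgt0Pl => e0 e0_gt0.
have Y1 : 0 < Y + 1 by rewrite ltr_wpDl.
pose e := Num.min 1 (e0 / (Y + 1)).
have e_gt0 : 0 < e by rewrite lt_min ltr01 divr_gt0.
apply: le_trans (main _ e_gt0) _.
have e1 : e <= 1 by rewrite ge_min lexx.
have eY : e * Y <= e0.
  apply: (@le_trans _ _ (e0 / (Y + 1) * (Y + 1))); last by rewrite divfK // gt_eqF.
  by apply: ler_pM => //; rewrite ?(ltW e_gt0) ?lerDl // ge_min lexx orbT.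
have -> : (1 + e) * GG + (1 + e^-1) * (2 * e ^+ 2 * K' ^+ 2) =
   GG + (e * GG + 2 * (e ^+ 2 + e) * K' ^+ 2) by field; rewrite gt_eqF.
rewrite mulrDr addrC lerD2r; apply: le_trans eY.
rewrite (_ : e * Y = M ^+ 2 * (e * (GG + 4 * K' ^+ 2))); last by rewrite /Y mulrCA.
rewrite ler_wpM2l ?sqr_ge0 // [e * (GG + _)]mulrDr lerD2l [e * (4 * _)]mulrA ler_wpM2r ?sqr_ge0 //.
by rewrite expr2; nra.
Qed.

End Test.
End Transfer.

(** * Decay of the fundamental solution from the lower bound *)

Section Growth.
Variable R : realType.

Lemma expr_unbounded (x B : R) : 1 < x -> exists k, B < x ^+ k.
Proof.
move=> x1; have h k : 1 + k%:R * (x - 1) <= x ^+ k.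
  elim: k => [|k IH]; first by rewrite mul0r addr0 expr0.
  rewrite exprS -natr1; have k0 : 0 <= k%:R :> R by [].
  have : x * (1 + k%:R * (x - 1)) <= x * x ^+ k by rewrite ler_wpM2l // ltW // (lt_trans _ x1).
  apply: le_trans; rewrite -subr_ge0.
  by have := mulr_ge0 k0 (sqr_ge0 (x - 1)); congr (0 <= _); ring.
have x10 : 0 < x - 1 by rewrite subr_gt0.
exists (Num.truncn (B / (x - 1))).+1; apply: lt_le_trans (h _).
have : B / (x - 1) < (Num.truncn (B / (x - 1))).+1%:R by exact: truncnS_gt.
by rewrite ltr_pdivrMr //; lra.
Qed.

(** Under the recurrence a value above [a] forces growth at the rate
    [k / (k - 1)], which a slower exponential bound excludes. *)
Lemma dichotomy (E : nat -> R) (a k r C : R) : 1 < k -> 0 < r -> r * (k - 1) < k ->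
  (forall m, E m.+1 <= a + k * (E m.+1 - E m)) -> (forall m, E m <= C * r ^+ m) ->
  0 <= a -> forall m, E m <= a.
Proof.
move=> k1 r0 rk hE hC a0 m; rewrite leNgt; apply/negP => Ema.
have k10 : 0 < k - 1 by rewrite subr_gt0.
have k0 : 0 < k by rewrite (lt_trans _ k1).
pose q := k / (r * (k - 1)).
have q1 : 1 < q by rewrite ltr_pdivlMr ?mulr_gt0 // mul1r.
have grow j : (E m - a) * (k / (k - 1)) ^+ j <= E (m + j)%N - a.
  elim: j => [|j IH]; first by rewrite addn0 mulr1.
  rewrite exprSr mulrA mulrA addnS ler_pdivrMr //.
  have := hE (m + j)%N; have : (E m - a) * (k / (k - 1)) ^+ j * k <= (E (m + j)%N - a) * k.
    by rewrite ler_wpM2r // ltW.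
  move: (_ * _ ^+ j * k) (E (m + j)%N) (E (m + j).+1) => G e e' h1 h2.
  by apply: le_trans h1 _; rewrite -subr_ge0; move: h2; rewrite -subr_ge0; congr (0 <= _); ring.
have [j hj] := expr_unbounded (C * r ^+ m / (E m - a)) q1.
have Ea0 : 0 < E m - a by rewrite subr_gt0.
have := grow j; have := hC (m + j)%N; rewrite exprD => h2 h1.
move: hj; rewrite ltr_pdivrMr //; apply/negP; rewrite -leNgt.
have rj : 0 < r ^+ j by rewrite exprn_gt0.
rewrite -(ler_pM2r rj).
have -> : q ^+ j * (E m - a) * r ^+ j = (E m - a) * (k / (k - 1)) ^+ j.
  rewrite mulrAC -exprMn mulrC; congr (_ * _ ^+ j); rewrite /q.
  by field; rewrite !gt_eqF.
by apply: le_trans h1 _; rewrite -mulrA; move: h2 a0; lra.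
Qed.

End Growth.

(** Exponential decay of the fundamental solution, to which both sides of the
    equivalence reduce. *)
Definition fund_decay (R : realType) (d n : nat) (tau : 'I_n.+1 -> R)
    (D : 'I_n.+1 -> R -> 'M[R[i]]_d) :=
  exists g K : R, [/\ 0 < g, 0 < K &
    forall x t, enorm (fund tau D x t) <= K * expR (- (g * x))].

Section Decay.
Variables (R : realType) (d n : nat).
Variables (tau : 'I_n.+1 -> R) (D : 'I_n.+1 -> R -> 'M[R[i]]_d).
Hypothesis tau0_gt0 : 0 < tau ord0.
Hypothesis tau_min : forall j, tau ord0 <= tau j.
Hypothesis tau_max : forall j, tau j <= tau ord_max.
Variable c : R.
Hypothesis D_bounded : forall j t, enorm (D j t) <= c.
Variables beta M : R.
Hypothesis beta_lt0 : beta < 0.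
Hypothesis M_ge0 : 0 <= M.
Hypothesis lower_bound_discrete : forall (S : seq R) (u : R -> 'cV[R[i]]_d),
  uniq S -> (forall r, r \notin S -> u r = 0) ->
  (forall r j, r \notin S -> u (r - tau j) = 0) -> forall b, beta <= b ->
  \sum_(r <- S) expR (- (b * r)) ^+ 2 * enorm (u r) ^+ 2 <=
  M ^+ 2 * \sum_(r <- S) expR (- (b * r)) ^+ 2 *
             enorm (u r - \sum_j D j r *m u (r - tau j)) ^+ 2.

Let c_ge0 : 0 <= c.
Proof. exact: le_trans (enorm_ge0 _) (D_bounded ord0 0). Qed.

Let tau_pos j : 0 < tau j := tau_gt0 tau0_gt0 tau_min j.
Notation tN := (tau ord_max).
Notation X := (fund tau D).

(** An a priori bound, the starting point of the descent in [energy_bound]. *)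
Lemma fund_exp_bound : exists2 b1, 0 < b1 & forall x t,
  enorm (X x t) <= enorm (1%:M : 'M[R[i]]_d) * expR (b1 * x).
Proof.
pose b1 := (n.+1%:R * c + 1) / tau ord0.
have b10 : 0 < b1 by rewrite divr_gt0 // ltr_wpDl // mulr_ge0.
exists b1 => // x t; suff h k y s : y < k%:R * tau ord0 ->
    enorm (X y s) <= enorm (1%:M : 'M[R[i]]_d) * expR (b1 * y).
  by apply: (h (Num.truncn (x / tau ord0)).+1); rewrite -ltr_pdivrMr // truncnS_gt.
elim: k y s => [|k IH] y s hy.
  by rewrite fund_lt0 ?enorm0 ?mulr_ge0 ?enorm_ge0 ?expR_ge0 //; move: hy; rewrite mul0r.
have [y0|y0|->] := ltgtP y 0; last by rewrite fund0 // mulr0 expR0 mulr1.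
  by rewrite fund_lt0 ?enorm0 ?mulr_ge0 ?enorm_ge0 ?expR_ge0.
rewrite fund_gt0 // (le_trans (enorm_sum _ _ _)) //.
apply: (@le_trans _ _ (\sum_(j < n.+1) c * (enorm (1%:M : 'M[R[i]]_d) *
    (expR (b1 * y) * expR (- (b1 * tau ord0)))))).
  apply: ler_sum => j _; rewrite (le_trans (enormM _ _)) //.
  apply: ler_pM; rewrite ?enorm_ge0 //.
  apply: (@le_trans _ _ (enorm (1%:M : 'M[R[i]]_d) * expR (b1 * (y - tau j)))).
    apply: IH; move: hy (tau_min j); rewrite -natr1; lra.
  rewrite ler_wpM2l ?enorm_ge0 // -expRD ler_expR mulrBr lerD2l lerN2.
  by rewrite ler_wpM2l // ltW.
rewrite sumr_const card_ord -mulr_natl.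
set e1 := enorm _; set ey := expR (b1 * y).
have -> : n.+1%:R * (c * (e1 * (ey * expR (- (b1 * tau ord0))))) =
  e1 * (ey * (n.+1%:R * c * expR (- (b1 * tau ord0)))) by ring.
rewrite ler_wpM2l ?enorm_ge0 // ger_pMr ?expR_gt0 //.
rewrite expRN ler_pdivrMr ?expR_gt0 // mul1r.
by rewrite /b1 divfK ?gt_eqF // (le_trans _ (expR_ge1Dx _)) //; lra.
Qed.

Lemma mem_delaysle_add L x j : x \in delaysle tau L -> x + tau j \in delaysle tau (L + tau j).
Proof.
rewrite mem_undup => /mapP[w]; rewrite mem_wordsle // => h ->.
rewrite mem_undup; apply/mapP; exists (j :: w); last by rewrite delay_cons addrC.
by rewrite mem_wordsle // delay_cons addrC lerD2r.
Qed.

Lemma mem_delaysleP L x : x \in delaysle tau L ->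
  forall L', x <= L' -> x \in delaysle tau L'.
Proof.
rewrite mem_undup => /mapP[w _ ->] L' h; rewrite mem_undup map_f //.
by rewrite mem_wordsle.
Qed.

Section Energy.
Variables (t0 : R) (v : 'cV[R[i]]_d).
Hypothesis v_le1 : enorm v <= 1.

Let a x := enorm (X x (t0 + x) *m v) ^+ 2.

Let a_ge0 x : 0 <= a x. Proof. exact: sqr_ge0. Qed.

(** A weighted l^2 norm, on the discrete real line, of the solution that starts
    with a delta [v] at [t0]; it is supported on the total delays after [t0]. *)
Definition energy b (L : R) := \sum_(x <- delaysle tau L) expR (- (b * x)) ^+ 2 * a x.

Lemma energy_le b L L' : L' <= L ->
  energy b L' = \sum_(x <- delaysle tau L | x <= L') expR (- (b * x)) ^+ 2 * a x.
Proof.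
move=> LL; rewrite -[RHS]big_filter; apply/perm_big/uniq_perm.
- exact: undup_uniq.
- by rewrite filter_uniq // undup_uniq.
move=> x; rewrite (mem_filter (fun x => x <= L')); apply/idP/andP => [h|[h1 h2]].
  have /andP[_ h1] := mem_delaysle tau0_gt0 tau_min h; split => //.
  by apply: mem_delaysleP h _ _; rewrite (le_trans h1).
exact: mem_delaysleP h2 _ h1.
Qed.

Let kap := n.+1%:R * c ^+ 2 * (n.+1%:R * expR (- (beta * tN)) ^+ 2).

(** Apply the lower bound to the fundamental solution cut off after [L]: the
    source is [v] at time [t0] and a boundary term that involves only the last
    [tN] units of time before [L]. *)
Lemma energy_rec b L : beta <= b -> 0 <= L ->
  energy b L <= M ^+ 2 * (1 + kap * (energy b L - energy b (L - tN))).
Proof.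
move=> bb L0; pose S := [seq t0 + x | x <- delaysle tau (L + tN)].
pose u r := if r - t0 <= L then X (r - t0) r *m v else 0.
have uE x : u (t0 + x) = if x <= L then X x (t0 + x) *m v else 0.
  by rewrite /u [t0 + x]addrC addrK.
have uD r x j : r = t0 + x -> u (r - tau j) =
    if x - tau j <= L then X (x - tau j) (r - tau j) *m v else 0.
  by move=> ->; rewrite -addrA uE.
have tN0 : 0 < tN by exact: tau_pos.
have S_uniq : uniq S by rewrite map_inj_uniq ?undup_uniq // => x y /addrI.
have u_out r : r \notin S -> u r = 0.
  move=> rS; rewrite /u; case: ifP => // rL.
  rewrite (fund_notin tau0_gt0 tau_min D (L := L + tN)) ?mul0mx //.
    by rewrite (le_trans rL) // lerDl ltW.
  by apply: contra rS => h; apply/mapP; exists (r - t0); rewrite // addrC subrK.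
have u_delay r j : r \notin S -> u (r - tau j) = 0.
  move=> rS; rewrite /u; case: ifP => // rL.
  rewrite (fund_notin tau0_gt0 tau_min D (L := L)) ?mul0mx //.
  apply: contra rS => h; apply/mapP; exists (r - t0); last by rewrite addrC subrK.
  have := mem_delaysle_add j h; rewrite addrAC subrK => /mem_delaysleP; apply.
  by move: rL (tau_max j); lra.
have := lower_bound_discrete S_uniq u_out u_delay bb.
rewrite !big_map.
have e2 x : expR (- (b * (t0 + x))) ^+ 2 = expR (- (b * t0)) ^+ 2 * expR (- (b * x)) ^+ 2.
  by rewrite mulrDr opprD expRD exprMn.
under eq_bigr do rewrite e2 -mulrA.
under [X in _ <= _ * X]eq_bigr do rewrite e2 -mulrA.
rewrite -!mulr_sumr mulrCA ler_pM2l ?exprn_gt0 ?expR_gt0 // => main.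
have eL : energy b L =
    \sum_(x <- delaysle tau (L + tN)) expR (- (b * x)) ^+ 2 * enorm (u (t0 + x)) ^+ 2.
  rewrite (@energy_le b (L + tN) L) ?lerDl ?(ltW tN0) // big_mkcond /=.
  apply: eq_bigr => x _; rewrite uE; case: ifP => // _.
  by rewrite enorm0 expr0n mulr0.
rewrite {1}eL; apply: le_trans main _; rewrite ler_wpM2l ?sqr_ge0 //.
have -> : energy b L - energy b (L - tN) =
    \sum_(x <- delaysle tau L | L - tN < x) expR (- (b * x)) ^+ 2 * a x.
  rewrite (@energy_le b L (L - tN)) ?gerBl ?(ltW tN0) //.
  rewrite /energy (bigID (fun x => x <= L - tN)) /= addrAC subrr add0r.
  by apply: eq_bigl => x; rewrite -ltNge.
set W := \sum_(x <- delaysle tau L | _) _.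
have W0 : 0 <= W by apply: sumr_ge0 => x _; rewrite mulr_ge0 ?sqr_ge0.
rewrite (bigID (fun x => x <= L)) /=; apply: lerD.
  rewrite (bigID (fun x => x == 0)) /= [X in _ + X]big1 ?addr0.
    rewrite (eq_bigr (fun=> enorm v ^+ 2)); last first.
      move=> x /andP[_ /eqP ->]; rewrite mulr0 oppr0 expR0 expr1n mul1r addr0.
      rewrite big1 ?subr0 => [|j _].
        by rewrite -[t0 in u t0]addr0 uE L0 fund0 // mul1mx.
      rewrite (uD _ 0) ?addr0 // sub0r ifT; last by rewrite (le_trans _ L0) // oppr_le0 ltW.
      by rewrite fund_lt0 ?oppr_lt0 // mul0mx mulmx0.
    rewrite -big_filter big_const_seq count_predT iter_addr_0.
    have v1 : enorm v ^+ 2 <= 1 by rewrite -(expr1n _ 2) lerXn2r ?nnegrE ?enorm_ge0.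
    set s0 := [seq _ <- _ | _]; have : (size s0 <= 1)%N.
      apply: (@uniq_leq_size _ s0 [:: 0]); first by rewrite filter_uniq // undup_uniq.
      by move=> x; rewrite mem_filter inE => /andP[/andP[]].
    by case: (size s0) => [|[|//]] _; rewrite ?mulr0n ?mulr1n.
  move=> x /andP[xL x0]; rewrite uE xL.
  have [x_lt|x_gt|/eqP] := ltgtP x 0; last by rewrite (negbTE x0).
    rewrite fund_lt0 // mul0mx big1 ?subr0 ?enorm0 ?expr0n ?mulr0 // => j _.
    rewrite (uD _ x) // ifT; last by rewrite (le_trans _ xL) // gerBl ltW.
    by rewrite fund_lt0 ?mul0mx ?mulmx0 // subr_lt0 (lt_trans x_lt).
  rewrite fund_gt0 // mulmx_suml -sumrB big1 ?enorm0 ?expr0n ?mulr0 // => j _.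
  rewrite (uD _ x) // ifT; last by rewrite (le_trans _ xL) // gerBl ltW.
  by rewrite mulmxA subrr.
pose f x j := expR (- (b * x)) ^+ 2 * enorm (u (t0 + x - tau j)) ^+ 2.
apply: (@le_trans _ _ (\sum_(x <- delaysle tau (L + tN) | ~~ (x <= L))
    n.+1%:R * c ^+ 2 * \sum_j f x j)).
  apply: ler_sum => x xL; rewrite uE (negbTE xL) sub0r enormN.
  rewrite (_ : n.+1%:R * _ * _ = expR (- (b * x)) ^+ 2 * (n.+1%:R * c ^+ 2 *
    \sum_j enorm (u (t0 + x - tau j)) ^+ 2)); last by rewrite /f -mulr_sumr mulrCA.
  rewrite ler_wpM2l ?sqr_ge0 //.
  apply: (@le_trans _ _ ((\sum_j c * enorm (u (t0 + x - tau j))) ^+ 2)).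
    rewrite lerXn2r ?nnegrE ?enorm_ge0 //.
      by apply: sumr_ge0 => j _; rewrite mulr_ge0 ?enorm_ge0.
    apply: le_trans (enorm_sum _ _ _) _; apply: ler_sum => j _.
    by rewrite (le_trans (enormM _ _)) // ler_wpM2r ?enorm_ge0.
  apply: le_trans (cauchy_schwarz_seq _ _ _) _.
  by rewrite sumr_const card_ord -[c ^+ 2 *+ _]mulr_natl.
rewrite -mulr_sumr /kap -!mulrA !ler_wpM2l ?sqr_ge0 //.
rewrite exchange_big /=.
apply: (@le_trans _ _ (\sum_(j < n.+1) expR (- (beta * tN)) ^+ 2 * W)); last first.
  by rewrite sumr_const card_ord mulr_natl expr2 -mulrA.
apply: ler_sum => j _; rewrite /W mulr_sumr -big_filter.
pose h y := if L - tN < y then expR (- (beta * tN)) ^+ 2 *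
              (expR (- (b * y)) ^+ 2 * enorm (u (t0 + y)) ^+ 2) else 0.
have h0 y : 0 <= h y.
  by rewrite /h; case: ifP => // _; rewrite mulr_ge0 ?sqr_ge0 // mulr_ge0 ?sqr_ge0.
apply: (@le_trans _ _ (\sum_(x <- [seq x <- delaysle tau (L + tN) | ~~ (x <= L)]) h (x - tau j))).
  rewrite big_seq [leRHS]big_seq; apply: ler_sum => x.
  rewrite (mem_filter (fun x => ~~ (x <= L))) -ltNge => /andP[Lx _].
  rewrite /h ifT; last by move: Lx (tau_max j); lra.
  rewrite /f -addrA mulrA ler_wpM2r ?sqr_ge0 // -exprMn -expRD.
  rewrite lerXn2r ?nnegrE ?expR_ge0 // ler_expR.
  have h1 : beta * tau j <= b * tau j by rewrite ler_wpM2r // ltW.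
  have h2 : beta * tN <= beta * tau j by rewrite ler_wnM2l ?tau_max // ltW.
  by move: h1 h2; rewrite mulrBr; lra.
rewrite -(big_map (fun x => x - tau j) xpredT h).
apply: (@le_trans _ _ (\sum_(x <- delaysle tau L) h x)).
  apply: ler_sum_uniq => //; last 1 first.
  - move=> y _ yL; rewrite /h; case: ifP => // _; rewrite uE; case: ifP => yL'.
      by rewrite (fund_notin tau0_gt0 tau_min D (L := L)) // mul0mx enorm0 expr0n !mulr0.
    by rewrite enorm0 expr0n !mulr0.
  - by rewrite map_inj_uniq ?filter_uniq ?undup_uniq // => x y /addIr.
  - exact: undup_uniq.
rewrite [leRHS]big_mkcond big_seq [leRHS]big_seq; apply: ler_sum => y.
move=> /(mem_delaysle tau0_gt0 tau_min) /andP[_ yL]; rewrite /h; case: ifP => // _.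
by rewrite uE yL.
Qed.

Lemma energy_mono b L L' : L' <= L -> energy b L' <= energy b L.
Proof.
move=> LL; rewrite (energy_le _ LL) /energy [leRHS](bigID (fun x => x <= L')) /=.
by rewrite lerDl sumr_ge0 // => x _; rewrite mulr_ge0 ?sqr_ge0.
Qed.

(** By [dichotomy] the energy for the exponent [b] is bounded as soon as it grows
    slowly. This holds for large [b], and passes from [b + dl] to [b]; hence
    it holds down to [beta]. *)
Lemma energy_bound m : energy beta (m%:R * tN) <= M ^+ 2.
Proof.
have tN0 : 0 < tN by exact: tau_pos.
have kap0 : 0 <= kap by rewrite mulr_ge0 // mulr_ge0 ?sqr_ge0.
(* [energy_rec] forces a growth rate of at least [k / (k - 1)]; [r] is smaller,
   and [dl] is such that the squared weights for [b] and [b + dl] differ by the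
   factor [r] over a time [tN]. *)
pose k := M ^+ 2 * kap + 2.
have k1 : 1 < k by rewrite ltr_wpDl // ?ltr1n // mulr_ge0 ?sqr_ge0.
have k0 : 0 < k by rewrite (lt_trans _ k1).
pose y := (2 * k)^-1; have y0 : 0 < y by rewrite invr_gt0 mulr_gt0.
pose r := expR y; have r0 : 0 < r by exact: expR_gt0.
have rk : r * (k - 1) < k.
  have : 1 - y <= expR (- y) by exact: expR_ge1Dx.
  rewrite expRN -/r => h; rewrite -ltr_pdivlMl //.
  have : (1 - y) * k <= r^-1 * k by rewrite ler_wpM2r // ltW.
  apply: lt_le_trans; rewrite mulrBl mul1r ltrD2l ltrN2 /y.
  by rewrite mulrC ltr_pdivrMr ?mulr_gt0 // mul1r; lra.
pose E b j := energy b (j%:R * tN).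
have good b : beta <= b -> (exists C, forall j, E b j <= C * r ^+ j) ->
    forall j, E b j <= M ^+ 2.
  move=> bb [C hC]; apply: (dichotomy k1 r0 rk _ hC (sqr_ge0 _)) => j.
  have := @energy_rec b (j.+1%:R * tN) bb; rewrite mulr_ge0 ?(ltW tN0) // => /(_ isT).
  rewrite {3}[j.+1%:R]mulrSr mulrDl mul1r addrK -/(E b j) -/(E b j.+1).
  have : 0 <= E b j.+1 - E b j.
    by rewrite subr_ge0 energy_mono // ler_wpM2r ?(ltW tN0) // ler_nat.
  rewrite /k; set de := E b j.+1 - E b j => de0.
  by rewrite mulrDr mulr1 mulrA mulrDl; move: de0; lra.
pose dl := y / (2 * tN).
have dl0 : 0 < dl by rewrite divr_gt0 // mulr_gt0.
have down b : (forall j, E (b + dl) j <= M ^+ 2) -> exists C, forall j, E b j <= C * r ^+ j.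
  move=> h; exists (M ^+ 2) => j; rewrite mulrC.
  apply: (@le_trans _ _ (r ^+ j * E (b + dl) j)); last by rewrite ler_pM2l ?exprn_gt0.
  rewrite /E /energy mulr_sumr big_seq [leRHS]big_seq; apply: ler_sum => x.
  move=> /(mem_delaysle tau0_gt0 tau_min) /andP[x0 xL].
  rewrite mulrA ler_wpM2r // /r -!expRM_natl -expRD ler_expR.
  have h1 : dl * x <= dl * (j%:R * tN) by rewrite ler_wpM2l // ltW.
  have h2 : dl * (j%:R * tN) * 2 = j%:R * y by rewrite /dl; field; rewrite gt_eqF.
  by rewrite -h2; move: h1; lra.
have [b1 b10 hb1] := fund_exp_bound.
set e1 := enorm (1%:M : 'M[R[i]]_d) in hb1.
have base b : b1 <= b -> exists C, forall j, E b j <= C * r ^+ j.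
  move=> bb; have [C C0 hC] := len_exp_le tau0_gt0 (divr_gt0 y0 tN0).
  exists (e1 ^+ 2 * C) => j; rewrite /E.
  have jt : 0 <= j%:R * tN by rewrite mulr_ge0 // ltW.
  apply: (@le_trans _ _ (\sum_(x <- delaysle tau (j%:R * tN)) e1 ^+ 2)).
    rewrite /energy big_seq [leRHS]big_seq; apply: ler_sum => x.
    move=> /(mem_delaysle tau0_gt0 tau_min) /andP[x0 _].
    rewrite /a -exprMn lerXn2r ?nnegrE ?mulr_ge0 ?expR_ge0 ?enorm_ge0 //.
    apply: (@le_trans _ _ (expR (- (b * x)) * (e1 * expR (b1 * x)))).
      rewrite ler_wpM2l ?expR_ge0 // (le_trans (enormM _ _)) //.
      apply: le_trans (hb1 x (t0 + x)).
      by rewrite -[leRHS]mulr1 ler_wpM2l ?enorm_ge0.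
    rewrite mulrCA -expRD ler_piMr ?enorm_ge0 //.
    have h : b1 * x <= b * x by rewrite ler_wpM2r.
    by rewrite -expR0 ler_expR; move: h; lra.
  rewrite big_const_seq count_predT iter_addr_0 -[_ *+ size _]mulr_natr -mulrA.
  rewrite ler_wpM2l ?sqr_ge0 //.
  apply: (@le_trans _ _ (len tau (j%:R * tN) ^ n.+1)%N%:R).
    by rewrite ler_nat size_delaysle.
  apply: le_trans (hC _ jt) _; rewrite ler_pM2l // /r -expRM_natl ler_expR.
  by rewrite le_eqVlt; apply/orP; left; apply/eqP; field; rewrite gt_eqF.
pose k1' := (Num.truncn ((b1 - beta) / dl)).+1.
have large j : (k1' <= j)%N -> b1 <= beta + j%:R * dl.
  move=> h; rewrite -lerBlDl; apply: (@le_trans _ _ (k1'%:R * dl)).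
    by rewrite -ler_pdivrMr // ltW // truncnS_gt.
  by rewrite ler_wpM2r ?(ltW dl0) // ler_nat.
have beta_le j : beta <= beta + j%:R * dl by rewrite lerDl mulr_ge0 // ltW.
suff h i j : (k1' <= j + i)%N -> forall m', E (beta + j%:R * dl) m' <= M ^+ 2.
  by have := h k1' 0%N (leqnn _) m; rewrite mul0r addr0.
elim: i j => [|i IH] j; first by rewrite addn0 => /large /base; exact: good.
rewrite addnS -addSn => /IH h; apply: good => //; apply: down.
by move: h; rewrite -[in j.+1%:R]natr1 mulrDl mul1r addrA.
Qed.

Lemma fund_col_le x : enorm (X x (t0 + x) *m v) <= M * expR (beta * x).
Proof.
have M0 : 0 <= M * expR (beta * x) by rewrite mulr_ge0 ?expR_ge0.
have [xL|xL] := boolP (x \in delaysle tau x); last first.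
  by rewrite (fund_notin tau0_gt0 tau_min D (L := x)) // mul0mx enorm0.
have tN0 : 0 < tN by exact: tau_pos.
pose m := (Num.truncn (x / tN)).+1.
have xm : x <= m%:R * tN by rewrite -ler_pdivrMr // ltW // truncnS_gt.
have : expR (- (beta * x)) ^+ 2 * a x <= M ^+ 2.
  apply: le_trans (energy_bound m); rewrite /energy (bigD1_seq x) ?undup_uniq //=.
    by rewrite lerDl sumr_ge0 // => y _; rewrite mulr_ge0 ?sqr_ge0.
  exact: mem_delaysleP xL _ xm.
rewrite /a -exprMn ler_pXn2r ?nnegrE ?mulr_ge0 ?expR_ge0 ?enorm_ge0 //.
by rewrite expRN mulrC ler_pdivrMr ?expR_gt0.
Qed.

End Energy.

Lemma enorm_delta_col i : enorm (delta_mx i ord0 : 'cV[R[i]]_d) = 1.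
Proof.
rewrite /enorm (bigD1 i) //= big_ord1 mxE !eqxx /= expr1n expr0n addr0.
rewrite big1 ?addr0 ?sqrtr1 // => j ji.
by rewrite big_ord1 mxE (negbTE ji) /= expr0n addr0.
Qed.

Lemma enorm_le_cols (A : 'M[R[i]]_d) :
  enorm A <= \sum_i enorm (A *m (delta_mx i ord0 : 'cV_d)).
Proof.
have delta_row i : enorm (delta_mx ord0 i : 'rV[R[i]]_d) = 1.
  rewrite /enorm big_ord1 (bigD1 i) //= mxE !eqxx /= expr1n expr0n addr0.
  rewrite big1 ?addr0 ?sqrtr1 // => j ji.
  by rewrite mxE (negbTE ji) /= expr0n addr0.
rewrite -[in leLHS](mulmx1 A) mx1_sum_delta mulmx_sumr.
apply: le_trans (enorm_sum _ _ _) _; apply: ler_sum => i _.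
rewrite -(mul_delta_mx (ord0 : 'I_1)) mulmxA (le_trans (enormM _ _)) //.
by rewrite delta_row mulr1.
Qed.

Lemma decay_of_lower_bound : fund_decay tau D.
Proof.
exists (- beta), (d%:R * M + 1); split; first by rewrite oppr_gt0.
  by rewrite ltr_wpDl // mulr_ge0.
move=> x t; rewrite mulNr opprK (le_trans (enorm_le_cols _)) //.
apply: (@le_trans _ _ (\sum_(i < d) M * expR (beta * x))).
  apply: ler_sum => i _.
  have e1 : enorm (delta_mx i ord0 : 'cV[R[i]]_d) <= 1 by rewrite enorm_delta_col.
  by have := fund_col_le (t - x) e1 x; rewrite subrK.
rewrite sumr_const card_ord -[(M * _) *+ d]mulr_natl mulrA ler_wpM2r ?expR_ge0 //.
by rewrite lerDl.
Qed.

End Decay.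

(** * Norm bounds for the delay operators *)

Section WordOperators.
Variables (R : realType) (d n : nat).
Variables (tau : 'I_n.+1 -> R) (T : R) (D : 'I_n.+1 -> R -> 'M[R[i]]_d).
Hypothesis T_gt0 : 0 < T.
Variable F : 'I_n.+1 -> int -> 'M[R[i]]_d.
Variable c : R.
Hypothesis F_summable : forall j, summable_by (F j) c.
Hypothesis F_inversion : forall j t,
  mxcvg (fun N => \sum_(m <- win N) cis (m%:~R * (2 * pi / T) * t) *: F j m) (D j t).
Implicit Types (p : R[i]) (x y : zseq R d) (w : seq 'I_n.+1).

Notation om := (2 * pi / T).
Notation delop := (delop tau T F).
Notation delop_trunc := (delop_trunc tau T F).
Notation Dk := (D_trunc T F).

Let c_ge0 : 0 <= c := c_ge0 F_summable F_inversion.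

Definition wordop p w x : zseq R d := foldr (fun j y => delop p j y) x w.

(** The truncated operators keep finitely supported sequences finitely supported,
    so that [symbol] below applies to them. *)
Definition wordop_trunc k p w x : zseq R d := foldr (fun j y => delop_trunc k p j y) x w.

Definition wbound p w : R := \prod_(j <- w) (c * expR (- (complex.Re p * tau j))).

Lemma wordop_L2by p w x C : L2by x C -> L2by (wordop p w x) (wbound p w * C).
Proof.
move=> hx; elim: w => [|j w IH]; first by rewrite /wbound big_nil mul1r.
rewrite /wbound big_cons -!mulrA; exact: (delop_L2by tau T F_summable p j IH).
Qed.

Lemma wordop_linear p w x y C C' (a : R[i]) : L2by x C -> L2by y C' ->
  wordop p w (fun l => a *: x l + y l) = (fun l => a *: wordop p w x l + wordop p w y l).
Proof.
move=> hx hy; elim: w => //= j w ->.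
exact: (delop_linear tau T F_summable p j a (wordop_L2by p w hx) (wordop_L2by p w hy)).
Qed.

Lemma D_trunc_bounded k j t : enorm (Dk k j t) <= c.
Proof.
apply: le_trans (enorm_sum _ _ _) _; apply: le_trans (F_summable j (win_uniq k)).
by apply: ler_sum => m _; rewrite enorm_cisZ.
Qed.

Lemma wcoef_bounded w : exists2 B, 0 < B & forall t, enorm (wcoef tau D w t) <= B.
Proof.
elim: w => [|j w [B B0 hB]].
  by exists (enorm (1%:M : 'M[R[i]]_d) + 1); rewrite ?ltr_wpDl ?enorm_ge0 // => t; rewrite lerDl.
exists (c * B + 1); first by rewrite ltr_wpDl // mulr_ge0 // ltW.
move=> t /=; rewrite (le_trans (enormM _ _)) // ler_wpDr //.
by rewrite ler_pM ?enorm_ge0 // (D_bounded F_summable F_inversion).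
Qed.

Lemma wcoef_trunc_near w e : 0 < e -> exists N, forall k t, (N <= k)%N ->
  enorm (wcoef tau (Dk k) w t - wcoef tau D w t) <= e.
Proof.
elim: w e => [|j w IH] e e0.
  by exists 0%N => k t _; rewrite subrr enorm0 ltW.
have [B B0 hB] := wcoef_bounded w; have c1 : 0 < c + 1 by rewrite ltr_wpDl.
have [N hN] := IH (e / 2 / (c + 1)) (divr_gt0 (divr_gt0 e0 (ltr0Sn _ 1)) c1).
have [N' hN'] := F_tail F_summable (divr_gt0 (divr_gt0 e0 (ltr0Sn _ 1)) B0).
exists (maxn N N') => k t; rewrite geq_max => /andP[k1 k2] /=.
set A := wcoef tau (Dk k) w (t - tau j); set A' := wcoef tau D w (t - tau j).
rewrite (_ : _ - _ = Dk k j t *m (A - A') + (Dk k j t - D j t) *m A'); last first.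
  by rewrite mulmxBr mulmxBl addrA subrK.
rewrite (le_trans (enormD _ _)) // (splitr e); apply: lerD; rewrite (le_trans (enormM _ _)) //.
  apply: (@le_trans _ _ ((c + 1) * (e / 2 / (c + 1)))).
    apply: ler_pM; rewrite ?enorm_ge0 ?hN //.
    by apply: le_trans (D_trunc_bounded k j t) _; rewrite lerDl.
  by rewrite mulrCA divff ?mulr1 // gt_eqF.
apply: (@le_trans _ _ (e / 2 / B * B)); last by rewrite divfK // gt_eqF.
apply: ler_pM; rewrite ?enorm_ge0 ?hB //.
exact: (D_trunc_near F_inversion _ (hN' k j k2)).
Qed.

Definition L2cvg (xs : nat -> zseq R d) x :=
  forall e, 0 < e -> exists N, forall k, (N <= k)%N -> L2by (fun l => xs k l - x l) e.

Lemma delop_trunc_L2by k p j x C : L2by x C ->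
  L2by (delop_trunc k p j x) (c * (expR (- (complex.Re p * tau j)) * C)).
Proof.
move=> hx; set C' := expR _ * C.
apply: (@L2by_le _ _ _ (\sum_(m <- win k) enorm (F j m) * C')).
  by apply: L2by_sum => m; apply: L2byM; apply: L2by_shift; exact: twist_L2by.
rewrite -mulr_suml ler_wpM2r //; last exact: F_summable (win_uniq k).
by rewrite mulr_ge0 ?expR_ge0 // (L2by_ge0 hx).
Qed.

Lemma delop_trunc_cvg p j (xs : nat -> zseq R d) x C : L2by x C -> L2cvg xs x ->
  L2cvg (fun k => delop_trunc k p j (xs k)) (delop p j x).
Proof.
move=> hx hxs e e0; set b := expR (- (complex.Re p * tau j)).
have b0 : 0 < b by exact: expR_gt0.
have cb0 : 0 < c * b + 1 by rewrite ltr_wpDl // mulr_ge0 // ltW.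
have C0 := L2by_ge0 hx.
have bC0 : 0 < b * C + 1 by rewrite ltr_wpDl // mulr_ge0 // ltW.
have [N hN] := hxs _ (divr_gt0 (divr_gt0 e0 (ltr0Sn _ 1)) cb0).
have [N' hN'] := F_tail F_summable (divr_gt0 (divr_gt0 e0 (ltr0Sn _ 1)) bC0).
exists (maxn N N') => k; rewrite geq_max => /andP[k1 k2].
have h1 := delop_trunc_L2by k p j (hN k k1).
have h2 := delop_approx tau T F_summable p (hN' k j k2) hx.
have := L2byB h1 h2; set e1 := e / 2 / _; set e2 := e / 2 / _ => h.
have -> : (fun l => delop_trunc k p j (xs k) l - delop p j x l) =
   (fun l => delop_trunc k p j (fun m => xs k m - x m) l -
             (delop p j x l - delop_trunc k p j x l)).
  apply/funext => l; rewrite opprB addrA; congr (_ - _).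
  rewrite -big_split /=; apply: eq_bigr => m _.
  by rewrite -mulmxDr /twist -scalerDr subrK.
apply: L2by_le h _; rewrite -/b (splitr e); apply: lerD.
  apply: (@le_trans _ _ ((c * b + 1) * e1)); last by rewrite /e1 mulrCA divff ?mulr1 // gt_eqF.
  by rewrite mulrA ler_wpM2r ?lerDl // /e1 !divr_ge0 // ltW.
apply: (@le_trans _ _ (e2 * (b * C + 1))); last by rewrite /e2 divfK // gt_eqF.
by rewrite ler_wpM2l ?lerDl // /e2 !divr_ge0 // ltW.
Qed.

Lemma mask_cvg x C : L2by x C -> L2cvg (fun k l => if l \in win k then x l else 0) x.
Proof.
move=> hx e e0; have [s us hs] := L2by_tail hx e0.
have [N hN] := win_sub_seq s; exists N => k Nk.
apply: (L2by_dom hs) => l; case: (boolP (l \in win k)) => lk.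
  by rewrite subrr enorm0 enorm_ge0.
case: ifP => [/hN|_]; last by rewrite sub0r enormN.
by rewrite mem_win => h; case/negP: lk; rewrite mem_win (leq_trans h).
Qed.

Lemma wordop_trunc_cvg p w x C : L2by x C ->
  L2cvg (fun k => wordop_trunc k p w (fun l => if l \in win k then x l else 0))
        (wordop p w x).
Proof.
move=> hx; elim: w => [|j w IH] /=; first exact: mask_cvg hx.
exact: (delop_trunc_cvg p j (wordop_L2by p w hx) IH).
Qed.

(** The function with Fourier coefficients [x], when [x] is supported in
    [win A]. *)
Definition symbol (A : nat) x (t : R) : 'cV[R[i]]_d :=
  \sum_(l <- win A) cis (- (l%:~R * om * t)) *: x l.

Definition in_win (A : nat) x := forall l, l \notin win A -> x l = 0.

Lemma in_win_le A A' x : (A <= A')%N -> in_win A x -> in_win A' x.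
Proof.
move=> AA h l; rewrite mem_win => lA; apply: h; apply: contra lA.
by rewrite mem_win => /leq_trans; apply.
Qed.

Lemma symbol_le A A' x t : (A <= A')%N -> in_win A x -> symbol A' x t = symbol A x t.
Proof.
move=> AA h; apply: big_supp; rewrite ?win_uniq //.
  by move=> l; rewrite !mem_win => /leq_trans; apply.
by move=> l _ /h ->; rewrite scaler0.
Qed.

Lemma chi0 p l r : chi T p l r = chi T p 0 r * cis (l%:~R * om * r).
Proof. by rewrite -[in LHS](add0r l) chi_addl. Qed.

Lemma delop_trunc_in_win k p j A x : in_win A x -> in_win (A + k) (delop_trunc k p j x).
Proof.
move=> h l; rewrite mem_win => lA; apply: big1_seq => m /andP[_]; rewrite mem_win => mk.
by rewrite /twist h ?scaler0 ?mulmx0 // mem_win; lia.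
Qed.

(** On symbols the truncated operators are exactly the delayed multiplications. *)
Lemma symbol_delop k p j A x t : in_win A x ->
  symbol (A + k) (delop_trunc k p j x) t =
  Dk k j t *m (chi T p 0 (tau j) *: symbol A x (t - tau j)).
Proof.
move=> h.
rewrite /symbol /delop_trunc; under eq_bigr do rewrite scaler_sumr.
rewrite exchange_big /= /D_trunc mulmx_suml; rewrite big_seq [RHS]big_seq.
apply: eq_bigr => m mk; rewrite -scalemxAl.
pose f l := cis (- (l%:~R * om * t)) *: twist T p (tau j) x l.
have fE l : f l = chi T p 0 (tau j) *: (cis (- (l%:~R * om * (t - tau j))) *: x l).
  rewrite /f /twist chi0 !scalerA; congr (_ *: _); rewrite mulrCA -cisD.
  by congr (_ * cis _); ring.
have -> : \sum_(l <- win (A + k))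
      cis (- (l%:~R * om * t)) *: (F j m *m twist T p (tau j) x (l + m)) =
    cis (m%:~R * om * t) *: (F j m *m \sum_(l <- win (A + k)) f (l + m)).
  rewrite mulmx_sumr scaler_sumr; apply: eq_bigr => l _.
  rewrite /f; move: (twist _ _ _ _ _) => y.
  by rewrite -scalemxAr scalerA -cisD; congr (cis _ *: _); rewrite intrD; ring.
congr (_ *: (_ *m _)); rewrite -(big_map (fun l => l + m) xpredT f).
rewrite scaler_sumr; under [RHS]eq_bigr do rewrite -fE.
apply: big_supp; rewrite ?win_uniq //.
- by rewrite map_inj_uniq ?win_uniq // => a b /addIr.
- move=> l lA; apply/mapP; exists (l - m); last by rewrite subrK.
  by move: lA mk; rewrite !mem_win; lia.
- by move=> l _ /h xl; rewrite /f /twist xl !scaler0.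
Qed.

Lemma symbol_wordop k p w A x t : in_win A x ->
  in_win (A + size w * k) (wordop_trunc k p w x) /\
  symbol (A + size w * k) (wordop_trunc k p w x) t =
  chi T p 0 (delay tau w) *: (wcoef tau (Dk k) w t *m symbol A x (t - delay tau w)).
Proof.
move=> h; elim: w t => [|j w IH] t /=.
  rewrite mul0n addn0 /delay big_nil subr0 mul1mx chiE !mulr0 oppr0 expR0 cis0 mulr1.
  by rewrite -[Complex 1 0]/(1 : R[i]) scale1r.
have [h1 _] := IH t; rewrite mulSn addnCA addnC; split; first exact: delop_trunc_in_win.
rewrite symbol_delop //; have [_ ->] := IH (t - tau j).
rewrite delay_cons chiD scalerA -scalemxAr mulmxA; congr (_ *: (_ *m symbol _ _ _)).
by ring.
Qed.

(** Parseval's identity, with means over equidistant times: the symbol of the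
    image at [t] is the value at [t] of the summed coefficient function applied to
    the symbol of [x] at [t - r]. *)
Lemma trunc_group_bound k p A x C (ws : seq (seq 'I_n.+1)) r Cs :
  in_win A x -> L2by x C -> (forall w, w \in ws -> delay tau w = r) ->
  (forall t, enorm (\sum_(w <- ws) wcoef tau (Dk k) w t) <= Cs) ->
  L2by (fun l => \sum_(w <- ws) wordop_trunc k p w x l)
       (expR (- (complex.Re p * r)) * Cs * C).
Proof.
move=> hx hC hws hCs; set z := fun l => \sum_(w <- ws) _ l.
have [B hB] : exists B, forall w, w \in ws -> (size w <= B)%N.
  elim: {hws hCs z} ws => [|w ws [B hB]]; first by exists 0%N.
  exists (maxn (size w) B) => w'; rewrite inE => /orP[/eqP ->|/hB h].
    exact: leq_maxl.
  by rewrite (leq_trans h) ?leq_maxr.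
pose A' := (A + B * k)%N.
have AA : (A <= A')%N by rewrite leq_addr.
have zA : in_win A' z.
  move=> l lA; rewrite /z big1_seq // => w /andP[_ ww].
  have [h _] := symbol_wordop k p w 0 hx; apply: (in_win_le _ h) lA.
  by rewrite leq_add2l leq_mul2r hB ?orbT.
have zS t : symbol A' z t = chi T p 0 r *:
    ((\sum_(w <- ws) wcoef tau (Dk k) w t) *m symbol A' x (t - r)).
  rewrite mulmx_suml scaler_sumr /symbol /z.
  under eq_bigr do rewrite scaler_sumr.
  rewrite exchange_big /= big_seq [RHS]big_seq; apply: eq_bigr => w ww.
  have [h hs] := symbol_wordop k p w t hx.
  rewrite -/(symbol A' x _) (symbol_le _ AA hx) -(hws w ww) -hs.
  by apply: symbol_le; rewrite // leq_add2l leq_mul2r hB ?orbT.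
pose de : R := (2 * A'.+1)%:R^-1.
have de0 : 0 < de by rewrite invr_gt0 ltr0n.
pose th (l : int) := l%:~R * de.
have hth : {in win A' &, forall l l', l != l' -> cos (th l - th l') != 1}.
  move=> l l'; rewrite !mem_win => lA lA' ll; rewrite /th -mulrBl -intrB.
  apply: cos_neq1; rewrite normrM (ger0_norm (ltW de0)).
    by rewrite mulr_gt0 // normr_gt0 intr_eq0 subr_eq0.
  apply: (@lt_le_trans _ _ 1); last by have := pi_ge2 R; lra.
  rewrite /de ltr_pdivrMr ?ltr0n // mul1r -intr_norm.
  rewrite -[(2 * A'.+1)%:R]/((2 * A'.+1)%:Z%:~R) ltr_int; lia.
pose tt (v : nat) := - (v%:R * de / om).
have om0 : om != 0 by rewrite gt_eqF // divr_gt0 // mulr_gt0 // pi_gt0.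
have symE y v s : symbol A' y (tt v - s) =
    \sum_(l <- win A') cis (v%:R * th l) *: (cis (l%:~R * om * s) *: y l).
  apply: eq_bigr => l _; rewrite scalerA -cisD; congr (cis _ *: _).
  by move: om0; rewrite /tt /th; move: om (de) => o e o0; field.
have [B1 hB1] := bohr_mean (fun l => cis (l%:~R * om * 0) *: z l) (win_uniq A') hth.
have [B2 hB2] := bohr_mean (fun l => cis (l%:~R * om * r) *: x l) (win_uniq A') hth.
have norm_cis y s : \sum_(l <- win A') enorm (cis (l%:~R * om * s) *: y l) ^+ 2 =
    \sum_(l <- win A') enorm (y l) ^+ 2.
  by apply: eq_bigr => l _; rewrite enorm_cisZ.
apply: (L2by_supp (win_uniq A') zA).
set b := expR _; have b0 : 0 <= b by exact: expR_ge0.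
have Cs0 : 0 <= Cs by exact: le_trans (enorm_ge0 _) (hCs 0).
have C0 := L2by_ge0 hC.
rewrite -[leRHS]ger0_norm ?mulr_ge0 // -sqrtr_sqr ler_wsqrtr //.
apply: (@le_trans _ _ ((b * Cs) ^+ 2 * \sum_(l <- win A') enorm (x l) ^+ 2)); last first.
  rewrite [leRHS]exprMn ler_wpM2l ?sqr_ge0 // -l2sumK.
  by rewrite lerXn2r ?nnegrE ?l2sum_ge0 // hC ?win_uniq.
apply: (@ler_lim_nat _ _ _ (B1 + (b * Cs) ^+ 2 * B2)) => N.
have := hB1 N; have := hB2 N; rewrite !norm_cis.
under eq_bigr do rewrite -symE; under [X in _ -> `|X - _| <= _ -> _]eq_bigr do rewrite -symE.
rewrite !ler_norml => /andP[_ h2] /andP[h1 _].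
have h3 : \sum_(v < N) enorm (symbol A' z (tt v - 0)) ^+ 2 <=
    (b * Cs) ^+ 2 * \sum_(v < N) enorm (symbol A' x (tt v - r)) ^+ 2.
  rewrite mulr_sumr; apply: ler_sum => v _; rewrite subr0 zS -exprMn.
  rewrite lerXn2r ?nnegrE ?mulr_ge0 ?enorm_ge0 // enorm_chiZ -mulrA ler_wpM2l //.
  by rewrite (le_trans (enormM _ _)) // ler_wpM2r ?enorm_ge0.
have h4 : (b * Cs) ^+ 2 * \sum_(v < N) enorm (symbol A' x (tt v - r)) ^+ 2 <=
    (b * Cs) ^+ 2 * (B2 + N%:R * \sum_(l <- win A') enorm (x l) ^+ 2).
  by rewrite ler_wpM2l ?sqr_ge0 // -lerBlDr.
apply: (@le_trans _ _ (B1 + (b * Cs) ^+ 2 * (B2 + N%:R * \sum_(l <- win A') enorm (x l) ^+ 2))).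
  by move: (le_trans h3 h4) h1; lra.
by rewrite le_eqVlt; apply/orP; left; apply/eqP; ring.
Qed.

(** By truncation this follows from [trunc_group_bound]. Only the supremum of the
    summed coefficient function enters, not the number of words. *)
Lemma group_bound p x C (ws : seq (seq 'I_n.+1)) r Cs : L2by x C ->
  (forall w, w \in ws -> delay tau w = r) ->
  (forall t, enorm (\sum_(w <- ws) wcoef tau D w t) <= Cs) ->
  L2by (fun l => \sum_(w <- ws) wordop p w x l)
       (expR (- (complex.Re p * r)) * Cs * C).
Proof.
move=> hC hws hCs; have C0 := L2by_ge0 hC.
set b := expR _; have b0 : 0 < b by exact: expR_gt0.
have near e : 0 < e -> exists N, forall k t, (N <= k)%N ->
    enorm (\sum_(w <- ws) wcoef tau (Dk k) w t - \sum_(w <- ws) wcoef tau D w t) <= e.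
  elim: {hws hCs} ws e => [|w ws IH] e e0.
    by exists 0%N => k t _; rewrite !big_nil subrr enorm0 ltW.
  have e20 : 0 < e / 2 by rewrite divr_gt0.
  have [N hN] := wcoef_trunc_near w e20; have [N' hN'] := IH _ e20.
  exists (maxn N N') => k t; rewrite geq_max => /andP[k1 k2].
  rewrite !big_cons opprD addrACA (le_trans (enormD _ _)) // (splitr e).
  by rewrite lerD ?hN ?hN'.
pose xk k l := if l \in win k then x l else 0.
have cvg : L2cvg (fun k l => \sum_(w <- ws) wordop_trunc k p w (xk k) l)
                 (fun l => \sum_(w <- ws) wordop p w x l).
  elim: {hws hCs near} ws => [|w ws IH] e e0.
    exists 0%N => k _; under eq_fun do rewrite !big_nil subrr.
    by apply: L2by_le (@L2by0 _ _) _; exact: ltW.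
  have e20 : 0 < e / 2 by rewrite divr_gt0.
  have [N hN] := wordop_trunc_cvg p w hC e20; have [N' hN'] := IH _ e20.
  exists (maxn N N') => k; rewrite geq_max => /andP[k1 k2].
  under eq_fun do rewrite !big_cons opprD addrACA.
  by rewrite (splitr e); apply: L2byD; [exact: hN|exact: hN'].
move=> s us; apply/ler_addgt0Pl => e e0.
have bC0 : 0 < b * C + 1 by rewrite ltr_wpDl // mulr_ge0 // ltW.
have [N hN] := near _ (divr_gt0 (divr_gt0 e0 (ltr0Sn _ 1)) bC0).
have [N' hN'] := cvg _ (divr_gt0 e0 (ltr0Sn _ 1)).
set e1 := e / 2 / _ in hN; set k := maxn N N'.
have h1 t : enorm (\sum_(w <- ws) wcoef tau (Dk k) w t) <= e1 + Cs.
  rewrite -(subrK (\sum_(w <- ws) wcoef tau D w t) (\sum_(w <- ws) wcoef tau (Dk k) w t)).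
  by rewrite (le_trans (enormD _ _)) // lerD // hN // leq_maxl.
have kw : in_win k (xk k) by move=> l /negbTE; rewrite /xk => ->.
have kC : L2by (xk k) C by exact: (L2by_mask (mem (win k)) hC).
have := L2byB (trunc_group_bound p kw kC hws h1) (hN' k (leq_maxr _ _)).
move=> /(_ s us); rewrite -/b.
under [fun l => enorm _]eq_fun do rewrite opprB addrC subrK.
move=> h; apply: le_trans h _.
have e10 : 0 <= e1 by rewrite /e1 !divr_ge0 // ltW.
have : b * C * e1 <= e / 2.
  rewrite -[leRHS](@divfK _ (b * C + 1)) ?gt_eqF // -/e1 mulrC.
  by rewrite ler_wpM2l // lerDl.
have -> : b * (e1 + Cs) * C = b * C * e1 + b * Cs * C by ring.
lra.
Qed.

End WordOperators.

(** * The inverse of the harmonic operator *)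

Section Inverse.
Variables (R : realType) (d n : nat).
Variables (tau : 'I_n.+1 -> R) (T : R) (D : 'I_n.+1 -> R -> 'M[R[i]]_d).
Hypothesis T_gt0 : 0 < T.
Variable F : 'I_n.+1 -> int -> 'M[R[i]]_d.
Variable c : R.
Hypothesis F_summable : forall j, summable_by (F j) c.
Hypothesis F_inversion : forall j t,
  mxcvg (fun N => \sum_(m <- win N) cis (m%:~R * (2 * pi / T) * t) *: F j m) (D j t).
Hypothesis tau0_gt0 : 0 < tau ord0.
Hypothesis tau_min : forall j, tau ord0 <= tau j.
Hypothesis tau_max : forall j, tau j <= tau ord_max.
Variables (g K : R).
Hypothesis g_gt0 : 0 < g.
Hypothesis K_gt0 : 0 < K.
Hypothesis decay : forall x t, enorm (fund tau D x t) <= K * expR (- (g * x)).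
Implicit Types (p : R[i]) (x y : zseq R d).

Notation delop := (delop tau T F).
Notation wordop := (wordop tau T F).
Notation harm := (harm tau T F).
Notation tN := (tau ord_max).

Let c_ge0 : 0 <= c := c_ge0 F_summable F_inversion.

(** Partial sums of the Neumann series of [harm p], ordered by total delay. *)
Definition neumann p (L : R) x : zseq R d := fun k => \sum_(w <- wordsle tau L) wordop p w x k.

(** By [group_bound] its norm is controlled by [fund], not by the number of
    words of delay [r]. *)
Definition group p (r : R) x : zseq R d :=
  fun k => \sum_(w <- wordsle tau r | delay tau w == r) wordop p w x k.

Lemma groupE p L r x k : r <= L ->
  group p r x k = \sum_(w <- wordsle tau L | delay tau w == r) wordop p w x k.
Proof.
by move=> rL; symmetry; apply: (sum_wordsle_le tau0_gt0 tau_min) => // w /eqP ->.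
Qed.

Lemma group_L2by p r x C : L2by x C ->
  L2by (group p r x) (K * expR (- ((g + complex.Re p) * r)) * C).
Proof.
move=> hx; pose ws := [seq w <- wordsle tau r | delay tau w == r].
have := @group_bound _ _ _ tau T D T_gt0 F c F_summable F_inversion p x C ws r
  (K * expR (- (g * r))) hx.
rewrite (_ : expR (- (complex.Re p * r)) * _ = K * expR (- ((g + complex.Re p) * r))); last first.
  by rewrite mulrCA -expRD; congr (_ * expR _); ring.
rewrite (_ : (fun l => \sum_(w <- ws) wordop p w x l) = group p r x); last first.
  by apply/funext => l; rewrite big_filter.
apply; first by move=> w; rewrite (mem_filter (fun w => delay tau w == r)) => /andP[/eqP].
by move=> t; rewrite big_filter; exact: decay.
Qed.

Lemma sum_wordop_group p L x k (P : pred R) :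
  \sum_(w <- wordsle tau L | P (delay tau w)) wordop p w x k =
  \sum_(r <- delaysle tau L | P r) group p r x k.
Proof.
rewrite -[LHS]big_filter.
pose f w := if P (delay tau w) then wordop p w x k else 0.
rewrite big_filter big_mkcond (sum_group _ (delay tau)) [RHS]big_mkcond.
rewrite big_seq [RHS]big_seq; apply: eq_bigr => r /(mem_delaysle tau0_gt0 tau_min).
move=> /andP[_ rL]; rewrite (groupE p x k rL).
case: ifP => Pr; first by apply: eq_bigr => w /eqP ->; rewrite Pr.
by rewrite big1 // => w /eqP ->; rewrite Pr.
Qed.

(* Of the rate [g], one half compensates for Re p and one quarter for the number
   of delays; the last quarter is the rate of convergence. *)
Notation g2 := (g / 2).
Notation rho := (expR (- (g / 4))).

(** The sums over all delays in an interval decay exponentially, because their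
    number grows only polynomially. *)
Lemma tail_const : exists2 C1, 0 < C1 & forall p L0 L x C,
  - g2 <= complex.Re p -> 0 <= L -> L2by x C ->
  L2by (fun k => \sum_(w <- wordsle tau L | L0 < delay tau w) wordop p w x k)
       (C1 * expR (g / 4 * L) * expR (- (g2 * L0)) * C).
Proof.
have g40 : 0 < g / 4 by rewrite divr_gt0.
have [C1 C10 hC1] := len_exp_le tau0_gt0 g40; exists (C1 * K); first exact: mulr_gt0.
move=> p L0 L x C hp L_ge0 hx; have C0 := L2by_ge0 hx.
have g20 : 0 < g2 by rewrite divr_gt0.
under eq_fun do rewrite (sum_wordop_group _ _ _ _ (fun r => L0 < r)) -big_filter.
set s := [seq _ <- _ | _].
have e0 : 0 <= K * expR (- (g2 * L0)) * C by rewrite mulr_ge0 // mulr_ge0 ?expR_ge0 // ltW.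
apply: (@L2by_le _ _ _ (\sum_(r <- s) K * expR (- (g2 * L0)) * C)); last first.
  rewrite big_const_seq count_predT iter_addr_0 -[_ *+ size s]mulr_natr.
  have hs : (size s)%:R <= C1 * expR (g / 4 * L).
    apply: le_trans (hC1 _ L_ge0); rewrite ler_nat.
    apply: leq_trans (size_delaysle tau0_gt0 tau_min L).
    by rewrite size_filter count_size.
  apply: le_trans (ler_wpM2l e0 hs) _.
  by rewrite le_eqVlt; apply/orP; left; apply/eqP; ring.
have : forall r, r \in s -> L2by (group p r x) (K * expR (- (g2 * L0)) * C).
  move=> r; rewrite (mem_filter (fun r => L0 < r)) => /andP[L0r rs].
  have /andP[r0 _] := mem_delaysle tau0_gt0 tau_min rs.
  apply: L2by_le (group_L2by p r hx) _; rewrite ler_wpM2r // ler_wpM2l ?(ltW K_gt0) //.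
  rewrite ler_expR lerN2.
  have h1 : g2 * L0 <= g2 * r by rewrite ler_wpM2l // ltW.
  have h2 : g2 * r <= (g + complex.Re p) * r by rewrite ler_wpM2r //; move: hp; lra.
  exact: le_trans h1 h2.
elim: s => [_|r s IH h].
  by under eq_fun do rewrite big_nil; rewrite big_nil; exact: L2by0.
under eq_fun do rewrite big_cons; rewrite big_cons; apply: L2byD.
  by apply: h; rewrite mem_head.
by apply: IH => r' r's; apply: h; rewrite inE r's orbT.
Qed.

Lemma neumann_L2by p L x C : L2by x C -> exists C', L2by (neumann p L x) C'.
Proof.
move=> hx; exists (\sum_(w <- wordsle tau L) wbound tau c p w * C).
by apply: L2by_sum => w; exact: (wordop_L2by tau T F_summable p w hx).
Qed.

Lemma delop0 p j : delop p j (fun=> 0) = fun=> 0.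
Proof.
apply/funext => k.
have -> : delop p j (fun=> 0) k = conv (F j) (twist T p (tau j) (fun=> 0)) k by [].
rewrite /conv (@zsum_supp _ _ [::]) ?big_nil // => l _.
by rewrite /twist scaler0 mulmx0.
Qed.

Lemma delop_sum p j (ws : seq (seq 'I_n.+1)) x C (P : pred (seq 'I_n.+1)) : L2by x C ->
  delop p j (fun k => \sum_(w <- ws | P w) wordop p w x k) =
  (fun k => \sum_(w <- ws | P w) wordop p (j :: w) x k).
Proof.
move=> hx; elim: ws => [|w ws IH].
  under [X in delop p j X]eq_fun do rewrite big_nil.
  under [RHS]eq_fun do rewrite big_nil.
  exact: delop0.
case: (boolP (P w)) => Pw; last first.
  under [X in delop p j X]eq_fun do rewrite big_cons (negbTE Pw).
  by rewrite IH; apply/funext => k; rewrite big_cons (negbTE Pw).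
have [C' hC'] : exists C', L2by (fun k => \sum_(w <- ws | P w) wordop p w x k) C'.
  exists (\sum_(w <- [seq w <- ws | P w]) wbound tau c p w * C).
  under eq_fun do rewrite -big_filter.
  by apply: L2by_sum => w'; exact: (wordop_L2by tau T F_summable p w' hx).
have hw := wordop_L2by tau T F_summable p w hx.
rewrite (_ : (fun k => _) = (fun k => 1 *: wordop p w x k + \sum_(w <- ws | P w) wordop p w x k)).
  rewrite (delop_linear tau T F_summable p j 1 hw hC') IH.
  by apply/funext => k; rewrite scale1r big_cons Pw.
by apply/funext => k; rewrite scale1r big_cons Pw.
Qed.

Lemma harm_neumann p L x C : 0 <= L -> L2by x C ->
  harm p (neumann p L x) = fun k => x k -
    \sum_j \sum_(w <- wordsle tau L | L - tau j < delay tau w) wordop p (j :: w) x k.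
Proof.
move=> L0 hx; apply/funext => k; rewrite /harm.
under eq_bigr do rewrite (delop_sum p _ (wordsle tau L) xpredT hx).
rewrite {1}/neumann (sum_wordsle_cons tau0_gt0 tau_min) //= -addrA -sumrB; congr (_ + _).
rewrite -sumrN; apply: eq_bigr => j _.
have Lj : L - tau j <= L by rewrite gerBl ltW // (tau_gt0 tau0_gt0 tau_min).
by rewrite [X in _ - X](sum_wordsle_split tau0_gt0 tau_min _ Lj) opprD addrA subrr add0r.
Qed.

Lemma wordop_rcons p w j x : wordop p (rcons w j) x = wordop p w (delop p j x).
Proof. by rewrite /wordop -cats1 foldr_cat. Qed.

Lemma wordop_sum p w (f : 'I_n.+1 -> zseq R d) x C (Cf : 'I_n.+1 -> R) :
  L2by x C -> (forall j, L2by (f j) (Cf j)) ->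
  wordop p w (fun k => x k - \sum_j f j k) =
  (fun k => wordop p w x k - \sum_j wordop p w (f j) k).
Proof.
move=> hx hf; elim: (index_enum _) => [|j s IH].
  under [X in wordop p w X]eq_fun do rewrite big_nil subr0.
  by apply/funext => k; rewrite big_nil subr0.
have hs : L2by (fun k => x k - \sum_(j <- s) f j k) (C + \sum_(j <- s) Cf j).
  by apply: L2byB => //; exact: L2by_sum.
have := wordop_linear tau T F_summable p w (-1) (hf j) hs.
rewrite (_ : (fun l => -1 *: f j l + _) = (fun k => x k - \sum_(i <- j :: s) f i k)).
  move=> ->; rewrite IH; apply/funext => k.
  by rewrite scaleN1r big_cons opprD addrCA.
by apply/funext => k; rewrite scaleN1r big_cons opprD addrCA.
Qed.

Lemma neumann_harm p L x C : 0 <= L -> L2by x C ->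
  neumann p L (harm p x) = fun k => x k -
    \sum_j \sum_(w <- wordsle tau L | L - tau j < delay tau w) wordop p w (delop p j x) k.
Proof.
move=> L0 hx; apply/funext => k; rewrite /neumann /harm.
under eq_bigr do rewrite (wordop_sum p _ hx (fun j => delop_L2by tau T F_summable p j hx)).
rewrite sumrB exchange_big /=.
rewrite (sum_wordsle_rcons tau0_gt0 tau_min) //= -addrA -sumrB; congr (_ + _).
rewrite -sumrN; apply: eq_bigr => j _.
have Lj : L - tau j <= L by rewrite gerBl ltW // (tau_gt0 tau0_gt0 tau_min).
rewrite [X in _ - X](sum_wordsle_split tau0_gt0 tau_min _ Lj) opprD addrA.
by under eq_bigr do rewrite wordop_rcons; rewrite subrr add0r.
Qed.

Lemma rho_lt1 : rho < 1.
Proof. by rewrite -expR0 ltr_expR oppr_lt0 divr_gt0. Qed.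

(** All three differences are sums over words whose delay exceeds [m - tN]. *)
Lemma decaying_bound : exists2 C2, 0 < C2 & forall p, - g2 <= complex.Re p ->
  forall x C (m : nat), L2by x C ->
  [/\ L2by (fun k => neumann p m.+1%:R x k - neumann p m%:R x k) (C2 * rho ^+ m * C),
      L2by (fun k => harm p (neumann p m%:R x) k - x k) (C2 * rho ^+ m * C)
    & L2by (fun k => neumann p m%:R (harm p x) k - x k) (C2 * rho ^+ m * C)].
Proof.
have [C1 C10 hC1] := tail_const.
pose A := c * expR (g2 * tN).
have A0 : 0 <= A by rewrite mulr_ge0 ?expR_ge0.
have tau_pos j : 0 < tau j := tau_gt0 tau0_gt0 tau_min j.
have delopA p j y C : - g2 <= complex.Re p -> L2by y C -> L2by (delop p j y) (A * C).
  move=> hp hy; have C0 := L2by_ge0 hy.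
  apply: L2by_le (delop_L2by tau T F_summable p j hy) _.
  rewrite /A -mulrA ler_wpM2l // ler_wpM2r // ler_expR.
  have h1 : - (complex.Re p * tau j) <= g2 * tau j.
    by rewrite -mulNr ler_wpM2r ?(ltW (tau_pos j)) //; move: hp; lra.
  by apply: le_trans h1 _; rewrite ler_wpM2l // ltW // divr_gt0.
pose C2 := C1 * expR (g / 4) + n.+1%:R * (A * (C1 * expR (g2 * tN))).
have rhoE (m : nat) : rho ^+ m = expR (g / 4 * m%:R) * expR (- (g2 * m%:R)).
  rewrite -expRM_natl -expRD; congr expR; have -> : g / 2 = g / 4 + g / 4 by lra.
  by ring.
have An : 0 <= n.+1%:R * (A * (C1 * expR (g2 * tN))).
  by rewrite !mulr_ge0 ?expR_ge0 // ltW.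
exists C2; first by rewrite /C2 ltr_pwDl ?mulr_gt0 ?expR_gt0.
move=> p hp x C m hx; have C0 := L2by_ge0 hx.
have rC0 : 0 <= rho ^+ m * C by rewrite mulr_ge0 // exprn_ge0 ?expR_ge0.
have m0 : 0 <= m%:R :> R by [].
have tailj j y C' : L2by y C' -> 0 <= C' ->
  L2by (fun k => \sum_(w <- wordsle tau m%:R | m%:R - tau j < delay tau w) wordop p w y k)
    (C1 * expR (g2 * tN) * rho ^+ m * C').
  move=> hy C'0; apply: L2by_le (hC1 p (m%:R - tau j) _ _ _ hp m0 hy) _.
  have h : expR (- (g2 * (m%:R - tau j))) <= expR (g2 * tN) * expR (- (g2 * m%:R)).
    rewrite -expRD ler_expR mulrBr opprB lerD2r.
    by rewrite ler_wpM2l // ltW // divr_gt0.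
  rewrite ler_wpM2r // rhoE.
  move: (expR (g2 * tN)) (expR (g / 4 * _)) (expR (- (g2 * m%:R))) h (expR_ge0 (g / 4 * m%:R)).
  move=> a b e h b0; rewrite (_ : C1 * a * (b * e) = C1 * b * (a * e)); last by ring.
  by rewrite ler_wpM2l // mulr_ge0 // ltW.
have sumj : \sum_(j < n.+1) A * (C1 * expR (g2 * tN) * rho ^+ m * C) <= C2 * rho ^+ m * C.
  rewrite sumr_const card_ord -[_ *+ n.+1]mulr_natl /C2 -!mulrA mulrDl.
  rewrite -[leLHS]add0r lerD ?mulr_ge0 ?expR_ge0 ?(ltW C10) //.
  by rewrite le_eqVlt; apply/orP; left; apply/eqP; ring.
split.
- have -> : (fun k => neumann p m.+1%:R x k - neumann p m%:R x k) =
    (fun k => \sum_(w <- wordsle tau m.+1%:R | m%:R < delay tau w) wordop p w x k).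
    apply/funext => k; rewrite /neumann.
    rewrite (sum_wordsle_split tau0_gt0 tau_min (L' := m%:R)) ?ler_nat //.
    by rewrite addrAC subrr add0r.
  apply: L2by_le (hC1 p m%:R m.+1%:R _ _ hp _ hx) _ => //.
  rewrite ler_wpM2r // /C2 rhoE mulrDl -[X in g / 4 * X]natr1 mulrDr mulr1 expRD.
  rewrite -[leLHS]addr0 lerD ?mulr_ge0 ?expR_ge0 ?(ltW C10) //.
  by rewrite le_eqVlt; apply/orP; left; apply/eqP; ring.
- rewrite (harm_neumann p m0 hx).
  under eq_fun do rewrite addrAC subrr add0r; apply: L2byN.
  apply: L2by_le sumj; apply: L2by_sum => j.
  rewrite -(delop_sum p j _ _ hx); apply: delopA => //; exact: tailj.
- rewrite (neumann_harm p m0 hx).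
  under eq_fun do rewrite addrAC subrr add0r; apply: L2byN.
  apply: L2by_le sumj; apply: L2by_sum => j.
  apply: L2by_le (tailj j _ _ (delopA p j x C hp hx) _) _; first exact: mulr_ge0.
  by rewrite le_eqVlt; apply/orP; left; apply/eqP; ring.
Qed.

Lemma harm_L2by p : exists2 B, 0 <= B & forall y C', L2by y C' ->
  L2by (harm p y) (B * C').
Proof.
exists (1 + \sum_j c * expR (- (complex.Re p * tau j))).
  by rewrite addr_ge0 // sumr_ge0 // => j _; rewrite mulr_ge0 ?expR_ge0.
move=> y C' hy; rewrite mulrDl mul1r mulr_suml; apply: L2byB => //.
by apply: L2by_sum => j; rewrite -mulrA; exact: (delop_L2by tau T F_summable p j hy).
Qed.

Lemma harm_linear p x y C C' (a : R[i]) : L2by x C -> L2by y C' ->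
  harm p (fun k => a *: x k + y k) = fun k => a *: harm p x k + harm p y k.
Proof.
move=> hx hy; apply/funext => k.
have hE z : harm p z k = z k - \sum_j delop p j z k by [].
rewrite !hE.
have hj j : delop p j (fun l => a *: x l + y l) k = a *: delop p j x k + delop p j y k.
  by rewrite (delop_linear tau T F_summable p j a hx hy).
have e : \sum_j delop p j (fun l => a *: x l + y l) k =
    a *: (\sum_j delop p j x k) + \sum_j delop p j y k.
  by rewrite scaler_sumr -big_split; apply: eq_bigr => j _; exact: hj.
rewrite scalerBr addrACA -opprD; exact: (congr1 (fun z => _ - z) e).
Qed.

Lemma harmB p x y C C' : L2by x C -> L2by y C' ->
  harm p (fun k => x k - y k) = fun k => harm p x k - harm p y k.
Proof.
move=> hx hy; have := harm_linear p (-1) hy hx.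
rewrite (_ : (fun k => -1 *: y k + x k) = (fun k => x k - y k)) => [->|].
  by apply/funext => k; rewrite scaleN1r addrC.
by apply/funext => k; rewrite scaleN1r addrC.
Qed.

Lemma geometric_small (r A e : R) : 0 < r -> r < 1 -> 0 < e -> exists m, A * r ^+ m <= e.
Proof.
move=> r0 r1 e0; have r'1 : 1 < r^-1 by rewrite invf_gt1.
have [m hm] := expr_unbounded (A / e) r'1; exists m.
move: hm; rewrite exprVn ltr_pdivrMr // mulrC ltr_pdivlMr ?exprn_gt0 //.
exact: ltW.
Qed.

Lemma geometric_sum (r b : R) m N : 0 < r -> r < 1 -> 0 <= b ->
  \sum_(m <= j < N) b * r ^+ j <= b / (1 - r) * r ^+ m.
Proof.
move=> r0 r1 b0; have r10 : 0 < 1 - r by rewrite subr_gt0.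
have p0 : 0 <= b / (1 - r) by rewrite divr_ge0 // ltW.
have [Nm|mN] := leqP N m.
  by rewrite big_geq // mulr_ge0 // exprn_ge0 // ltW.
rewrite -(subnK (ltnW mN)); elim: (N - m)%N => [|k IH].
  by rewrite big_geq // mulr_ge0 // exprn_ge0 // ltW.
suff -> : \sum_(m <= j < k.+1 + m) b * r ^+ j = b / (1 - r) * (r ^+ m - r ^+ (k.+1 + m)).
  by rewrite ler_wpM2l // gerBl exprn_ge0 // ltW.
elim: k {IH} => [|k IH].
  by rewrite big_nat1 add1n exprS; field; rewrite gt_eqF.
rewrite addSn big_nat_recr ?leq_addl //= IH !exprS.
by field; rewrite gt_eqF.
Qed.

Lemma L2by_eq0 x (A : R) : (forall m : nat, L2by x (A * rho ^+ m)) -> x = fun=> 0.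
Proof.
move=> h; apply/funext => k; apply/enorm_eq0/ler_addgt0Pl => e e0.
have [m hm] := geometric_small A (expR_gt0 _) rho_lt1 e0.
by rewrite addr0 (le_trans (L2by_pt k (h m))).
Qed.

(** The inverse is the sum of the Neumann series in the order of [neumann]. *)
Lemma harm_inverse : exists2 M, 0 < M & forall p, - g2 <= complex.Re p ->
  exists B : zseq R d -> zseq R d,
  [/\ forall x C, L2by x C -> L2by (B x) (M * C),
      forall x C, L2by x C -> harm p (B x) = x
    & forall x C, L2by x C -> B (harm p x) = x].
Proof.
have [C2 C20 hC2] := decaying_bound; have rho0 : 0 < rho by exact: expR_gt0.
have r10 : 0 < 1 - rho by rewrite subr_gt0 rho_lt1.
pose M' := C2 / (1 - rho); have M'0 : 0 < M' by rewrite divr_gt0.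
exists (1 + M') => [|p hp]; first by rewrite addr_gt0.
pose B x : zseq R d := fun k => mxlim (fun m : nat => neumann p m%:R x k).
have hB x C m : L2by x C -> L2by (fun k => B x k - neumann p m%:R x k) (M' * C * rho ^+ m).
  move=> hx; have C0 := L2by_ge0 hx; have CC0 : 0 <= C2 * C by rewrite mulr_ge0 // ltW.
  have E : M' * C = C2 * C / (1 - rho) by rewrite /M' mulrAC.
  have hb j : L2by (fun k => neumann p j.+1%:R x k - neumann p j%:R x k) (C2 * C * rho ^+ j).
    by have [h _ _] := hC2 p hp x C j hx; apply: L2by_le h _; rewrite mulrAC.
  rewrite E; apply: (L2by_complete (x_ := fun j => neumann p j%:R x) hb) => [N|N].
    by rewrite -(big_mkord xpredT (fun j => C2 * C * rho ^+ j)); exact: geometric_sum rho_lt1 CC0.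
  exact: geometric_sum rho_lt1 CC0.
have n0 x : neumann p 0 x = x.
  apply/funext => k; rewrite /neumann (sum_wordsle_cons tau0_gt0 tau_min) //=.
  rewrite big1 ?addr0 // => j _.
  by rewrite (wordsle_lt0 tau0_gt0 tau_min) ?big_nil // sub0r oppr_lt0 (tau_gt0 tau0_gt0 tau_min).
have B_L2by x C : L2by x C -> L2by (B x) ((1 + M') * C).
  move=> hx; have := L2byD (hB x C 0%N hx) hx; rewrite expr0 mulr1 mulrDl mul1r addrC.
  by rewrite n0; congr L2by; apply/funext => k; rewrite subrK.
exists B; split => // x C hx.
- have [Q Q0 hQ] := harm_L2by p.
  suff : (fun k => harm p (B x) k - x k) = fun=> 0.
    by move=> e; apply/funext => k; apply/eqP; rewrite -subr_eq0; apply/eqP/(congr1 (fun f => f k) e).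
  apply: (@L2by_eq0 _ (Q * (M' * C) + C2 * C)) => m.
  have [_ h2 _] := hC2 p hp x C m hx.
  have [Cm hm] := neumann_L2by p m%:R hx.
  have := L2byD (hQ _ _ (hB x C m hx)) h2.
  rewrite (harmB p (B_L2by x C hx) hm).
  by congr L2by; [apply/funext => k; rewrite subrKA | ring].
- have [Q Q0 hQ] := harm_L2by p; have hy := hQ _ _ hx.
  suff : (fun k => B (harm p x) k - x k) = fun=> 0.
    by move=> e; apply/funext => k; apply/eqP; rewrite -subr_eq0; apply/eqP/(congr1 (fun f => f k) e).
  apply: (@L2by_eq0 _ (M' * (Q * C) + C2 * C)) => m.
  have [_ _ h3] := hC2 p hp x C m hx.
  have := L2byD (hB _ _ m hy) h3.
  by congr L2by; [apply/funext => k; rewrite subrKA | ring].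
Qed.

End Inverse.

(** * Stability from decay of the fundamental solution *)

Section StableOfDecay.
Variables (R : realType) (d n : nat).
Variables (tau : 'I_n.+1 -> R) (D : 'I_n.+1 -> R -> 'M[R[i]]_d).
Hypothesis tau0_gt0 : 0 < tau ord0.
Hypothesis tau_min : forall j, tau ord0 <= tau j.
Hypothesis tau_max : forall j, tau j <= tau ord_max.
Variable c : R.
Hypothesis D_bounded : forall j t, enorm (D j t) <= c.
Notation tN := (tau ord_max).

(** A solution, continued by zero to the left, is the response of the system to a
    source supported in the initial interval. *)
Lemma C0_stable_of_decay : fund_decay tau D -> C0_exponentially_stable tau D.
Proof.
case=> g [K [g0 K0 hX]].
have c0 : 0 <= c by exact: le_trans (enorm_ge0 _) (D_bounded ord0 0).
have tN0 : 0 < tN by exact: tau_gt0.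
(* Half of the rate of decay pays for the number of delays. *)
have g20 : 0 < g / 2 by rewrite divr_gt0.
have [C1 C10 hC1] := len_exp_le tau0_gt0 g20.
pose N1 := 1 + n.+1%:R * c.
have N10 : 0 < N1 by rewrite ltr_pwDl // mulr_ge0.
pose K1 := C1 * (K * N1) * expR (g / 2 * tN).
have K10 : 0 < K1 by rewrite mulr_gt0 ?expR_gt0 // mulr_gt0 // mulr_gt0.
pose K2 := K1 * expR (g / 2 * tN).
have K20 : 0 < K2 by rewrite mulr_gt0 ?expR_gt0.
exists (g / 2), K2; split => // s phi y _ [_ y_phi y_eq] t st.
have phi_le th : - tN <= th <= 0 -> ((enorm (phi th))%:E <= C0_norm tau phi)%E.
  by move=> h; apply: ereal_sup_ubound; exists th => //=; rewrite in_itv.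
have phi0 : (0 <= C0_norm tau phi)%E.
  apply: le_trans (phi_le 0 _); first by rewrite lee_fin enorm_ge0.
  by rewrite lexx oppr_le0 ltW.
have e0 : 0 < K2 * expR (- (g / 2) * (t - s)) by rewrite mulr_gt0 ?expR_gt0.
case E: (C0_norm tau phi) phi0 phi_le => [Phi| |] //; last first.
  by move=> _ _; rewrite gt0_muley ?lte_fin // leey.
rewrite lee_fin => Phi0 phi_le.
have {}phi_le th : - tN <= th <= 0 -> enorm (phi th) <= Phi.
  by move=> /phi_le; rewrite lee_fin.
pose a := s - tN.
pose z r := if r < a then 0 else y r.
pose f r := if r < a then 0 else z r - \sum_j D j r *m z (r - tau j).
have z_le r : r <= s -> enorm (z r) <= Phi.
  move=> rs; rewrite /z; case: ltP => [_|ar]; first by rewrite enorm0.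
  have h : - tN <= r - s <= 0 by apply/andP; split; move: ar rs; rewrite /a; lra.
  have -> : y r = phi (r - s) by rewrite -(y_phi (r - s) h) addrC subrK.
  exact: phi_le.
have f_le r : enorm (f r) <= N1 * Phi /\ (s < r -> f r = 0).
  rewrite /f; case: ltP => [_|ar]; first by rewrite enorm0 mulr_ge0 // ltW.
  have f0 : s < r -> z r - \sum_j D j r *m z (r - tau j) = 0.
    move=> sr; rewrite /z ltNge ar /= y_eq // /delayed_sum; apply/eqP; rewrite subr_eq0; apply/eqP.
    by apply: eq_bigr => j _; rewrite ifF // /a; apply/negbTE; rewrite -leNgt;
      move: sr (tau_max j); lra.
  have [rs|sr] := leP r s; split => //.
  - rewrite (le_trans (enormB _ _)) // /N1 mulrDl mul1r lerD ?z_le //.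
    apply: le_trans (enorm_sum _ _ _) _.
    rewrite -mulrA mulr_natl -[n.+1 in leRHS]card_ord -sumr_const.
    apply: ler_sum => j _; apply: le_trans (enormM _ _) _.
    rewrite ler_pM ?enorm_ge0 // z_le // (le_trans _ rs) // gerBl ltW //.
    exact: (tau_gt0 tau0_gt0 tau_min).
  - by rewrite f0 // enorm0 mulr_ge0 // ltW.
  - by move=> _; exact: f0.
have zE : forall r, z r = causal tau D a f r.
  apply: (causal_unique tau0_gt0 tau_min) => r ra; first by rewrite /z ra.
  by rewrite /f ltNge ra /= subrK.
have y_le r : a <= r -> enorm (y r) <= K1 * expR (- (g / 2 * (r - s))) * Phi.
  move=> ar; have -> : y r = z r by rewrite /z ltNge ar.
  rewrite zE /causal (sum_wordsle_fund tau0_gt0 tau_min D (r - a) r (fun x => f (r - x))).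
  apply: le_trans (enorm_sum _ _ _) _.
  apply: (@le_trans _ _ (\sum_(x <- delaysle tau (r - a)) K * expR (- (g * (r - s))) * (N1 * Phi))).
    apply: ler_sum => x _; have [h1 h2] := f_le (r - x).
    have [rx|rx] := leP (r - x) s; last first.
      by rewrite h2 // mulmx0 enorm0 !mulr_ge0 ?expR_ge0 // ltW.
    rewrite (le_trans (enormM _ _)) // ler_pM ?enorm_ge0 //.
    apply: le_trans (hX x r) _; rewrite ler_wpM2l ?(ltW K0) // ler_expR lerN2.
    by rewrite ler_wpM2l ?(ltW g0) //; move: rx; lra.
  rewrite big_const_seq count_predT iter_addr_0 -[_ *+ size _]mulr_natl.
  have ra0 : 0 <= r - a by rewrite subr_ge0.
  have hs : (size (delaysle tau (r - a)))%:R <= C1 * expR (g / 2 * (r - a)).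
    apply: le_trans (hC1 _ ra0); rewrite ler_nat; exact: (size_delaysle tau0_gt0 tau_min).
  have u0 : 0 <= K * expR (- (g * (r - s))) * (N1 * Phi) by rewrite !mulr_ge0 ?expR_ge0 // ltW.
  apply: le_trans (ler_wpM2r u0 hs) _; rewrite /K1.
  have -> : expR (g / 2 * (r - a)) = expR (g / 2 * tN) * expR (g / 2 * (r - s)).
    by rewrite -expRD; congr expR; rewrite /a; ring.
  have -> : expR (- (g * (r - s))) = expR (- (g / 2 * (r - s))) * expR (- (g / 2 * (r - s))).
    by rewrite -expRD; congr expR; rewrite [in LHS](splitr g); ring.
  have : expR (g / 2 * (r - s)) * expR (- (g / 2 * (r - s))) = 1.
    by rewrite -expRD subrr expR0.
  move: (expR (g / 2 * tN)) (expR (g / 2 * (r - s))) (expR (- (g / 2 * (r - s)))) => u v w vw.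
  rewrite le_eqVlt; apply/orP; left; apply/eqP.
  transitivity (C1 * (K * N1) * u * w * Phi * (v * w)); [ring|by rewrite vw mulr1].
rewrite /C0_norm; apply: ge_ereal_sup => x [th]; rewrite /= in_itv /= => /andP[th1 th2] <-.
rewrite /shift -EFinM lee_fin.
apply: le_trans (y_le (t + th) _) _; first by rewrite /a; move: th1 st; rewrite /tauN; lra.
rewrite ler_wpM2r // /K2 -[leRHS]mulrA ler_wpM2l ?(ltW K10) // -expRD ler_expR.
have : g / 2 * (- tN) <= g / 2 * th by rewrite ler_wpM2l // ltW.
by move: th1; lra.
Qed.

End StableOfDecay.

(** * Norms of functions comparable to a step function *)

Section StepNorms.
Variable R : realType.
Notation mu := (@lebesgue_measure R).
Local Open Scope ereal_scope.

Definition step (c a l : R) : R -> \bar R := (fun=> c%:E) \_ `[a, (a + l)%R].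

(** The [L^q] norm of the indicator function of an interval of length [l]. *)
Definition unit_norm (q : \bar R) (l : R) : R := if q is r%:E then (l `^ r^-1)%R else 1%R.

Lemma unit_norm_gt0 q l : (0 < l)%R -> (0 < unit_norm q l)%R.
Proof. by case: q => [r||] l0 //=; rewrite powR_gt0. Qed.

(** The factor does not depend on [l]: this lets the width of the test functions
    tend to zero. *)
Lemma unit_norm_double q l : 1 <= q -> (0 < l)%R ->
  (unit_norm q (2 * l) <= 2 * unit_norm q l)%R.
Proof.
case: q => [r||] //= r1 l0; last by rewrite mulr1 ler1n.
rewrite lee_fin in r1; have r0 : (0 < r)%R by rewrite (lt_le_trans _ r1).
rewrite powRM ?(ltW l0) // ler_wpM2r ?powR_ge0 //.
rewrite -[leRHS]powRr1 // ler_powR ?ler1n //.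
by rewrite invf_le1.
Qed.

Lemma measurable_step c a l : measurable_fun [set: R] (step c a l).
Proof. by apply/(measurable_restrictT _ (measurable_itv _)); exact: measurable_cst. Qed.

Lemma mu_itv (a l : R) : (0 < l)%R -> mu `[a, (a + l)%R] = l%:E.
Proof.
move=> l0; rewrite lebesgue_measure_itv /= lte_fin ltrDl l0 -EFinD.
by rewrite addrAC subrr add0r.
Qed.

Lemma Lnorm_step q c a l : 1 <= q -> (0 <= c)%R -> (0 < l)%R ->
  'N[mu]_q[step c a l] = (c * unit_norm q l)%:E.
Proof.
case: q => [r||] //= r1 c0 l0.
- rewrite lee_fin in r1; have r0 : (0 < r)%R by rewrite (lt_le_trans _ r1).
  rewrite unlock.
  have -> : (fun x => `|step c a l x| `^ r) = (fun=> (c `^ r)%:E) \_ `[a, (a + l)%R].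
    apply/funext => x; rewrite /step !patchE; case: ifP => _.
      by rewrite gee0_abs ?lee_fin // poweR_EFin.
    by rewrite abse0 poweR0r // gt_eqF.
  rewrite -integral_mkcond (@integral_cst _ _ _ mu) ?measurable_itv //.
  transitivity (((c `^ r)%:E * l%:E) `^ r^-1).
    by congr ((_ * _) `^ _); exact: mu_itv.
  rewrite -EFinM.
  rewrite poweR_EFin powRM ?powR_ge0 ?(ltW l0) // -powRrM divff ?gt_eqF //.
  by rewrite powRr1.
- rewrite unlock mulr1.
  have mu0 : 0 < mu [set: R].
    apply: (@lt_le_trans _ _ (mu `[0%R, (0 + 1)%R])); first by rewrite mu_itv ?lte_fin.
    by apply: le_measure; rewrite ?inE.
  rewrite mu0; apply/eqP; rewrite eq_le; apply/andP; split.
    apply/ess_supP/nearW => x /=; rewrite /step patchE; case: ifP => _.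
      by rewrite gee0_abs ?lee_fin.
    by rewrite abse0 lee_fin.
  rewrite leNgt; apply/negP => h.
  have := ess_sup_ge mu (abse \o step c a l); move=> [N [mN N0 hN]].
  have : mu `[a, (a + l)%R] <= mu N.
    apply: le_measure; rewrite ?inE //.
    move=> x xI; apply: hN => /=; apply/negP; rewrite -ltNge.
    apply: lt_le_trans h _; rewrite /step patchE mem_set //.
    by rewrite gee0_abs ?lee_fin.
  by rewrite N0 mu_itv // lee_fin leNgt l0.
Qed.

Lemma Lnorm_le q (f g : R -> \bar R) : 1 <= q ->
  measurable_fun [set: R] f -> measurable_fun [set: R] g ->
  (forall x, 0 <= f x <= g x) -> 'N[mu]_q[f] <= 'N[mu]_q[g].
Proof.
move=> q1 mf mg fg; rewrite unlock; case: q q1 => [r||] //= r1.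
- rewrite lee_fin in r1; have r0 : (0 < r)%R by rewrite (lt_le_trans _ r1).
  have mpow (h : R -> \bar R) : measurable_fun [set: R] h ->
      measurable_fun [set: R] (fun x => `|h x| `^ r).
    move=> mh; apply: (@measurableT_comp _ _ _ _ _ _ (fun x : \bar R => x `^ r)) => //=.
      exact: measurable_poweR.
    exact: measurableT_comp.
  apply: gt0_ler_poweR; rewrite ?invr_ge0 ?(ltW r0) //; last first.
    apply: ge0_le_integral => //; try exact: mpow; try by move=> x _; exact: poweR_ge0.
    move=> x _; have /andP[f0 fgx] := fg x; apply: gt0_ler_poweR; rewrite ?(ltW r0) //.
    - by rewrite in_itv /= leey abse_ge0.
    - by rewrite in_itv /= leey abse_ge0.
    by rewrite !gee0_abs // (le_trans f0).
  - by rewrite in_itv /= leey andbT; apply: integral_ge0 => x _; exact: poweR_ge0.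
  - by rewrite in_itv /= leey andbT; apply: integral_ge0 => x _; exact: poweR_ge0.
- case: ifP => // _; apply: le_ess_sup; apply/nearW => x /=.
  by have /andP[f0 fgx] := fg x; rewrite !gee0_abs // (le_trans f0).
Qed.

Local Close Scope ereal_scope.

Section Vectors.
Variable d : nat.
Implicit Types (f : R -> 'cV[R[i]]_d).

Definition part_continuous m n (f : R -> 'M[R[i]]_(m, n)) :=
  forall q, continuous (fun t => part (f t) q : R).

Lemma continuous_sum (I : Type) (s : seq I) (h : I -> R -> R) :
  (forall i, continuous (h i)) -> continuous (fun t => \sum_(i <- s) h i t : R).
Proof.
move=> hc; elim: s => [|i s IH] t.
  rewrite (_ : (fun t => _) = fun=> 0); first exact: cvg_cst.
  by apply/funext => u; rewrite big_nil.
rewrite (_ : (fun t => _) = (fun t => h i t + \sum_(i <- s) h i t)).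
  by apply: cvgD; [exact: hc|exact: IH].
by apply/funext => u; rewrite big_cons.
Qed.

Lemma continuous_enorm m n (f : R -> 'M[R[i]]_(m, n)) :
  part_continuous f -> continuous (fun t => enorm (f t) : R).
Proof.
move=> hf; rewrite (_ : (fun t => _) = (fun t => Num.sqrt (\sum_q part (f t) q ^+ 2))).
  move=> t; apply: continuous_comp; last exact: sqrt_continuous.
  by apply: continuous_sum => q u; apply: cvgM; exact: hf.
by apply/funext => t; rewrite enormE.
Qed.

Lemma measurable_enorm f a b : part_continuous f ->
  measurable_fun [set: R] ((fun t => (enorm (f t))%:E) \_ `[a, b]).
Proof.
move=> hf; apply/(measurable_restrictT _ (measurable_itv _)).
apply/measurable_EFinP; apply: measurable_funTS.
by apply: continuous_measurable_fun; exact: continuous_enorm.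
Qed.

Lemma Lq_norm_le_step q a b p l f c : (1 <= q)%E -> part_continuous f -> 0 <= c -> 0 < l ->
  (forall t, a <= t <= b -> enorm (f t) <= if p <= t <= p + l then c else 0) ->
  (Lq_norm q a b f <= (c * unit_norm q l)%:E)%E.
Proof.
move=> q1 hf c0 l0 h; rewrite -(@Lnorm_step q c p l) //.
apply: Lnorm_le => //; [exact: measurable_enorm|exact: measurable_step|].
move=> t; rewrite /step !patchE; case: ifPn => [/set_mem|_]; last first.
  by rewrite lexx /=; case: ifP; rewrite lee_fin.
rewrite /= in_itv /= => ht; rewrite lee_fin enorm_ge0 /=.
have := h t ht; case: ifPn => ht'.
  by rewrite mem_set ?lee_fin // /= in_itv.
by rewrite memNset ?lee_fin // /= in_itv /=; exact/negP.
Qed.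

Lemma Lq_norm_ge_step q a b p l f c : (1 <= q)%E -> part_continuous f -> 0 <= c -> 0 < l ->
  a <= p -> p + l <= b ->
  (forall t, p <= t <= p + l -> c <= enorm (f t)) ->
  ((c * unit_norm q l)%:E <= Lq_norm q a b f)%E.
Proof.
move=> q1 hf c0 l0 ap plb h; rewrite -(@Lnorm_step q c p l) //.
apply: Lnorm_le => //; [exact: measurable_step|exact: measurable_enorm|].
move=> t; rewrite /step !patchE; case: ifPn => [/set_mem|_]; last first.
  by rewrite lexx /=; case: ifP; rewrite lee_fin // enorm_ge0.
rewrite /= in_itv /= => ht; rewrite mem_set; first by rewrite !lee_fin c0 h.
by rewrite /= in_itv /=; move: ht => /andP[h1 h2]; apply/andP; split; lra.
Qed.

Lemma in_Lq_continuous q a b f : (1 <= q)%E -> part_continuous f -> in_Lq q a b f.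
Proof.
move=> q1 hf; split.
  move=> i j; split; apply: measurable_funTS; apply: continuous_measurable_fun.
    exact: (hf (i, j, true)).
  exact: (hf (i, j, false)).
pose l := Num.max (b - a) 0 + 1.
have l0 : 0 < l by rewrite ltr_pwDr // le_max lexx orbT.
have [c c0 hc] : exists2 c, 0 <= c & forall t, a <= t <= b -> enorm (f t) <= c.
  have [ab|ba] := leP a b; last by exists 0 => // t /andP[h1 h2]; move: ba h1 h2; lra.
  have [|t _ ht] := @EVT_max R (fun t => enorm (f t)) a b ab.
    by apply: continuous_subspaceT; exact: continuous_enorm.
  by exists (enorm (f t)) => [|s sI]; [exact: enorm_ge0|apply: ht; rewrite in_itv].
apply: le_lt_trans (@Lq_norm_le_step q a b a l f c q1 hf c0 l0 _) _; last exact: ltry.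
move=> t ht; rewrite ifT ?hc //; case/andP: ht => h1 h2; rewrite h1 /=.
have : b - a <= Num.max (b - a) 0 by rewrite le_max lexx.
by rewrite /l; lra.
Qed.

End Vectors.
End StepNorms.

(** * Decay of the fundamental solution from stability *)

Section DecayOfStable.
Variables (R : realType) (d n : nat).
Variables (tau : 'I_n.+1 -> R) (D : 'I_n.+1 -> R -> 'M[R[i]]_d).
Hypothesis tau0_gt0 : 0 < tau ord0.
Hypothesis tau_min : forall j, tau ord0 <= tau j.
Hypothesis tau_max : forall j, tau j <= tau ord_max.
Hypothesis D_cont : forall j, part_continuous (D j).
Notation tN := (tau ord_max).
Notation t1 := (tau ord0).

Lemma part_mulmx m k p (A : 'M[R[i]]_(m, k)) (B : 'M[R[i]]_(k, p)) i j b :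
  part (A *m B) (i, j, b) = \sum_l
    if b then part A (i, l, true) * part B (l, j, true) -
              part A (i, l, false) * part B (l, j, false)
    else part A (i, l, true) * part B (l, j, false) +
         part A (i, l, false) * part B (l, j, true).
Proof.
rewrite /part /= mxE; case: b; rewrite raddf_sum; apply: eq_bigr => l _ /=.
  by case: (A i l) (B l j) => a b [a' b'].
by case: (A i l) (B l j) => a b [a' b'].
Qed.

Lemma part_continuous_mulmx m k p (A : R -> 'M[R[i]]_(m, k)) (B : R -> 'M[R[i]]_(k, p)) :
  part_continuous A -> part_continuous B -> part_continuous (fun t => A t *m B t).
Proof.
move=> hA hB [[i j] b]; under eq_fun do rewrite part_mulmx.
apply: continuous_sum => l t; case: b.
  by apply: cvgB; apply: cvgM; [exact: hA|exact: hB|exact: hA|exact: hB].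
by apply: cvgD; apply: cvgM; [exact: hA|exact: hB|exact: hA|exact: hB].
Qed.

Lemma part_continuous_sum m k (I : Type) (s : seq I) (F : I -> R -> 'M[R[i]]_(m, k)) :
  (forall i, part_continuous (F i)) -> part_continuous (fun t => \sum_(i <- s) F i t).
Proof.
move=> hF q; rewrite (_ : (fun t => _) = (fun t => \sum_(i <- s) part (F i t) q)).
  by apply: continuous_sum => i; exact: hF.
apply/funext => t; elim: s => [|i s IH]; first by rewrite !big_nil part0.
by rewrite !big_cons partD IH.
Qed.

Lemma continuous_shift (h : R -> R) a : continuous h -> continuous (fun t => h (t + a)).
Proof.
move=> hc t; apply: (@continuous_comp _ _ _ (fun t => t + a) h); last exact: hc.
by apply: cvgD; [exact: cvg_id|exact: cvg_cst].
Qed.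

Lemma part_continuous_shift m k (F : R -> 'M[R[i]]_(m, k)) a :
  part_continuous F -> part_continuous (fun t => F (t + a)).
Proof. by move=> hF q; apply: (continuous_shift (h := fun t => part (F t) q)). Qed.

Lemma part_continuous_wcoef w : part_continuous (wcoef tau D w).
Proof.
elim: w => [|j w IH] /=; first by move=> q t; exact: cvg_cst.
by apply: part_continuous_mulmx => //; exact: part_continuous_shift.
Qed.

Lemma part_continuous_fund x : part_continuous (fund tau D x).
Proof.
rewrite (_ : fund tau D x = fun t => \sum_(w <- [seq w <- wordsle tau x | delay tau w == x])
  wcoef tau D w t).
  by apply: part_continuous_sum => w; exact: part_continuous_wcoef.
by apply/funext => t; rewrite big_filter.
Qed.

Lemma causalE m a L (f : R -> 'M[R[i]]_(d, m)) t : t - a <= L ->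
  (forall r, r < a -> f r = 0) ->
  causal tau D a f t = \sum_(w <- wordsle tau L) wcoef tau D w t *m f (t - delay tau w).
Proof.
move=> tL f0; rewrite (sum_wordsle_split tau0_gt0 tau_min _ tL) -[LHS]addr0; congr (_ + _).
symmetry; apply: big1 => w hw; rewrite f0 ?mulmx0 //; move: hw; lra.
Qed.

(** Up to time [t + 1] the same finite set of words serves all times. *)
Lemma part_continuous_causal m a (f : R -> 'M[R[i]]_(d, m)) :
  (forall r, r < a -> f r = 0) -> part_continuous f -> part_continuous (causal tau D a f).
Proof.
move=> f0 hf q t; pose L := t - a + 1.
pose G u := part (\sum_(w <- wordsle tau L) wcoef tau D w u *m f (u - delay tau w)) q.
have hG : continuous G.
  suff : part_continuous (fun u => \sum_(w <- wordsle tau L)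
      wcoef tau D w u *m f (u - delay tau w)) by move=> /(_ q).
  apply: part_continuous_sum => w; apply: part_continuous_mulmx.
    exact: part_continuous_wcoef.
  exact: part_continuous_shift.
have GE u : u <= t + 1 -> part (causal tau D a f u) q = G u.
  by move=> ut; rewrite /G (causalE (L := L)) // /L; move: ut; lra.
rewrite /continuous_at GE ?lerDl //; have := hG t; apply: cvg_trans.
apply: near_eq_cvg; have : t < t + 1 by rewrite ltrDl.
by move/lt_nbhsl; apply: filterS => u /ltW /GE.
Qed.

(** The tent function on [-1, 1]. *)
Definition hat (x : R) : R := (1 - `|x| + `|1 - `|x| |) / 2.

Lemma hat_out x : 1 <= `|x| -> hat x = 0.
Proof. by move=> h; rewrite /hat (@ler0_norm _ (1 - _)) ?subr_le0 // subrr mul0r. Qed.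

Lemma hat_in x : `|x| <= 1 -> hat x = 1 - `|x|.
Proof. by move=> h; rewrite /hat (@ger0_norm _ (1 - _)) ?subr_ge0 //; lra. Qed.

Lemma hat_bounds x : 0 <= hat x <= 1.
Proof.
have [h|h] := leP `|x| 1; first by rewrite hat_in // subr_ge0 h gerBl normr_ge0.
by rewrite hat_out ?lexx ?ler01 // ltW.
Qed.

Lemma continuous_hat : continuous hat.
Proof.
have h1 : continuous (fun x : R => 1 - `|x|).
  by move=> x; apply: cvgB; [exact: cvg_cst|exact: norm_continuous].
move=> x; apply: cvgM; last exact: cvg_cst.
apply: cvgD; first exact: h1.
by apply: cvg_norm; exact: h1.
Qed.

Lemma gap (s : seq R) (x : R) : exists2 e, 0 < e & forall r, r \in s -> `|r - x| < e -> r = x.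
Proof.
elim: s => [|r s [e e0 he]]; first by exists 1.
have [->|rx] := eqVneq r x.
  by exists e => // r'; rewrite inE => /orP[/eqP ->|/he].
exists (Num.min e `|r - x|); first by rewrite lt_min e0 normr_gt0 subr_eq0.
move=> r'; rewrite inE lt_min => /orP[/eqP ->|/he h] /andP[h1 h2]; last exact: h.
by rewrite ltxx in h2.
Qed.

Section Bump.
Variables (t0 x eta : R) (v : 'cV[R[i]]_d).
Hypothesis eta_gt0 : 0 < eta.

Let A := enorm (fund tau D x (t0 + x) *m v).

(** The solution for a narrow tent as initial value: at time [t0 + x] the delays
    other than [x] see values of the source outside the tent, so only the
    coefficient [fund x] shows. *)
Lemma bump_solution : exists e y, [/\ 0 < e, e <= t1 / 4, part_continuous y,
  (forall t, t <= t0 + t1 / 2 -> y t = Complex (hat ((t - t0) / e)) 0 *: v) /\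
  (forall t, t0 + t1 / 2 < t -> y t = delayed_sum tau D y t)
  & forall h, `|h| <= e -> hat (h / e) * (A - eta) <= enorm (y (t0 + x + h))].
Proof.
pose N h := enorm (fund tau D x (t0 + x + h) *m v).
have Ncont : {for 0, continuous (N : R -> R)}.
  have : continuous (fun t => enorm (fund tau D x (t + (t0 + x)) *m v)).
    apply: continuous_enorm; apply: part_continuous_mulmx.
      exact/part_continuous_shift/part_continuous_fund.
    by move=> q t; exact: cvg_cst.
  have -> : N = fun t => enorm (fund tau D x (t + (t0 + x)) *m v).
    by apply/funext => t; rewrite /N [t + _]addrC.
  exact.
have [del del0 hdel] : exists2 del, 0 < del & forall h, `|h| < del -> A - eta <= N h.
  move: Ncont => /cvgrPdist_le /(_ eta eta_gt0) /nbhs_ballP[del /= del0 hdel].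
  exists del => // h hh; have : ball (0 : R) del h by rewrite /ball /= sub0r normrN.
  move=> /hdel /=; rewrite {1}/N addr0 -/A => h1.
  by have := le_trans (ler_norm _) h1; lra.
have [gp gp0 hgp] := gap (delaysle tau (x + t1)) x.
(* Within [e] of [t0 + x] the coefficient [fund x] varies by at most [eta], and
   the tents shifted by delays other than [x] are not seen. *)
pose e := Num.min (t1 / 4) (Num.min (del / 2) (gp / 2)).
have e0 : 0 < e by rewrite !lt_min !divr_gt0.
have e1 : e <= t1 / 4 by rewrite ge_min lexx.
have e2 : e <= del / 2 by rewrite !ge_min lexx orbT.
have e3 : e <= gp / 2 by rewrite !ge_min lexx !orbT.
pose f t : 'cV[R[i]]_d := Complex (hat ((t - t0) / e)) 0 *: v.
have f_out t : e <= `|t - t0| -> f t = 0.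
  move=> h; rewrite /f hat_out ?scale0r //.
  by rewrite normrM normfV (ger0_norm (ltW e0)) ler_pdivlMr // mul1r.
have fa r : r < t0 - e -> f r = 0.
  by move=> h; apply: f_out; rewrite distrC ger0_norm; move: h e0; lra.
have fcont : part_continuous f.
  move=> q; rewrite (_ : (fun t => _) = (fun t => hat ((t - t0) / e) * part v q)).
    move=> t; apply: cvgM; last exact: cvg_cst.
    apply: (@continuous_comp _ _ _ (fun t => (t - t0) / e) hat); last exact: continuous_hat.
    by apply: cvgM; [apply: cvgB; [exact: cvg_id|exact: cvg_cst]|exact: cvg_cst].
  apply/funext => t; case: q => -[i j] []; rewrite /part /f /= mxE;
    by case: (v i j) => a b /=; ring.
pose y := causal tau D (t0 - e) f; exists e, y; split => //.
- exact: part_continuous_causal.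
- have y_early t : t <= t0 + t1 / 2 -> y t = f t.
    move=> ht; have [ta|at_] := ltP t (t0 - e).
      by rewrite fa // /y causal_lt.
    rewrite /y (causal_eq tau0_gt0 tau_min) // big1 ?addr0 // => j _.
    by rewrite causal_lt ?mulmx0 //; move: ht e0 e1 (tau_min j); lra.
  split=> // t ht; rewrite /y (causal_eq tau0_gt0 tau_min); last by move: ht e0 e1 tau0_gt0; lra.
  by rewrite f_out ?add0r // ger0_norm; move: ht e1 tau0_gt0; lra.
move=> h hh; rewrite /y (causalE (L := x + t1)) //; last first.
  by move: (le_trans (ler_norm h) hh) e1 tau0_gt0; lra.
have -> : \sum_(w <- wordsle tau (x + t1)) wcoef tau D w (t0 + x + h) *m
     f (t0 + x + h - delay tau w) =
   \sum_(w <- wordsle tau (x + t1) | delay tau w == x) wcoef tau D w (t0 + x + h) *m f (t0 + h).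
  rewrite [RHS]big_mkcond big_seq [RHS]big_seq; apply: eq_bigr => w ww.
  case: eqP => [->|wx]; first by congr (_ *m f _); ring.
  rewrite f_out ?mulmx0 // leNgt; apply/negP => hlt; apply: wx.
  apply: hgp; first by rewrite mem_undup map_f.
  have -> : delay tau w - x = h - (t0 + x + h - delay tau w - t0) by ring.
  by rewrite (le_lt_trans (ler_normB _ _)) //; move: hh hlt e3; lra.
rewrite -mulmx_suml -(fundE tau0_gt0 tau_min) ?lerDl ?(ltW tau0_gt0) //.
rewrite /f [t0 + h]addrC addrK -scalemxAr enormZ /cabs2 /= expr0n addr0 sqrtr_sqr.
have /andP[hat0 _] := hat_bounds (h / e); rewrite (ger0_norm hat0) ler_wpM2l //.
by apply: hdel; move: hh e2 del0; lra.
Qed.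

(** With initial time [t0 + t1 / 2] the tent lies inside the initial interval, and
    [y] vanishes at its right end and at the points that the delays reach from
    there, so that the initial value satisfies the compatibility condition. *)
Lemma bump_state e y : 0 < e -> e <= t1 / 4 ->
  (forall t, t <= t0 + t1 / 2 -> y t = Complex (hat ((t - t0) / e)) 0 *: v) ->
  forall r, r <= t0 + t1 / 2 -> e <= `|r - t0| -> y r = 0.
Proof.
move=> e0 e1 y_early r rs er; rewrite y_early // hat_out ?scale0r //.
by rewrite normrM normfV (ger0_norm (ltW e0)) ler_pdivlMr // mul1r.
Qed.

Lemma fund_le_C0 g K : t1 <= x -> 0 < K ->
  (forall s phi y, C0_state tau D s phi -> C0_solution tau D s phi y ->
    forall t, s <= t -> (C0_norm tau (Defs.shift y t) <=
       (K * expR (- g * (t - s)))%:E * C0_norm tau phi)%E) ->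
  A - eta <= K * expR (- (g * (x - t1 / 2))) * enorm v.
Proof.
move=> t1x K0 hK; have [e [y [e0 e1 ycont [y_early y_eq] y_ge]]] := bump_solution.
pose s := t0 + t1 / 2; pose phi := Defs.shift y s.
have tN0 : 0 < tN by exact: tau_gt0.
have y0 := bump_state e0 e1 y_early.
have cont_on B a : mx_continuous_on B (fun t => y (a + t)).
  have h : part_continuous (fun t => y (a + t)).
    rewrite (_ : (fun t => y (a + t)) = (fun t => y (t + a))).
      exact: part_continuous_shift.
    by apply/funext => t; rewrite addrC.
  move=> i j; split; apply: continuous_subspaceT.
    exact: (h (i, j, true)).
  exact: (h (i, j, false)).
have st : C0_state tau D s phi.
  split; first exact: cont_on.
  rewrite /phi /Defs.shift addr0 y0 ?lexx //; last first.
    by rewrite /s ger0_norm; move: e1 tau0_gt0; lra.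
  rewrite big1 // => j _; rewrite y0 ?mulmx0 //.
    by rewrite /s; move: (tau_min j) tau0_gt0; lra.
  by rewrite /s ler0_norm; move: (tau_min j) e1 tau0_gt0; lra.
have sol : C0_solution tau D s phi y.
  split=> //; rewrite (_ : y = fun t => y (0 + t)); first exact: cont_on.
  by apply/funext => t; rewrite add0r.
have := hK s phi y st sol (t0 + x); rewrite lerD2l => /(_ _).
have sx : t1 / 2 <= x by move: t1x tau0_gt0; lra.
move=> /(_ sx) h.
have h1 : ((enorm (y (t0 + x)))%:E <= C0_norm tau (Defs.shift y (t0 + x)))%E.
  apply: ereal_sup_ubound; exists 0; last by rewrite /Defs.shift addr0.
  by rewrite /= in_itv /= lexx oppr_le0 ltW.
have h2 : (C0_norm tau phi <= (enorm v)%:E)%E.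
  apply: ge_ereal_sup => _ [th thI <-]; rewrite lee_fin /phi /Defs.shift y_early; last first.
    by move: thI; rewrite /= in_itv /= => /andP[_ h']; rewrite gerDl.
  rewrite enormZ /cabs2 /= expr0n addr0 sqrtr_sqr.
  have /andP[a0 a1] := hat_bounds ((s + th - t0) / e).
  by rewrite (ger0_norm a0) ler_piMl ?enorm_ge0.
have e' : 0 <= K * expR (- g * (t0 + x - s)) by rewrite mulr_ge0 ?expR_ge0 // ltW.
have h3 : ((enorm (y (t0 + x)))%:E <= (K * expR (- g * (t0 + x - s)))%:E * (enorm v)%:E)%E.
  apply: le_trans h1 (le_trans h _); apply: lee_wpmul2l h2.
  by rewrite lee_fin.
move: h3; rewrite -EFinM lee_fin.
rewrite (_ : - g * (t0 + x - s) = - (g * (x - t1 / 2))); last by rewrite /s; ring.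
apply: le_trans; have := y_ge 0; rewrite normr0 mul0r addr0 hat_in ?normr0 ?ler01 //.
by rewrite subr0 mul1r; apply; exact: ltW.
Qed.

(** The initial value lives on an interval of length [2 * e], and half of its
    height is still seen on an interval of length [e] around [t0 + x]; in the
    ratio of the two L^q norms the width [e] cancels. *)
Lemma fund_le_Lq q g K : t1 <= x -> 0 < K -> 0 < g -> (1 <= q)%E ->
  (forall s phi y, in_Lq q (- tauN tau) 0 phi -> Lq_solution tau D q s phi y ->
    forall t, s <= t -> (Lq_norm q (- tauN tau) 0 (Defs.shift y t) <=
       (K * expR (- g * (t - s)))%:E * Lq_norm q (- tauN tau) 0 phi)%E) ->
  A - eta <= 4 * K * expR (- (g * (x - t1 / 2))) * enorm v.
Proof.
move=> t1x K0 g0 q1 hK; have [e [y [e0 e1 ycont [y_early y_eq] y_ge]]] := bump_solution.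
have [Aeta|Aeta] := leP (A - eta) 0.
  by apply: le_trans Aeta _; rewrite !mulr_ge0 ?expR_ge0 ?enorm_ge0 // ltW.
pose s := t0 + t1 / 2; pose phi := Defs.shift y s.
have tN0 : 0 < tN by exact: tau_gt0.
have y0 := bump_state e0 e1 y_early.
have cont_sh a : part_continuous (Defs.shift y a).
  rewrite (_ : Defs.shift y a = (fun t => y (t + a))).
    exact: part_continuous_shift.
  by apply/funext => t; rewrite /Defs.shift addrC.
have sol : Lq_solution tau D q s phi y.
  split=> [b||]; first exact: in_Lq_continuous.
    by apply/nearW => th _.
  by apply/nearW => t; exact: y_eq.
pose t := t0 + x + e / 2.
have st : s <= t by rewrite /s /t; move: t1x tau0_gt0 e0; lra.
have := hK s phi y (in_Lq_continuous _ _ q1 (cont_sh s)) sol t st.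
have e2 : 0 < 2 * e by rewrite mulr_gt0.
have hphi : (Lq_norm q (- tauN tau) 0 phi <= (enorm v * unit_norm q (2 * e))%:E)%E.
  apply: (@Lq_norm_le_step _ _ q _ _ (- (t1 / 2) - e)) => //; [exact: cont_sh|exact: enorm_ge0|].
  move=> th /andP[_ th0]; have hs : s + th <= t0 + t1 / 2 by rewrite gerDl.
  case: ifPn => [_|hth].
    rewrite /phi /Defs.shift y_early // enormZ /cabs2 /= expr0n addr0 sqrtr_sqr.
    have /andP[a0 a1] := hat_bounds ((s + th - t0) / e).
    by rewrite (ger0_norm a0) ler_piMl ?enorm_ge0.
  rewrite /phi /Defs.shift y0 ?enorm0 //.
  rewrite leNgt; apply: contra hth; rewrite ltr_norml => /andP[h1 h2].
  by apply/andP; split; move: h1 h2; rewrite /s; lra.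
have hy : (((A - eta) / 2 * unit_norm q e)%:E <= Lq_norm q (- tauN tau) 0 (Defs.shift y t))%E.
  apply: (@Lq_norm_ge_step _ _ q _ _ (- e)) => //.
  - by rewrite divr_ge0 // ltW.
  - by rewrite lerN2 /tauN; move: e1 (tau_max ord0) tau0_gt0; lra.
  - by rewrite addNr.
  move=> th /andP[th1 th2]; rewrite addNr in th2.
  have he : `|e / 2 + th| <= e / 2 by rewrite ler_norml; apply/andP; split; lra.
  have he' : `|e / 2 + th| <= e by apply: le_trans he _; move: e0; lra.
  have := y_ge _ he'; rewrite addrA -/t; apply: le_trans.
  have hn : `|(e / 2 + th) / e| <= 1 / 2.
    by rewrite normrM normfV (ger0_norm (ltW e0)) ler_pdivrMr //; move: he; lra.
  rewrite hat_in; last by apply: le_trans hn _; lra.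
  by rewrite mulrC ler_wpM2r ?(ltW Aeta) //; move: hn; lra.
move=> h; have e' : 0 <= K * expR (- g * (t - s)) by rewrite mulr_ge0 ?expR_ge0 // ltW.
have : (((A - eta) / 2 * unit_norm q e)%:E <=
    (K * expR (- g * (t - s)))%:E * (enorm v * unit_norm q (2 * e))%:E)%E.
  apply: le_trans hy (le_trans h _); apply: lee_wpmul2l hphi.
  by rewrite lee_fin.
rewrite -EFinM lee_fin => {}h.
have u0 := unit_norm_gt0 q e0.
have h2 : K * expR (- g * (t - s)) * (enorm v * unit_norm q (2 * e)) <=
    K * expR (- (g * (x - t1 / 2))) * (enorm v * (2 * unit_norm q e)).
  apply: ler_pM => //.
  - by rewrite mulr_ge0 ?enorm_ge0 // ltW // unit_norm_gt0.
  - rewrite ler_wpM2l ?(ltW K0) // ler_expR mulNr lerN2 ler_wpM2l ?(ltW g0) //.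
    by rewrite /t /s; move: e0; lra.
  - by rewrite ler_wpM2l ?enorm_ge0 ?unit_norm_double.
have := le_trans h h2; move: (expR _) (unit_norm q e) u0 => E u u0 {}h.
by rewrite -(ler_pM2r u0); move: h; lra.
Qed.

End Bump.

Lemma fund_small x t : x < t1 -> enorm (fund tau D x t) <= enorm (1%:M : 'M[R[i]]_d).
Proof.
move=> xt; have [x0|x0|->] := ltgtP x 0; last by rewrite fund0.
  by rewrite fund_lt0 // enorm0 enorm_ge0.
rewrite fund_gt0 // big1 ?enorm0 ?enorm_ge0 // => j _.
by rewrite fund_lt0 ?mulmx0 //; move: (tau_min j) xt; lra.
Qed.

Lemma decay_of_bound g K : 0 < g -> 0 < K ->
  (forall t0 x eta (v : 'cV[R[i]]_d), t1 <= x -> 0 < eta ->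
     enorm (fund tau D x (t0 + x) *m v) - eta <= K * expR (- (g * (x - t1 / 2))) * enorm v) ->
  fund_decay tau D.
Proof.
move=> g0 K0 h; pose E1 := enorm (1%:M : 'M[R[i]]_d).
pose K2 := d%:R * (K * expR (g * (t1 / 2))) + E1 * expR (g * t1) + 1.
have p1 : 0 <= d%:R * (K * expR (g * (t1 / 2))) by rewrite !mulr_ge0 ?expR_ge0 // ltW.
have p2 : 0 <= E1 * expR (g * t1) by rewrite mulr_ge0 ?expR_ge0 ?enorm_ge0.
exists g, K2; split => //; first by rewrite /K2 ltr_wpDl // addr_ge0.
move=> x t; have [t1x|xt] := leP t1 x; last first.
  apply: le_trans (fund_small t xt) _.
  apply: (@le_trans _ _ (E1 * expR (g * t1) * expR (- (g * x)))); last first.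
    by rewrite ler_wpM2r ?expR_ge0 // /K2; move: p1; lra.
  rewrite -mulrA -expRD ler_peMr ?enorm_ge0 // -expR0 ler_expR -mulrBr.
  by rewrite mulr_ge0 ?(ltW g0) // subr_ge0 ltW.
apply: le_trans (enorm_le_cols _) _.
apply: (@le_trans _ _ (\sum_(i < d) K * expR (- (g * (x - t1 / 2))))).
  apply: ler_sum => i _; apply/ler_addgt0Pl => eta eta0.
  have := h (t - x) x eta (delta_mx i ord0) t1x eta0.
  by rewrite enorm_delta_col mulr1 subrK lerBlDl.
rewrite sumr_const card_ord -[(K * _) *+ d]mulr_natl.
have -> : expR (- (g * (x - t1 / 2))) = expR (g * (t1 / 2)) * expR (- (g * x)).
  by rewrite -expRD; congr expR; ring.
rewrite (_ : d%:R * _ = d%:R * (K * expR (g * (t1 / 2))) * expR (- (g * x))); last by ring.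
by rewrite ler_wpM2r ?expR_ge0 // /K2 -addrA lerDl addr_ge0.
Qed.

Lemma decay_of_stable : exponentially_stable tau D -> fund_decay tau D.
Proof.
case=> [[g [K [g0 K0 h]]]|[q q1 [g [K [g0 K0 h]]]]].
  apply: (decay_of_bound g0 K0) => t0 x eta v t1x eta0.
  by apply: fund_le_C0.
have K40 : 0 < 4 * K by rewrite mulr_gt0.
apply: (decay_of_bound g0 K40) => t0 x eta v t1x eta0.
by apply: (fund_le_Lq _ _ _ t1x K0 g0 q1 h).
Qed.

End DecayOfStable.

(** * Fourier series of differentiable functions *)

Section Integral.
Variables (R : realType) (T : R).
Hypothesis T_gt0 : 0 < T.
Implicit Types (f g h : R -> R).

Definition intT f : R := Rintegral lebesgue_measure `[0, T] f.

Lemma continuous_integrable f : continuous f ->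
  (@lebesgue_measure R).-integrable `[0, T] (EFin \o f).
Proof.
move=> cf; apply: continuous_compact_integrable; first exact: segment_compact.
exact: continuous_subspaceT.
Qed.

Lemma continuousD f g : continuous f -> continuous g -> continuous (fun s => f s + g s).
Proof. by move=> cf cg s; apply: cvgD; [exact: cf|exact: cg]. Qed.

Lemma continuousM f g : continuous f -> continuous g -> continuous (fun s => f s * g s).
Proof. by move=> cf cg s; apply: cvgM; [exact: cf|exact: cg]. Qed.

Lemma continuous_cst (a : R) : continuous (fun _ : R => a).
Proof. by move=> s; exact: cvg_cst. Qed.

Lemma continuousZ (a : R) f : continuous f -> continuous (fun s => a * f s).
Proof. by apply: continuousM; exact: continuous_cst. Qed.

Lemma intTD f g : continuous f -> continuous g ->
  intT (fun s => f s + g s) = intT f + intT g.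
Proof. by move=> cf cg; apply: RintegralD => //; exact: continuous_integrable. Qed.

Lemma intTZ (a : R) f : continuous f -> intT (fun s => a * f s) = a * intT f.
Proof. by move=> cf; apply: RintegralZl => //; exact: continuous_integrable. Qed.

Lemma intT_cst (a : R) : intT (fun=> a) = a * T.
Proof.
rewrite /intT Rintegral_cst //; congr (_ * _).
have h : lebesgue_measure (`[0, T] : set R) = T%:E.
  by rewrite lebesgue_measure_itv /= lte_fin T_gt0 oppr0 adde0.
exact: (congr1 fine h).
Qed.

Lemma le_intT f g : continuous f -> continuous g -> (forall s, f s <= g s) ->
  intT f <= intT g.
Proof.
by move=> cf cg fg; apply: le_Rintegral => //; exact: continuous_integrable.
Qed.

Lemma eq_intT f g : f =1 g -> intT f = intT g.
Proof. by move=> fg; congr intT; apply/funext. Qed.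

Lemma intT_sum (I : Type) (s : seq I) (F : I -> R -> R) :
  (forall i, continuous (F i)) ->
  intT (fun u => \sum_(i <- s) F i u) = \sum_(i <- s) intT (F i).
Proof.
move=> cF; elim: s => [|i s IH].
  rewrite big_nil (@eq_intT _ (fun=> 0)) ?intT_cst ?mul0r // => u.
  by rewrite big_nil.
rewrite big_cons -IH -intTD //; last exact: continuous_sum.
by apply: eq_intT => u; rewrite big_cons.
Qed.

Lemma intT_derive (F f : R -> R) : (forall s : R, is_derive s 1 F (f s)) ->
  continuous f -> intT f = F T - F 0.
Proof.
move=> dF cf.
have cF : continuous F.
  by move=> s; apply: differentiable_continuous; apply/derivable1_diffP; case: (dF s).
have : (\int[lebesgue_measure]_(x in `[0%R, T]) (f x)%:E = (F T)%:E - (F 0%R)%:E)%E.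
  apply: continuous_FTC2 => //.
  - exact: continuous_subspaceT.
  - split; first by move=> s _; case: (dF s).
      by apply: cvg_at_right_filter; exact: cF.
    by apply: cvg_at_left_filter; exact: cF.
  - by move=> s _; rewrite derive1E; case: (dF s).
by rewrite /intT /Rintegral => ->.
Qed.

Notation om := (2 * pi / T).

Lemma om_gt0 : 0 < om.
Proof. by rewrite divr_gt0 // mulr_gt0 // pi_gt0. Qed.

Lemma omT : om * T = 2 * pi.
Proof. by rewrite divfK // gt_eqF. Qed.

(** The characters and their phase shifts by [ph]; [ph = - (pi / 2)] is the sine. *)
Definition wave (k : int) (ph s : R) : R := cos (k%:~R * om * s + ph).

Lemma waveE k ph s : wave k ph s = cos (k%:~R * om * s + ph).
Proof. by []. Qed.

Lemma continuous_wave k ph : continuous (wave k ph).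
Proof.
move=> s; apply: continuous_comp; last exact: continuous_cos.
apply: cvgD; last exact: cvg_cst.
by apply: cvgM; [exact: cvg_cst|exact: cvg_id].
Qed.

Lemma is_derive_wave k ph (s : R) :
  is_derive s 1 (wave k ph) (- (k%:~R * om) * wave k (ph - pi / 2) s).
Proof.
have h : is_derive s 1 (fun s => k%:~R * om * s + ph) (k%:~R * om).
  rewrite -[X in is_derive _ _ _ X]addr0 -[X in is_derive _ _ _ (X + _)]mulr1.
  exact: is_deriveD.
have := @is_derive1_comp R (@cos R) (fun s => k%:~R * om * s + ph) s _ _
  (is_derive_cos _) h.
rewrite (_ : cos \o _ = wave k ph) // /wave addrA cosBpihalf.
by rewrite (_ : - sin _ * _ = - (k%:~R * om) * sin (k%:~R * om * s + ph)) //; ring.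
Qed.

Lemma wave_periodic k ph s : wave k ph (s + T) = wave k ph s.
Proof.
have -> : wave k ph (s + T) = cos (k%:~R * om * s + ph + 2 * (k%:~R * pi)).
  by rewrite /wave; congr cos; rewrite mulrDr -(mulrA _ om T) omT; ring.
rewrite /wave; move: (_ + ph) => z.
have sgn (m : nat) (y : R) : cos (y + 2 * (m%:R * pi)) = cos y.
  elim: m y => [|m IH] y; first by rewrite mul0r mulr0 addr0.
  rewrite (_ : y + _ = y + 2 * (m%:R * pi) + pi + pi); last by rewrite -natr1; ring.
  by rewrite !cosDpi opprK IH.
case: k => m; first exact: sgn.
by rewrite NegzE mulrNz mulNr mulrN -[LHS](sgn m.+1) subrK.
Qed.

Lemma intT_wave (k : int) ph : k != 0 -> intT (wave k ph) = 0.
Proof.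
move=> k0; pose a := (k%:~R * om)^-1.
have ka : k%:~R * om != 0 by rewrite mulf_neq0 ?intr_eq0 // gt_eqF // om_gt0.
have h (s : R) : is_derive s 1 (fun s => a * wave k (ph - pi / 2) s) (wave k ph s).
  have := is_deriveZ a (is_derive_wave k (ph - pi / 2) s).
  congr is_derive; rewrite /a /GRing.scale /= mulrA mulrN mulVf // mulN1r.
  by rewrite /wave -cosDpi; congr cos; move: (_ * s) => z; field.
rewrite (intT_derive h); last exact: continuous_wave.
by rewrite -{1}[T]add0r wave_periodic subrr.
Qed.

Lemma wave0 ph s : wave 0 ph s = cos ph.
Proof. by rewrite /wave mul0r mul0r add0r. Qed.

Lemma wave_mul k l ph ph' s :
  wave k ph s * wave l ph' s =
  2^-1 * wave (k - l) (ph - ph') s + 2^-1 * wave (k + l) (ph + ph') s.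
Proof.
rewrite /wave.
have -> : (k - l)%:~R * om * s + (ph - ph') = (k%:~R * om * s + ph) - (l%:~R * om * s + ph').
  by rewrite intrB !mulrBl; ring.
have -> : (k + l)%:~R * om * s + (ph + ph') = (k%:~R * om * s + ph) + (l%:~R * om * s + ph').
  by rewrite intrD !mulrDl; ring.
by move: (k%:~R * om * s + ph) (l%:~R * om * s + ph') => a b; rewrite cosB cosD; field.
Qed.

Lemma intT_wave_mul (k l : int) (ph ph' : R) : k + l != 0 ->
  intT (fun s => wave k ph s * wave l ph' s) =
  if k == l then T / 2 * cos (ph - ph') else 0.
Proof.
move=> kl; rewrite (eq_intT (fun s => wave_mul k l ph ph' s)).
have cw a b := @continuousZ (2^-1 : R) _ (@continuous_wave a b).
rewrite intTD // !intTZ; try exact: continuous_wave.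
rewrite (intT_wave _ kl) mulr0 addr0; case: eqP => [->|/eqP kl'].
  rewrite subrr (@eq_intT _ (fun=> cos (ph - ph'))) ?intT_cst; last exact: wave0.
  by field.
by rewrite intT_wave ?mulr0 // subr_eq0.
Qed.

(** Bessel's inequality, subtracting one projection at a time. *)
Lemma bessel (I : eqType) (s : seq I) (phi : I -> R -> R) (kp : R) f :
  uniq s -> 0 < kp -> (forall i, continuous (phi i)) ->
  {in s &, forall i j, intT (fun u => phi i u * phi j u) = if i == j then kp else 0} ->
  continuous f ->
  \sum_(i <- s) intT (fun u => f u * phi i u) ^+ 2 <= kp * intT (fun u => f u * f u).
Proof.
move=> us kp0 cphi; elim: s us f => [|i s IH] /= us f orth cf.
  rewrite big_nil; apply: mulr_ge0; first exact: ltW.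
  rewrite -(mul0r T) -intT_cst.
  apply: le_intT; [exact: continuous_cst|exact: continuousM|].
  by move=> u; rewrite -expr2 sqr_ge0.
case/andP: us => is_ us; rewrite big_cons.
pose a := intT (fun u => f u * phi i u) / kp.
pose f' u := f u + - a * phi i u.
have cf' : continuous f' by apply: continuousD => //; exact: continuousZ.
have orths : {in s &, forall j l, intT (fun u => phi j u * phi l u) = if j == l then kp else 0}.
  by move=> j l js ls; apply: orth; rewrite inE ?js ?ls orbT.
have := IH us f' orths cf'.
have -> : \sum_(j <- s) intT (fun u => f' u * phi j u) ^+ 2 =
    \sum_(j <- s) intT (fun u => f u * phi j u) ^+ 2.
  rewrite big_seq [RHS]big_seq; apply: eq_bigr => j js; congr (_ ^+ 2).
  rewrite (@eq_intT _ (fun u => f u * phi j u + - a * (phi i u * phi j u))).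
    rewrite intTD ?intTZ; try exact: continuousM; last by apply: continuousZ; exact: continuousM.
    rewrite orth ?mem_head ?inE ?js ?orbT // ifF ?mulr0 ?addr0 //.
    by apply/eqP => ij; move: is_; rewrite ij js.
  by move=> u; rewrite /f'; ring.
have -> : intT (fun u => f' u * f' u) = intT (fun u => f u * f u) - kp * a ^+ 2.
  rewrite (@eq_intT _ (fun u => (f u * f u + (- 2 * a) * (f u * phi i u)) +
     a ^+ 2 * (phi i u * phi i u))); last by move=> u; rewrite /f'; ring.
  have c1 : continuous (fun u => f u * f u) by exact: continuousM.
  have c2 : continuous (fun u => f u * phi i u) by exact: continuousM.
  have c3 : continuous (fun u => phi i u * phi i u) by exact: continuousM.
  rewrite intTD; [|by apply: continuousD => //; exact: continuousZ|exact: continuousZ].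
  rewrite intTD //; last exact: continuousZ.
  rewrite !intTZ // (orth i i) ?mem_head // eqxx.
  have -> : intT (fun u => f u * phi i u) = kp * a by rewrite /a mulrCA divff ?mulr1 // gt_eqF.
  by ring.
have -> : intT (fun u => f u * phi i u) = kp * a by rewrite /a mulrCA divff ?mulr1 // gt_eqF.
rewrite mulrBr lerBrDl.
by rewrite (_ : (kp * a) ^+ 2 = kp * (kp * a ^+ 2)) //; ring.
Qed.

End Integral.

Section FourierReal.
Variables (R : realType) (T : R).
Hypothesis T_gt0 : 0 < T.
Implicit Types (f g : R -> R).
Notation om := (2 * pi / T).
Notation intT := (intT T).
Notation wave := (wave T).

Let om0 : 0 < om. Proof. exact: om_gt0. Qed.

(** ** Summability of the coefficients *)

Lemma sum_inv_sqr (s : seq int) : uniq s ->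
  \sum_(m <- s) ((m%:~R : R) ^+ 2)^-1 <= 4.
Proof.
move=> us; have [n sn] := win_sub_seq s.
have w0 (m : int) : 0 <= ((m%:~R : R) ^+ 2)^-1 by rewrite invr_ge0 sqr_ge0.
apply: (@le_trans _ _ (\sum_(m <- win n) ((m%:~R : R) ^+ 2)^-1)).
  apply: ler_sum_uniq; rewrite ?win_uniq // => m /sn ms /negP; by case.
(* [1 / m ^ 2 <= 1 / (m - 1 / 2) - 1 / (m + 1 / 2)], which telescopes. *)
suff : \sum_(m <- win n) ((m%:~R : R) ^+ 2)^-1 <= 4 - 2 / (n%:R + 2^-1).
  by move=> /le_trans; apply; rewrite gerDl oppr_le0 divr_ge0 // addr_ge0 // invr_ge0.
elim: n {sn} => [|n IH]; first by rewrite win.unlock big_seq1 expr0n invr0 add0r invrK; lra.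
rewrite (perm_big _ (win_perm n)) 2!big_cons /= rmorphN sqrrN.
apply: le_trans (lerD (lexx _) (lerD (lexx _) IH)) _.
rewrite -pmulrn -natr1; set a := n%:R : R.
have a0 : 0 <= a by rewrite ler0n.
rewrite -subr_ge0 (_ : _ - _ = 2^-1 / ((a + 1) ^+ 2 * (a + 2^-1) * (a + 3 / 2))); last by field; lra.
by rewrite divr_ge0 // !mulr_ge0 ?sqr_ge0 // addr_ge0 // divr_ge0.
Qed.

Section OneFunction.
Variables (g g' : R -> R).
Hypotheses (dg : forall s : R, is_derive s 1 g (g' s)) (cg' : continuous g')
  (g_per : forall s, g (s + T) = g s).

Let cg : continuous g.
Proof.
by move=> s; apply: differentiable_continuous; apply/derivable1_diffP; case: (dg s).
Qed.

(** Integration by parts; the boundary terms cancel by periodicity. *)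
Lemma wave_by_parts m ph : m%:~R * om * intT (fun s => g s * wave m ph s) =
  intT (fun s => g' s * wave m (ph + pi / 2) s).
Proof.
have c1 a : continuous (fun s => g' s * wave m a s).
  by apply: continuousM => //; exact: continuous_wave.
have c2 a : continuous (fun s => g s * wave m a s).
  by apply: continuousM => //; exact: continuous_wave.
pose h s := g s * wave m (ph + pi / 2) s.
have dh (s : R) : is_derive s 1 h
    (g' s * wave m (ph + pi / 2) s + - (m%:~R * om) * (g s * wave m ph s)).
  have := is_deriveM (dg s) (is_derive_wave T m (ph + pi / 2) s).
  congr is_derive; rewrite /GRing.scale /= addrK; ring.
have := @intT_derive _ _ T_gt0 h _ dh.
rewrite intTD // ?intTZ //; last by apply: continuousZ; exact: c2.
have -> : h T = h 0 by rewrite /h -(g_per 0) -(wave_periodic T_gt0 _ _ 0) !add0r.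
rewrite subrr => e; apply/eqP; rewrite eq_sym -subr_eq0 -mulNr; apply/eqP/e.
by apply: continuousD; [exact: c1|apply: continuousZ; exact: c2].
Qed.

(** For a fixed phase the waves of opposite frequencies need not be orthogonal, so
    positive and negative frequencies are treated apart. *)
Lemma bessel_wave (s : seq int) ph : uniq s ->
  \sum_(m <- s | m != 0) intT (fun s => g' s * wave m ph s) ^+ 2 <=
  T * intT (fun s => g' s * g' s).
Proof.
move=> us.
have T20 : 0 < T / 2 by rewrite divr_gt0.
have key (s' : seq int) : uniq s' -> {in s' &, forall m l, m + l != 0} ->
    \sum_(m <- s') intT (fun s => g' s * wave m ph s) ^+ 2 <= T / 2 * intT (fun s => g' s * g' s).
  move=> us' h; apply: bessel => //; first by move=> m; exact: continuous_wave.
  by move=> m l ms ls; rewrite intT_wave_mul ?h // subrr cos0 mulr1.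
rewrite (bigID (fun m : int => 0 < m)) /=.
rewrite (_ : T * _ = T / 2 * intT (fun s => g' s * g' s) +
                     T / 2 * intT (fun s => g' s * g' s)); last by field.
apply: lerD.
  rewrite -big_filter; apply: key; first exact: filter_uniq.
  by move=> m l; rewrite !mem_filter => /andP[/andP[_ m0] _] /andP[/andP[_ l0] _]; lia.
rewrite -big_filter; apply: key; first exact: filter_uniq.
by move=> m l; rewrite !mem_filter => /andP[/andP[? m0] _] /andP[/andP[? l0] _]; lia.
Qed.

(** The coefficients of [g] are those of [g'] divided by the frequency; both
    factors are square summable. *)
Lemma wave_summable ph : exists c, forall s : seq int, uniq s ->
  \sum_(m <- s) `|intT (fun s => g s * wave m ph s)| <= c.
Proof.
pose x m := intT (fun s => g' s * wave m (ph + pi / 2) s).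
exists (`|intT (fun s => g s * wave 0 ph s)| +
  om^-1 / 2 * (T * intT (fun s => g' s * g' s) + 4)) => s us.
rewrite (bigID (fun m : int => m == 0)) /=; apply: lerD.
  rewrite -big_filter; set s' := [seq m <- s | m == 0].
  have h : {subset s' <= [:: 0 : int]} by move=> m; rewrite mem_filter inE => /andP[].
  have := @ler_sum_uniq R int s' [:: 0] (fun m => `|intT (fun s => g s * wave m ph s)|).
  rewrite big_seq1; apply=> //; first exact: filter_uniq.
  by move=> m /h ->.
apply: (@le_trans _ _ (\sum_(m <- s | m != 0) om^-1 / 2 * (x m ^+ 2 + ((m%:~R : R) ^+ 2)^-1))).
  apply: ler_sum => m m0.
  have mR : (m%:~R : R) != 0 by rewrite intr_eq0.
  have -> : intT (fun s => g s * wave m ph s) = om^-1 * (x m * (m%:~R)^-1).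
    rewrite /x -wave_by_parts; move: (intT _) om (lt0r_neq0 om0) => y o o0; field.
    by rewrite mR.
  rewrite normrM gtr0_norm ?invr_gt0 // -[leRHS]mulrA ler_pM2l ?invr_gt0 //.
  rewrite -exprVn; move: (x m) (m%:~R^-1) => a b.
  by have := sqr_ge0 (a + b); have := sqr_ge0 (a - b); case: (ler0P (a * b)) => _; nra.
rewrite -mulr_sumr big_split /=; apply: ler_wpM2l.
  by rewrite divr_ge0 // invr_ge0 (ltW om0).
apply: lerD; first exact: bessel_wave.
by rewrite -big_filter; apply: sum_inv_sqr; exact: filter_uniq.
Qed.

End OneFunction.

(** ** Fejer means *)

Lemma cos1_nat (th : R) k : cos th = 1 -> cos (k%:R * th) = 1 /\ sin (k%:R * th) = 0.
Proof.
move=> c1; have s0 : sin th = 0 by apply: cos1sin0; rewrite c1 normr1.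
elim: k => [|k [IHc IHs]]; first by rewrite mul0r cos0 sin0.
by rewrite -natr1 mulrDl mul1r cosD sinD IHc IHs c1 s0; split; ring.
Qed.

(** The Dirichlet and (unnormalised) Fejer kernels. *)
Definition dirichlet (N : nat) (th : R) : R := \sum_(m <- win N) cos (m%:~R * th).
Definition fejer (n : nat) (th : R) : R := \sum_(0 <= N < n) dirichlet N th.

Lemma dirichletS N th : dirichlet N.+1 th = dirichlet N th + 2 * cos (N.+1%:R * th).
Proof.
rewrite /dirichlet (perm_big _ (win_perm N)) 2!big_cons rmorphN mulNr cosN /=.
by rewrite -pmulrn; ring.
Qed.

Lemma dirichlet_mul N th :
  (1 - cos th) * dirichlet N th = cos (N%:R * th) - cos (N.+1%:R * th).
Proof.
elim: N => [|N IH].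
  by rewrite /dirichlet win.unlock big_seq1 /= !mul0r cos0 mul1r mulr1.
rewrite dirichletS mulrDr IH; set a := N.+1%:R * th.
have -> : N%:R * th = a - th by rewrite /a -natr1; ring.
have -> : N.+2%:R * th = a + th by rewrite /a -(natr1 N.+1); ring.
by rewrite cosB cosD; ring.
Qed.

Lemma fejer_mul n th : (1 - cos th) * fejer n th = 1 - cos (n%:R * th).
Proof.
rewrite /fejer; elim: n => [|n IH]; first by rewrite big_geq // mul0r cos0 mulr0 subrr.
by rewrite big_nat_recr //= mulrDr IH dirichlet_mul addrA subrK.
Qed.

Lemma fejer_ge0 n th : 0 <= fejer n th.
Proof.
have [c1|c1] := eqVneq (cos th) 1.
  apply: sumr_ge0 => N _; elim: N => [|N IH].
    by rewrite /dirichlet win.unlock big_seq1 /= !mul0r cos0.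
  by rewrite dirichletS (cos1_nat N.+1 c1).1 addr_ge0.
have c0 : 0 < 1 - cos th by rewrite subr_gt0 lt_neqAle c1 cos_le1.
by rewrite -(pmulr_rge0 _ c0) fejer_mul subr_ge0 cos_le1.
Qed.

Lemma periodic_int f : (forall s, f (s + T) = f s) ->
  forall (m : int) s, f (s + m%:~R * T) = f s.
Proof.
move=> hf; have hn (k : nat) s : f (s + k%:R * T) = f s.
  elim: k s => [|k IH] s; first by rewrite mul0r addr0.
  by rewrite -natr1 mulrDl mul1r addrA hf IH.
move=> [k|k] s; first exact: hn.
by rewrite NegzE mulrNz mulNr -[LHS](hn k.+1) subrK.
Qed.

(** The modulus of continuity against [1 - cos], as in Korovkin's theorem. *)
Lemma korovkin_bound g t eta : continuous g -> (forall s, g (s + T) = g s) -> 0 < eta ->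
  exists2 C, 0 <= C & forall s, `|g s - g t| <= eta + C * (1 - cos (om * (s - t))).
Proof.
move=> cg gT eta0.
have /cvgrPdist_le /(_ eta eta0) /nbhs_ballP [d /= d0 hd] := cg t.
pose de := Num.min (d / 2) (T / 4).
have de0 : 0 < de by rewrite lt_min !divr_gt0.
have deT : de <= T / 4 by rewrite ge_min lexx orbT.
have ded : de <= d / 2 by rewrite ge_min lexx.
have cn : continuous (fun s => `|g s - g t|).
  by move=> s; apply: cvg_norm; apply: cvgB; [exact: cg|exact: cvg_cst].
have [] := @EVT_max R (fun s => `|g s - g t|) (t - T / 2) (t + T / 2); first lra.
  exact: continuous_subspaceT.
move=> c _ hB; set B := `|_| in hB.
have hpi := pi_gt0 R.
have omT2 : om * (T / 2) = pi by field; rewrite gt_eqF.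
have zin : (0 : R) \in `[0, pi] by rewrite in_itv /= lexx (ltW hpi).
have dein : om * de \in `[0, pi].
  rewrite in_itv /= mulr_ge0 ?(ltW om0) ?(ltW de0) //= -[leRHS]omT2 ler_pM2l //; lra.
have c0 : 0 < 1 - cos (om * de).
  by rewrite subr_gt0 -[ltRHS]cos0 (ltr_cos zin dein) mulr_gt0.
have B0 : 0 <= B by exact: normr_ge0.
exists (B / (1 - cos (om * de))); first by rewrite divr_ge0 // (ltW c0).
have main s : t - T / 2 <= s <= t + T / 2 ->
    `|g s - g t| <= eta + B / (1 - cos (om * de)) * (1 - cos (om * (s - t))).
  move=> hs; have [near_t|far] := leP `|s - t| de.
    rewrite -[leLHS]addr0; apply: lerD.
      rewrite distrC; apply: hd; rewrite /ball /= distrC.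
      apply: le_lt_trans near_t _; lra.
    by rewrite mulr_ge0 ?divr_ge0 ?(ltW c0) // subr_ge0 cos_le1.
  apply: (@le_trans _ _ B); first by apply: hB; rewrite in_itv.
  rewrite ler_wpDl ?(ltW eta0) // -mulrA ler_peMr // mulrC ler_pdivlMr // mul1r lerD2l lerN2.
  rewrite -[cos (om * (s - t))]cos_norm normrM (gtr0_norm om0).
  have st : `|s - t| <= T / 2 by rewrite ler_norml; lra.
  have stin : om * `|s - t| \in `[0, pi].
    by rewrite in_itv /= mulr_ge0 ?(ltW om0) //= -[leRHS]omT2 ler_pM2l.
  by apply: ltW; rewrite (ltr_cos dein stin) ltr_pM2l.
move=> s; pose m := Num.floor ((s - t) / T + 1 / 2).
have /andP[m1 m2] := floor_itv ((s - t) / T + 1 / 2).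
pose s' := s + (- m)%:~R * T.
have -> : g s = g s' by rewrite /s' periodic_int.
have -> : cos (om * (s - t)) = cos (om * (s' - t)).
  have := @periodic_int (fun s => cos (om * (s - t))) _ (- m) s.
  move=> <- // r; have := wave_periodic T_gt0 1 (- (om * t)) r.
  by rewrite !waveE mul1r -!mulrBr.
apply: main; rewrite /s' rmorphN /= -/m in m1 m2 *.
have xE : ((s - t) / T + 1 / 2) * T = s - t + T / 2 by field; rewrite gt_eqF.
have mT1 : m%:~R * T <= s - t + T / 2.
  by have := ler_wpM2r (ltW T_gt0) m1; rewrite xE.
have mT2 : s - t + T / 2 < m%:~R * T + T.
  by move: m2; rewrite -(ltr_pM2r T_gt0) intrD xE mulrDl mul1r.
by rewrite mulNr; lra.
Qed.

(** If the symmetric partial sums of the Fourier series converge, so do their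
    means, and to the same limit; by positivity of the Fejer kernel the means
    converge to the function. *)
Lemma fourier_limit g t (l : R) : continuous g -> (forall s, g (s + T) = g s) ->
  (fun N => \sum_(m <- win N) intT (fun s => g s * wave m (- (m%:~R * om * t)) s) : R)
    @ \oo --> l ->
  l = T * g t.
Proof.
move=> cg gT hl; have := cesaro hl; set av := arithmetic_mean _ => hav.
have cwave m ph : continuous (fun s => wave m ph s) by exact: continuous_wave.
have cD N : continuous (fun s => dirichlet N (om * (s - t))).
  apply: (@continuous_sum R _ (win N) (fun m s => cos (m%:~R * (om * (s - t))))) => m.
  rewrite (_ : (fun _ => _) = wave m (- (m%:~R * om * t))) //; apply/funext => s.
  by rewrite !waveE; congr cos; ring.
have cF n : continuous (fun s => fejer n (om * (s - t))).
  exact: (@continuous_sum R _ (index_iota 0 n) (fun N s => dirichlet N (om * (s - t)))).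
have ccos : continuous (fun s => cos (om * (s - t))).
  rewrite (_ : (fun _ => _) = wave 1 (- (om * t))) //; apply/funext => s.
  by rewrite !waveE; congr cos; ring.
have SE N : \sum_(m <- win N) intT (fun s => g s * wave m (- (m%:~R * om * t)) s) =
    intT (fun s => g s * dirichlet N (om * (s - t))).
  rewrite -intT_sum //; last by move=> m; exact: continuousM.
  apply: eq_intT => s; rewrite /dirichlet mulr_sumr; apply: eq_bigr => m _.
  by rewrite !waveE; congr (_ * cos _); ring.
have avE n : av n = n.+1%:R^-1 * intT (fun s => g s * fejer n.+1 (om * (s - t))).
  rewrite /av /arithmetic_mean /series /=; congr (_ * _).
  under eq_bigr do rewrite SE.
  rewrite -intT_sum //; last by move=> N; exact: continuousM.
  by apply: eq_intT => s; rewrite /fejer mulr_sumr.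
have intD N : intT (fun s => dirichlet N (om * (s - t))) = T.
  elim: N => [|N IH].
    rewrite (@eq_intT R T _ (fun=> 1)) ?intT_cst ?mul1r // => s.
    by rewrite /dirichlet win.unlock big_seq1 /= mul0r cos0.
  rewrite (@eq_intT R T _ (fun s => dirichlet N (om * (s - t)) +
      2 * wave N.+1 (- (N.+1%:R * om * t)) s)).
    rewrite intTD ?intTZ ?IH //; last exact: continuousZ.
    by rewrite intT_wave // mulr0 addr0.
  move=> s; rewrite dirichletS; congr (_ + 2 * _); rewrite !waveE -pmulrn.
  by congr cos; ring.
have intF n : intT (fun s => fejer n (om * (s - t))) = n%:R * T.
  rewrite intT_sum // (eq_bigr (fun=> T)) => [|N _]; last exact: intD.
  by rewrite sumr_const_nat subn0 mulr_natl.
apply: (cvg_unique _ hav) => //.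
apply/cvgrPdist_le => e e0; pose eta := e / (2 * T).
have eta0 : 0 < eta by rewrite divr_gt0 // mulr_gt0.
have [C C0 hC] := korovkin_bound t cg gT eta0.
pose n0 := (Num.trunc (2 * (2 * C * T) / e)).+1.
exists n0 => // n /= hn.
have n1 : 0 < n.+1%:R :> R by rewrite ltr0n.
have -> : T * g t - av n = n.+1%:R^-1 * intT (fun s => (g t - g s) * fejer n.+1 (om * (s - t))).
  rewrite avE (@eq_intT R T (fun s => (g t - g s) * _)
      (fun s => g t * fejer n.+1 (om * (s - t)) + - 1 * (g s * fejer n.+1 (om * (s - t))))).
    have c1 : continuous (fun s => g s * fejer n.+1 (om * (s - t))) by exact: continuousM.
    rewrite intTD; [|exact: continuousZ|exact: continuousZ].
    rewrite !intTZ // intF; move: (intT _) => y.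
    by field; rewrite addrC natr1 gt_eqF.
  by move=> s; ring.
rewrite normrM gtr0_norm ?invr_gt0 // mulrC ler_pdivrMr //.
have step : `|intT (fun s => (g t - g s) * fejer n.+1 (om * (s - t)))| <=
    eta * (n.+1%:R * T) + 2 * C * T.
  have cB : continuous (fun s => eta * fejer n.+1 (om * (s - t)) + 2 * C).
    by apply: continuousD; [exact: continuousZ|exact: continuous_cst].
  have cL : continuous (fun s => (g t - g s) * fejer n.+1 (om * (s - t))).
    apply: continuousM => // s; apply: cvgB; [exact: cvg_cst|exact: cg].
  have <- : intT (fun s => eta * fejer n.+1 (om * (s - t)) + 2 * C) =
      eta * (n.+1%:R * T) + 2 * C * T.
    rewrite intTD; [|exact: continuousZ|exact: continuous_cst].
    by rewrite intTZ // intF intT_cst.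
  have pt s : `|(g t - g s) * fejer n.+1 (om * (s - t))| <=
      eta * fejer n.+1 (om * (s - t)) + 2 * C.
    rewrite normrM (ger0_norm (fejer_ge0 _ _)).
    apply: le_trans (ler_wpM2r (fejer_ge0 _ _) _) _; first by rewrite distrC; exact: hC.
    rewrite mulrDl lerD2l -[leLHS]mulrA fejer_mul [leLHS]mulrC ler_wpM2r //.
    by have := cos_geN1 (n.+1%:R * (om * (s - t))); lra.
  rewrite ler_norml; apply/andP; split.
    rewrite -[leLHS]mulN1r -intTZ //; apply: le_intT => //; first exact: continuousZ.
    by move=> s; have := pt s; rewrite ler_norml mulN1r => /andP[].
  by apply: le_intT => // s; have := pt s; rewrite ler_norml => /andP[].
apply: le_trans step _.
have -> : eta * (n.+1%:R * T) = e / 2 * n.+1%:R by rewrite /eta; field; rewrite gt_eqF.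
rewrite (_ : e * n.+1%:R = e / 2 * n.+1%:R + e / 2 * n.+1%:R); last by field.
rewrite lerD2l.
have hn1 : 2 * (2 * C * T) / e <= n.+1%:R.
  have := truncnS_gt (2 * (2 * C * T) / e) => h; apply: le_trans (ltW h) _.
  by rewrite ler_nat ltnW.
by move: hn1; rewrite ler_pdivrMr // => h; lra.
Qed.

End FourierReal.

Section FourierMatrix.
Variables (R : realType) (T : R) (m n : nat).
Hypothesis T_gt0 : 0 < T.
Variable f : R -> 'M[R[i]]_(m, n).
Hypotheses (f_per : forall t, f (t + T) = f t) (f_diff : mx_derivable f)
  (f_hoelder : hoelder_continuous (mx_derive f)).
Notation om := (2 * pi / T).
Notation intT := (intT T).
Notation wave := (wave T).
Notation F := (fourier_coef T f).

Let u i j s := complex.Re (f s i j).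
Let v i j s := complex.Im (f s i j).

Lemma is_derive_part q (s : R) :
  is_derive s 1 (fun s => part (f s) q : R) (part (mx_derive f s) q).
Proof.
case: q => -[i j] b; have [h1 h2] := f_diff i j.
rewrite /part /mx_derive /map_parts; case: b => /=; rewrite mxE /= derive1E.
  by apply: DeriveDef; [exact: h1|].
by apply: DeriveDef; [exact: h2|].
Qed.

Lemma part_continuous_derive : part_continuous (mx_derive f).
Proof.
have [al [C [al0 al1 C0 h]]] := f_hoelder => q s.
apply/cvgrPdist_le => e e0; have C1 : 0 < C + 1 by rewrite ltr_wpDl.
pose d := (e / (C + 1)) `^ al^-1.
have ec : 0 < e / (C + 1) by rewrite divr_gt0.
have d0 : 0 < d by exact: powR_gt0.
apply/nbhs_ballP; exists d => //= t; rewrite /ball /= distrC => st.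
rewrite -partN -partD; apply: le_trans (part_le_enorm _ _) _.
rewrite enormBC; apply: le_trans (h s t) _.
have : `|t - s| `^ al <= e / (C + 1).
  have -> : e / (C + 1) = d `^ al.
    by rewrite /d -powRrM mulVf ?(lt0r_neq0 al0) // powRr1 // ltW.
  by apply: ge0_ler_powR; rewrite ?nnegrE ?(ltW al0) ?powR_ge0 ?(ltW st).
rewrite ler_pdivlMr // => h'; apply: le_trans h'; rewrite mulrC ler_wpM2l ?powR_ge0 //.
by rewrite lerDl.
Qed.

Lemma part_continuous_self : part_continuous f.
Proof.
move=> q s; apply: differentiable_continuous; apply/derivable1_diffP.
by case: (is_derive_part q s).
Qed.

Lemma part_periodic q s : part (f (s + T)) q = part (f s) q.
Proof. by rewrite f_per. Qed.

Lemma fourier_coefE k i j : fourier_coef T f k i j = Complex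
  (T^-1 * (intT (fun s => u i j s * wave k 0 s) +
           intT (fun s => v i j s * wave k (- (pi / 2)) s)))
  (T^-1 * (intT (fun s => v i j s * wave k 0 s) -
           intT (fun s => u i j s * wave k (- (pi / 2)) s))).
Proof.
have cu : continuous (u i j) by exact: (@part_continuous_self (i, j, true)).
have cv : continuous (v i j) by exact: (@part_continuous_self (i, j, false)).
have cw ph (g : R -> R) : continuous g -> continuous (fun s => g s * wave k ph s).
  by move=> cg; apply: continuousM => //; exact: continuous_wave.
have prodE (z : R[i]) (a : R) : cexp (Complex 0 (- a)) * z =
    Complex (complex.Re z * cos a + complex.Im z * sin a)
            (complex.Im z * cos a - complex.Re z * sin a).
  rewrite cexp_im /cis cosN sinN; case: z => x y /=.
  by congr Complex; rewrite /=; ring.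
have w0 s : wave k 0 s = cos (k%:~R * om * s) by rewrite !waveE addr0.
have w1 s : wave k (- (pi / 2)) s = sin (k%:~R * om * s) by rewrite !waveE cosBpihalf.
rewrite /fourier_coef mxE /mx_integral /map_parts mxE.
have scal (a b c : R) : Complex a 0 * Complex b c = Complex (a * b) (a * c) :> R[i].
  by congr Complex; rewrite /=; ring.
rewrite scal; congr Complex; congr (_ * _).
  rewrite -intTD; [|exact: cw|exact: cw].
  by apply: eq_intT => s; rewrite mxE prodE /= w0 w1.
rewrite -[X in _ = _ + X]mulN1r -intTZ; last exact: cw.
rewrite -intTD; [|exact: cw|apply: continuousZ; exact: cw].
by apply: eq_intT => s; rewrite mxE prodE /= w0 w1 mulN1r.
Qed.

Lemma fourier_coef_summable : exists c, summable_by F c.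
Proof.
have /choice[c hc] : forall p : 'I_m * 'I_n * bool * R, exists c, forall s : seq int, uniq s ->
    \sum_(k <- s) `|intT (fun s => part (f s) p.1 * wave k p.2 s)| <= c.
  move=> p; apply: wave_summable => //; first exact: is_derive_part.
    exact: part_continuous_derive.
  exact: part_periodic.
pose b (q : 'I_m * 'I_n * bool)
  := T^-1 * (c ((q.1.1, q.1.2, q.2), 0) + c ((q.1.1, q.1.2, ~~ q.2), - (pi / 2))).
exists (\sum_q b q) => s us.
apply: (@le_trans _ _ (\sum_(k <- s) \sum_q `|part (F k) q|)).
  by apply: ler_sum => k _; exact: enorm_le_parts.
rewrite exchange_big /=; apply: ler_sum => -[[i j] b0] _.
apply: (@le_trans _ _ (\sum_(k <- s) (T^-1 *
   (`|intT (fun s => part (f s) (i, j, b0) * wave k 0 s)| +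
    `|intT (fun s => part (f s) (i, j, ~~ b0) * wave k (- (pi / 2)) s)|)))).
  apply: ler_sum => k _; rewrite /part /= fourier_coefE.
  case: b0 => /=; rewrite normrM gtr0_norm ?invr_gt0 // ler_pM2l ?invr_gt0 //.
    exact: ler_normD.
  exact: ler_normB.
rewrite -mulr_sumr ler_pM2l ?invr_gt0 // big_split /=.
by apply: lerD; [exact: (hc (_, _))|exact: (hc (_, _))].
Qed.

(** The sine terms of opposite frequencies cancel. *)
Lemma odd_sum (g : R -> R) t N : continuous g ->
  \sum_(k <- win N) intT (fun s => g s * wave k (- (k%:~R * om * t) - pi / 2) s) = 0.
Proof.
move=> cg; elim: N => [|N IH].
  rewrite win.unlock big_seq1 /= (@eq_intT _ _ _ (fun=> 0)) ?intT_cst ?mul0r // => s.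
  by rewrite !waveE !mul0r oppr0 !add0r cosN cos_pihalf mulr0.
rewrite (perm_big _ (win_perm N)) 2!big_cons IH /= addr0; apply/eqP; rewrite addr_eq0; apply/eqP.
rewrite -[RHS]mulN1r -intTZ; last by apply: continuousM => //; exact: continuous_wave.
apply: eq_intT => s; rewrite [RHS]mulN1r -[RHS]mulrN; congr (_ * _); rewrite !waveE.
move: (N.+1%:Z) => k; rewrite !addrA !cosBpihalf -sinN; congr sin.
by rewrite rmorphN /=; ring.
Qed.

Lemma fourier_term (k : int) i j t : (cis (k%:~R * om * t) *: F k) i j = Complex
  (T^-1 * (intT (fun s => u i j s * wave k (- (k%:~R * om * t)) s) +
           intT (fun s => v i j s * wave k (- (k%:~R * om * t) - pi / 2) s)))
  (T^-1 * (intT (fun s => v i j s * wave k (- (k%:~R * om * t)) s) -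
           intT (fun s => u i j s * wave k (- (k%:~R * om * t) - pi / 2) s))).
Proof.
have cu : continuous (u i j) by exact: (@part_continuous_self (i, j, true)).
have cv : continuous (v i j) by exact: (@part_continuous_self (i, j, false)).
have cw ph (g : R -> R) : continuous g -> continuous (fun s => g s * wave k ph s).
  by move=> cg; apply: continuousM => //; exact: continuous_wave.
rewrite mxE fourier_coefE; set th := k%:~R * om * t.
have ang1 (g : R -> R) : continuous g -> intT (fun s => g s * wave k (- th) s) =
    cos th * intT (fun s => g s * wave k 0 s) +
    sin th * intT (fun s => g s * wave k (- (pi / 2)) s).
  move=> cg; rewrite -!intTZ; try exact: cw.
  rewrite -intTD; [|by apply: continuousZ; exact: cw|by apply: continuousZ; exact: cw].
  apply: eq_intT => s; rewrite !waveE addr0 cosBpihalf cosB; ring.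
have ang2 (g : R -> R) : continuous g -> intT (fun s => g s * wave k (- th - pi / 2) s) =
    cos th * intT (fun s => g s * wave k (- (pi / 2)) s) +
    (- sin th) * intT (fun s => g s * wave k 0 s).
  move=> cg; rewrite -!intTZ; try exact: cw.
  rewrite -intTD; [|by apply: continuousZ; exact: cw|by apply: continuousZ; exact: cw].
  apply: eq_intT => s; rewrite !waveE addr0 addrA !cosBpihalf sinB; ring.
rewrite !ang1 // !ang2 // /cis.
by congr Complex; rewrite /=; ring.
Qed.

Lemma fourier_inversion t :
  mxcvg (fun N => \sum_(k <- win N) cis (k%:~R * om * t) *: F k) (f t).
Proof.
have [c hc] := fourier_coef_summable.
pose G k := cis (k%:~R * om * t) *: F k.
have hG : summable_by G c.
  by move=> s us; under eq_bigr do rewrite enorm_cisZ; exact: hc.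
have cvG := win_cvg hG.
have zE := mxcvg_lim cvG.
have -> // : f t = mxlim (fun N => \sum_(k <- win N) G k).
apply: part_inj => q.
have -> : part (mxlim (fun N => \sum_(k <- win N) G k)) q =
    limn (fun N => part (\sum_(k <- win N) G k) q : R).
  by case: q => -[i j] []; rewrite /part /= mxE.
pose w k := intT (fun s => part (f s) q * wave k (- (k%:~R * om * t)) s).
have pE : (fun N => part (\sum_(k <- win N) G k) q : R) =
    (fun N => T^-1 * \sum_(k <- win N) w k).
  apply/funext => N.
  have -> : part (\sum_(k <- win N) G k) q = \sum_(k <- win N) part (G k) q.
    elim: (win N) => [|k s IH]; first by rewrite !big_nil part0.
    by rewrite !big_cons partD IH.
  have cu i j : continuous (u i j) by exact: (@part_continuous_self (i, j, true)).
  have cv i j : continuous (v i j) by exact: (@part_continuous_self (i, j, false)).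
  rewrite /w mulr_sumr; case: q {cvG w} => -[i j] []; rewrite /part /=.
    under eq_bigr do rewrite fourier_term /= mulrDr.
    by rewrite big_split /= -[X in _ + X]mulr_sumr odd_sum // mulr0 addr0.
  under eq_bigr do rewrite fourier_term /= mulrBr.
  by rewrite sumrB -[X in _ - X]mulr_sumr odd_sum // mulr0 subr0.
have := cvG q; rewrite pE => cvw.
have Tn : T != 0 by rewrite gt_eqF.
have : (fun N => \sum_(k <- win N) w k : R) @ \oo -->
    T * limn (fun N => T^-1 * \sum_(k <- win N) w k : R).
  rewrite [X in X @ _ --> _](_ : _ = (fun N => T * (T^-1 * \sum_(k <- win N) w k))).
    by apply: cvgM; [exact: cvg_cst|exact: cvw].
  by apply/funext => N; rewrite mulVKf.
move=> /(fourier_limit T_gt0 (@part_continuous_self q) (part_periodic q)).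
by move=> /(mulfI Tn) ->.
Qed.

End FourierMatrix.

(** * The equivalence *)

Section Assembly.
Variables (R : realType) (d n : nat) (tau : 'I_n.+1 -> R) (T : R)
  (D : 'I_n.+1 -> R -> 'M[R[i]]_d) (c : R).
Notation F := (fun j => fourier_coef T (D j)).
Hypothesis F_summable : forall j, summable_by (F j) c.
Hypothesis F_inversion : forall j t,
  mxcvg (fun N => \sum_(k <- win N) cis (k%:~R * (2 * pi / T) * t) *: F j k) (D j t).

Lemma l2_L2by_norm (x : zseq R d) : l2 x -> L2by x (l2norm x).
Proof. by move=> /l2_L2by; apply. Qed.

Lemma harmonic_operator_l2 p (x : zseq R d) :
  l2 x -> harmonic_operator tau T D p x = harm tau T F p x.
Proof. by move=> /l2_L2by_norm hx; rewrite (harmonic_operatorE tau p F_summable hx). Qed.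

Lemma l2_comb (a : R[i]) (x y : zseq R d) : l2 x -> l2 y -> l2 (fun k => a *: x k + y k).
Proof.
move=> /l2_L2by_norm hx /l2_L2by_norm hy.
have hax : L2by (fun k => a *: x k) (Num.sqrt (cabs2 a) * l2norm x).
  by apply: (L2by_scale _ hx) => [|k]; rewrite ?sqrtr_ge0 // enormZ.
by have [] := L2by_l2 (L2byD hax hy).
Qed.

Lemma bounded_harmonic p : bounded_operator (harmonic_operator tau T D p).
Proof.
have [B B0 hB] := harm_L2by tau F_summable F_inversion p.
have main x : l2 x -> l2 (harmonic_operator tau T D p x) /\
    l2norm (harmonic_operator tau T D p x) <= B * l2norm x.
  by move=> lx; rewrite harmonic_operator_l2 //; apply: L2by_l2; apply: hB; exact: l2_L2by_norm.
split; [by move=> x /main[]| |by exists B => x /main[]].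
move=> a x y lx ly; rewrite !harmonic_operator_l2 //; last exact: l2_comb.
by apply: harm_linear; [exact: F_summable|exact: l2_L2by_norm|exact: l2_L2by_norm].
Qed.

(** Being a two-sided inverse of a linear map on l^2, [B] is linear there. *)
Lemma inverse_of_bound p (M : R) (B : zseq R d -> zseq R d) :
  (forall x C, L2by x C -> L2by (B x) (M * C)) ->
  (forall x C, L2by x C -> harm tau T F p (B x) = x) ->
  (forall x C, L2by x C -> B (harm tau T F p x) = x) ->
  is_inverse (harmonic_operator tau T D p) B.
Proof.
move=> hM hr hl.
have main x : l2 x -> l2 (B x) /\ l2norm (B x) <= M * l2norm x.
  by move=> /l2_L2by_norm /hM /L2by_l2.
have lB x : l2 x -> l2 (B x) by move=> /main[].
have hr' x : l2 x -> harm tau T F p (B x) = x by move=> /l2_L2by_norm /hr.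
have hl' x : l2 x -> B (harm tau T F p x) = x by move=> /l2_L2by_norm /hl.
split; first exact: bounded_harmonic.
- split => //; last by exists M => x /main[].
  move=> a x y lx ly; rewrite -{1}(hr' x lx) -{1}(hr' y ly).
  rewrite -(harm_linear tau T F_summable p a (l2_L2by_norm (lB x lx)) (l2_L2by_norm (lB y ly))).
  by rewrite hl' //; apply: l2_comb; exact: lB.
- by move=> x lx; rewrite harmonic_operator_l2 // hl'.
- by move=> x lx; rewrite harmonic_operator_l2 ?hr' //; exact: lB.
Qed.

(** Two inverses agree on l^2, so the bound for one holds for all. *)
Lemma opnorm_inverse_le p (M : R) (B S : zseq R d -> zseq R d) : 0 <= M ->
  (forall x C, L2by x C -> L2by (B x) (M * C)) ->
  is_inverse (harmonic_operator tau T D p) B ->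
  is_inverse (harmonic_operator tau T D p) S ->
  (opnorm S <= M%:E)%E.
Proof.
move=> M0 hM [_ [lB _ _] _ hr] [_ _ hl _].
apply: ge_ereal_sup => _ [x [lx x1] <-]; rewrite lee_fin.
have -> : S x = B x by rewrite -{1}(hr x lx) hl //; exact: lB.
have [_ h] := L2by_l2 (hM _ _ (l2_L2by_norm lx)).
by apply: le_trans h _; rewrite ler_piMr.
Qed.

(** The operator norm bounds [S] on the unit ball only: [harm p x] is divided by
    slightly more than its norm, which may be zero. *)
Lemma lower_bound_of_opnorm p (M : R) (S : zseq R d -> zseq R d) : 0 <= M ->
  is_inverse (harmonic_operator tau T D p) S -> (opnorm S <= M%:E)%E ->
  forall x C C', L2by x C' -> L2by (harm tau T F p x) C -> L2by x (M * C).
Proof.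
move=> M0 [_ [lS linS _] hl _] hM x C C' hx hy.
have [lx _] := L2by_l2 hx; have [ly ynorm] := L2by_l2 hy.
have Sy : S (harm tau T F p x) = x by rewrite -harmonic_operator_l2 // hl.
set y := harm tau T F p x in hy ly ynorm Sy.
apply: l2_L2by => //; apply/ler_addgt0Pl => e e0.
pose e' := e / (M + 1); have M1 : 0 < M + 1 by rewrite ltr_wpDl.
have e'0 : 0 < e' by rewrite divr_gt0.
pose a := C + e'; have C0 := L2by_ge0 hy; have a0 : 0 < a by rewrite ltr_wpDl.
pose b : R[i] := Complex a^-1 0.
have l0 : l2 (fun=> 0 : 'cV[R[i]]_d) by have [] := L2by_l2 (@L2by0 R d).
have nb : Num.sqrt (cabs2 b) = a^-1.
  by rewrite /cabs2 /= expr0n addr0 sqrtr_sqr gtr0_norm // invr_gt0.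
have S0 : S (fun=> 0) = (fun=> 0).
  have := linS 1 _ _ l0 l0.
  rewrite (_ : (fun k => 1 *: 0 + 0) = fun=> 0); last by apply/funext => k; rewrite scaler0 addr0.
  move=> /(congr1 (fun f : zseq R d => fun k => f k - S (fun=> 0) k)).
  move=> h; apply/funext => k; move/(congr1 (@^~ k)): h.
  by rewrite scale1r subrr addrK.
pose w : zseq R d := fun k => b *: y k.
have hw : L2by w 1.
  have : L2by w (a^-1 * C).
    by apply: (L2by_scale _ hy) => [|k]; rewrite ?invr_ge0 ?(ltW a0) // /w enormZ nb.
  move=> /L2by_le; apply; rewrite mulrC ler_pdivrMr // mul1r /a lerDl; exact: ltW.
have [lw w1] := L2by_l2 hw.
have Sw : S w = fun k => b *: x k.
  have := linS b y _ ly l0; rewrite S0 Sy.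
  rewrite (_ : (fun k => b *: y k + 0) = w); last by apply/funext => k; rewrite addr0.
  by move=> ->; apply/funext => k; rewrite addr0.
have : l2norm (S w) <= M.
  rewrite -lee_fin; apply: le_trans hM; apply: ereal_sup_ubound.
  by exists w.
move=> /(l2_L2by (lS w lw)); rewrite Sw => hbx.
have : L2by x (a * M).
  apply: (L2by_scale _ hbx) => [|k]; first exact: ltW.
  by rewrite enormZ nb mulVKf // gt_eqF.
move=> /L2by_l2[_ h]; apply: le_trans h _.
rewrite /a mulrDl [C * M]mulrC addrC lerD2r.
rewrite /e' mulrAC ler_pdivrMr // ler_pM2l //; lra.
Qed.

End Assembly.

Theorem theorem3 (R : realType) (d n : nat) (hd : (0 < d)%N)
    (tau : 'I_n.+1 -> R) (T : R) (D : 'I_n.+1 -> R -> 'M[R[i]]_d)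
    (htau0 : 0 < tau ord0)
    (htau : forall j k : 'I_n.+1, (j < k)%N -> tau j < tau k)
    (hT : tau ord_max < T)
    (hper : forall (j : 'I_n.+1) (t : R), D j (t + T) = D j t)
    (hdiff : forall j : 'I_n.+1, mx_derivable (D j))
    (hhoelder : forall j : 'I_n.+1, hoelder_continuous (mx_derive (D j))) :
  exponentially_stable tau D <->
  exists2 beta : R, beta < 0 &
    (forall p : R[i], beta <= complex.Re p ->
       invertible (harmonic_operator tau T D p)) /\
    (exists2 M : R, 0 < M &
       forall p : R[i], beta <= complex.Re p ->
       forall Rinv : zseq R d -> zseq R d,
         is_inverse (harmonic_operator tau T D p) Rinv ->
         (opnorm Rinv <= M%:E)%E).
Proof.
have tau_min j : tau ord0 <= tau j.
  have [->|j0] := eqVneq j ord0; first exact: lexx.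
  by apply/ltW/htau; rewrite lt0n.
have tau_max j : tau j <= tau ord_max.
  have [->|jm] := eqVneq j ord_max; first exact: lexx.
  by apply/ltW/htau; rewrite ltn_neqAle jm -ltnS ltn_ord.
have T_gt0 : 0 < T by rewrite (lt_trans htau0) // (le_lt_trans (tau_min ord_max)).
have /choice[cs hcs] j := fourier_coef_summable T_gt0 (hper j) (hdiff j) (hhoelder j).
pose c := \sum_j cs j.
have cs0 j : 0 <= cs j by have := hcs j [::] isT; rewrite big_nil.
have F_summable j : summable_by (fourier_coef T (D j)) c.
  move=> s us; apply: le_trans (hcs j s us) _.
  by rewrite /c (bigD1 j) //= lerDl sumr_ge0.
have F_inversion j t := fourier_inversion T_gt0 (hper j) (hdiff j) (hhoelder j) t.
split=> [stable|[beta beta0 [inv [M M0 hM]]]].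
  have D_cont j : part_continuous (D j) by exact: (part_continuous_self (hdiff j)).
  have [g [K [g0 K0 decay]]] := decay_of_stable htau0 tau_min tau_max D_cont stable.
  have [M M0 hM] := harm_inverse T_gt0 F_summable F_inversion htau0 tau_min tau_max g0 K0 decay.
  exists (- (g / 2)); first by rewrite oppr_lt0 divr_gt0.
  have hinv p : - (g / 2) <= complex.Re p -> exists2 B,
      is_inverse (harmonic_operator tau T D p) B &
      forall x C, L2by x C -> L2by (B x) (M * C).
    by move=> /hM[B [h1 h2 h3]]; exists B => //; apply: (inverse_of_bound F_summable F_inversion h1).
  split=> [p /hinv[B hB _]|]; first by exists B.
  exists M => // p /hinv[B hB hBM] S hS.
  exact: (opnorm_inverse_le (ltW M0) hBM hB hS).
left; apply: (C0_stable_of_decay htau0 tau_min tau_max (D_bounded F_summable F_inversion)).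
apply: (decay_of_lower_bound htau0 tau_min tau_max (D_bounded F_summable F_inversion) beta0 (ltW M0)).
move=> S u us u_out u_del b hb.
apply: (lower_bound_discrete T_gt0 F_summable F_inversion (ltW M0) _ us u_out u_del hb).
move=> p x C C' hp; have [B hB] := inv p hp.
exact: (lower_bound_of_opnorm F_summable (ltW M0) hB (hM p hp B hB)).
Qed.
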